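(* There exist universal constants $c,C>0$ such that the following holds. Let $n\geq 1$ and $2n\leq N\leq 2^n$. Let $G_1,\dots,G_N$ be independent random vectors in $\mathbb{R}^n$, $G_i=(G_{i,1},\dots,G_{i,n})$, satisfying: (a) the random variables $G_{i,j}$ ($1\le i\le N$, $1\le j\le n$) are independent; (b) for all $i,j$: $\mathbb{E}G_{i,j}=0$, $\mathbb{E}G_{i,j}^2=1$ and $\mathbb{E}\exp(G_{i,j}^2/10)\leq 10$. Set $\mathcal T=\mathrm{conv}\{\pm G_1,\dots,\pm G_N\}$. Then with probability greater than $1-Ce^{-cn}$, $L_{\mathcal T}<C$.
   Context: For a convex body $\mathcal K\subset\mathbb{R}^n$ (compact convex set with nonempty interior), the isotropic constant $L_{\mathcal K}$ is defined by $$nL_{\mathcal K}^2=\inf_{T}\frac{1}{\mathrm{vol}_n(\mathcal K)^{1+2/n}}\int_{\mathcal K}|Tx|^2\,dx,$$ where the infimum runs over all volume-preserving affine maps $T:\mathbb{R}^n\to\mathbb{R}^n$ and $|\cdot|$ is the Euclidean norm. The constants do not depend on $n,N$ or the distributions. (Example: coordinates that are independent symmetric $\pm1$ Bernoulli variables satisfy (a),(b).) *)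

(* Defs.v *)
From HB Require Import structures.
From mathcomp Require Import all_boot all_order all_algebra.
From mathcomp Require Import all_classical all_reals all_analysis.
Set Implicit Arguments. Unset Strict Implicit. Unset Printing Implicit Defensive.
Import Order.TTheory GRing.Theory Num.Theory.
Import numFieldNormedType.Exports.
Local Open Scope classical_set_scope.
Local Open Scope ring_scope.

Section Defs.
Variable R : realType.

Definition sqnorm m (x : 'rV[R]_m) : R := \sum_(j < m) x 0 j ^+ 2.

Definition box m (a b : 'rV[R]_m) : set 'rV[R]_m :=
  [set x | forall j, a 0 j <= x 0 j <= b 0 j].
Definition box_vol m (a b : 'rV[R]_m) : R :=
  \prod_(j < m) Num.max 0 (b 0 j - a 0 j).

Definition leb_outer m (S : set 'rV[R]_m) : \bar R :=
  ereal_inf [set s : \bar R | exists (a b : nat -> 'rV[R]_m),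
     S `<=` \bigcup_k box (a k) (b k) /\
     s = (\sum_(k <oo) (box_vol (a k) (b k))%:E)%E].

Definition vol m (S : set 'rV[R]_m) : R := fine (leb_outer S).

(** Lebesgue integral over K of a nonnegative function f : R^m -> R, defined
    as the (m+1)-dimensional Lebesgue measure of the region under its graph. *)
Definition subgraph m (K : set 'rV[R]_m) (f : 'rV[R]_m -> R) :
    set 'rV[R]_(m + 1) :=
  [set z | K (lsubmx z) /\ 0 <= rsubmx z 0 0 <= f (lsubmx z)].
Definition integral_nonneg m (K : set 'rV[R]_m) (f : 'rV[R]_m -> R) : R :=
  fine (leb_outer (subgraph K f)).

Definition vol_preserving_affine m (T : 'rV[R]_m -> 'rV[R]_m) : Prop :=
  exists (A : 'M[R]_m) (b : 'rV[R]_m),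
    `|\det A| = 1 /\ forall x, T x = x *m A + b.

Definition isotropic_functional n (K : set 'rV[R]_n) : R :=
  inf [set q : R | exists T : 'rV[R]_n -> 'rV[R]_n,
         vol_preserving_affine T /\
         q = integral_nonneg K (fun x => sqnorm (T x)) /
             (vol K `^ (1 + 2 / n%:R))].

Definition isotropic_constant n (K : set 'rV[R]_n) : R :=
  Num.sqrt (isotropic_functional K / n%:R).

Definition convex_Rn n (K : set 'rV[R]_n) : Prop :=
  forall x y (t : R), K x -> K y -> 0 <= t <= 1 -> K (t *: x + (1 - t) *: y).
Definition convex_body n (K : set 'rV[R]_n) : Prop :=
  compact K /\ convex_Rn K /\ interior K !=set0.

Definition sym_conv_hull n N (v : 'I_N -> 'rV[R]_n) : set 'rV[R]_n :=
  [set x | exists (l m : 'I_N -> R),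
     (forall i, 0 <= l i) /\ (forall i, 0 <= m i) /\
     \sum_(i < N) (l i + m i) = 1 /\
     x = \sum_(i < N) (l i - m i) *: v i].

Definition mutually_independent d (Omega : measurableType d)
    (P : probability Omega R) (I : finType) (X : I -> Omega -> R) : Prop :=
  (forall i, measurable_fun setT (X i)) /\
  forall (J : {set I}) (B : I -> set R), (forall i, measurable (B i)) ->
    P (\bigcap_(i in [set i | i \in J]) (X i @^-1` B i)) =
    (\prod_(i in J) fine (P (X i @^-1` B i)))%:E.

End Defs.

(* Main.v *)
Require Import Defs.
From HB Require Import structures.
From mathcomp Require Import all_boot all_order all_algebra.
From mathcomp Require Import all_classical all_reals all_analysis.
From mathcomp Require Import measurable_realfun perm ring lra zify.
Set Implicit Arguments. Unset Strict Implicit. Unset Printing Implicit Defensive.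
Import Order.TTheory GRing.Theory Num.Theory.
Import numFieldNormedType.Exports.
Local Open Scope classical_set_scope.
Local Open Scope ring_scope.

(** The identity is an admissible affine map, so it suffices to bound
    [\int_K |x|^2 / vol(K)^(1 + 2/n)] by [C n] for the random polytope [K].

    Second moment. A generic positive cost on the vertices triangulates [K] into
    the cones [conv(0, w_1, .., w_n)] over the dual feasible bases of the linear
    program of writing [x] as a cheapest nonnegative combination of vertices. On such
    a simplex the average of [|x|^2] is at most
    [(|\sum w_k|^2 + \sum |w_k|^2) / (n (n+1))]. A Chernoff bound and a net of the
    unit ball show that all signed sums of [n] of the [G_i] have norm
    [O(n sqrt(ln (N/n)))], except on an event of probability [e^-n].

    Volume, [N/n] bounded. Run through the rows and keep a row as soon as its
    projection to the orthogonal complement of the rows kept so far has at least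
    half of the expected squared length; an exponential potential shows that all
    but [C e^(-c n)] of the time [n] rows are kept. The matrix they form has squared
    determinant at least [n! / 2^n].

    Volume, [N/n] large. For each coordinate choose a bounded [phi] with
    [E phi(g) = 0] and [E (phi(g) g) = 1]. The weights
    [W_i = \prod_j (1 + x_j phi(G_ij))] satisfy [E W_i = 1] and [E (W_i G_i) = x],
    and their moments are at most [exp (C |x|^2)], a small power of [N/n] when
    [|x|^2] is a small multiple of [ln (N/n)]. Truncating and averaging over [i]
    exhibits, with overwhelming probability, a point of [2 K] near every vertex [x]
    of a cube of half-side [c sqrt(ln (N/n) / n)], and near every point of a net of
    a small ball. Successive approximation absorbs the errors, so [5 K] contains
    the cube. The assumption [N <= 2^n] keeps [1 + x_j phi] positive. *)

(** [vol] and the integral are infima over box covers. An upper bound on the integral thus needs a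
    cover of the region under the graph, and a lower bound on the volume needs an inscribed
    parallelepiped. Both rest on how outer measure behaves under linear maps, obtained by factoring
    a matrix into permutations, diagonal matrices and shears.

    Neither volume bound suffices alone. With [q = N/n], the average of [|x|^2] is only bounded by a
    multiple of [ln q + 1], so the volume radius has to be of order [sqrt(ln q / n)]. The greedy
    rows give [1 / sqrt(2 e q n)], which is enough only for bounded [q]. Tilting loses [1/tau] in
    every direction by truncation, which must be small against a fixed radius [c]; this forces
    [q = tau ^ 8] to be large. The power 8 comes from the Chernoff exponents: weights bounded by
    [tau ^ 2] give exponents of order [N / tau ^ 4 = n tau ^ 4], which beat union bounds over
    exponentially many (in [n]) points once [tau] is a large constant.

    Dimension 1 is not treated geometrically: [C] exceeds [exp gam], so the probability bound is
    negative there. *)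

(** * Outer measure by box covers; the volume of a box *)

Section outer.
Context {R : realType}.
Local Open Scope ereal_scope.

Lemma box_vol_ge0 m (a b : 'rV[R]_m) : (0 <= box_vol a b)%R.
Proof. by apply: prodr_ge0 => j _; rewrite le_max lexx. Qed.

Lemma leb_outer_ge0 m (S : set 'rV[R]_m) : 0 <= leb_outer S.
Proof.
apply: le_ereal_inf_tmp => _ [a [b [_ ->]]].
by apply: nneseries_ge0 => k _ _; rewrite lee_fin box_vol_ge0.
Qed.

Lemma leb_outer_cover m (S : set 'rV[R]_m) (a b : nat -> 'rV[R]_m) :
  S `<=` \bigcup_k box (a k) (b k) ->
  leb_outer S <= \sum_(k <oo) (box_vol (a k) (b k))%:E.
Proof. by move=> Sab; apply: ereal_inf_lbound; exists a, b. Qed.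

Lemma le_leb_outer m : {homo @leb_outer R m : A B / A `<=` B >-> A <= B}.
Proof.
move=> A B AB; apply: le_ereal_inf_tmp => _ [a [b [Bab ->]]].
by apply: leb_outer_cover; exact: subset_trans Bab.
Qed.

(** False in dimension 0, where the empty product gives every box volume 1; hence the outer measure
    structure is set up in dimension [m.+1]. *)
Lemma box_vol_nil m (a : 'rV[R]_m.+1) : box_vol a a = 0%R.
Proof. by rewrite /box_vol big_ord_recl subrr maxxx mul0r. Qed.

Lemma leb_outer_box_le m (a b : 'rV[R]_m.+1) :
  leb_outer (box a b) <= (box_vol a b)%:E.
Proof.
(* The box itself comes first; the remaining boxes are degenerate and add 0. *)
pose b' k := if k is 0%N then b else a.
have : box a b `<=` \bigcup_k box a (b' k) by move=> x abx; exists 0%N.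
move=> /leb_outer_cover/le_trans; apply.
rewrite nneseries_recl//; last by move=> k _; rewrite lee_fin box_vol_ge0.
rewrite eseries_cond/= eseries0 ?adde0// => -[|]//= k _ _.
by rewrite box_vol_nil.
Qed.

Lemma leb_outer0 m : @leb_outer R m.+1 set0 = 0.
Proof.
apply/eqP; rewrite eq_le leb_outer_ge0 andbT.
have := leb_outer_box_le (0 : 'rV[R]_m.+1) 0.
by rewrite box_vol_nil; apply: le_trans; exact: le_leb_outer.
Qed.

Lemma leb_outer_near m (S : set 'rV[R]_m) (e : R) : (0 < e)%R ->
  leb_outer S != +oo -> exists ab : nat -> 'rV[R]_m * 'rV[R]_m,
    S `<=` \bigcup_k box (ab k).1 (ab k).2 /\
    \sum_(k <oo) (box_vol (ab k).1 (ab k).2)%:E <= leb_outer S + e%:E.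
Proof.
move=> e0 Soo; have Sfin : leb_outer S \is a fin_num.
  by rewrite ge0_fin_numE ?leb_outer_ge0// ltey.
have [x [a [b [Sab ->]]] xS] := lb_ereal_inf_adherent e0 Sfin.
by exists (fun k => (a k, b k)); split => //; exact: ltW.
Qed.

(** Each [A n] is covered up to [e / 2 ^ n.+1], and the double family of boxes is listed along a
    bijection of [nat] with [nat * nat]. An [A i] of infinite outer measure makes the right side
    infinite. *)
Lemma leb_outer_sigma_subadditive m : sigma_subadditive (@leb_outer R m).
Proof.
move=> A; have [[i ioo]|] := pselect (exists i, leb_outer (A i) = +oo).
  rewrite (eseries_pinfty _ _ ioo) ?leey// => n _.
  by rewrite -ltNye (lt_le_trans _ (leb_outer_ge0 _)).
rewrite -forallNE => Aoo.
suff add2e (e : {posnum R}) :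
    leb_outer (\bigcup_n A n) <= \sum_(i <oo) leb_outer (A i) + e%:num%:E.
  by apply/lee_addgt0Pr => _/posnumP[].
rewrite (le_trans _ (epsilon_trick _ _ _))//; last first.
  by move=> n; exact: leb_outer_ge0.
pose P n (ab : nat -> 'rV[R]_m * 'rV[R]_m) :=
  A n `<=` \bigcup_k box (ab k).1 (ab k).2 /\
  \sum_(k <oo) (box_vol (ab k).1 (ab k).2)%:E
    <= leb_outer (A n) + (e%:num / (2 ^ n.+1)%:R)%:E.
have [G PG] : {G : nat -> nat -> 'rV[R]_m * 'rV[R]_m & forall n, P n (G n)}.
  apply: (@choice _ _ P) => n; apply: leb_outer_near => //.
  by apply/eqP; exact: Aoo.
pose v (p : 'rV[R]_m * 'rV[R]_m) : \bar R := (box_vol p.1 p.2)%:E.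
have v_ge0 x : 0 <= (v \o uncurry G) x by rewrite lee_fin box_vol_ge0.
apply: (@le_trans _ _ (\esum_(i in setT) (v \o uncurry G) i)).
  have /card_esym/ppcard_eqP[f] := card_nat2.
  have /leb_outer_cover : \bigcup_n A n `<=` \bigcup_k
      box (uncurry G (f k)).1 (uncurry G (f k)).2.
    apply: (@subset_trans _ (\bigcup_n \bigcup_k box (G n k).1 (G n k).2)).
      by move=> t [i _] /((PG i).1) [j _ ?]; exists i => //; exists j.
    move=> t [i _ [j _ Bijt]]; exists (f^-1%FUN (i, j)) => //=.
    by rewrite invK ?inE.
  move=> /le_trans; apply.
  rewrite (_ : \sum_(k <oo) _ = \sum_(k <oo) (v \o uncurry G) (f k))//.
  rewrite -(esum_pred_image (v \o uncurry G) _ xpredT) ?[fun=> _]set_true//.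
  by rewrite image_eq.
rewrite (_ : esum _ _ = \sum_(i <oo) \sum_(j <oo ) v (G i j)); last first.
  pose J : nat -> set (nat * nat) := fun i => [set (i, j) | j in setT].
  rewrite (_ : setT = \bigcup_k J k); last first.
    by rewrite predeqE => -[a b]; split => // _; exists a => //; exists b.
  rewrite esum_bigcupT /=; last 2 first.
    - apply/trivIsetP => i j _ _ ij.
      rewrite predeqE => -[n k] /=; split => //= -[] [_] _ [<-{n} _].
      by move=> [m' _] [] /esym/eqP; rewrite (negbTE ij).
    - by move=> /= [n k]; exact: v_ge0.
  rewrite -(image_id [set: nat]) -fun_true esum_pred_image//; last first.
    by move=> n _; apply: esum_ge0 => x _; exact: v_ge0.
  apply: eq_eseriesr => /= j _.
  rewrite -(esum_pred_image (v \o uncurry G) (pair j) predT)//=; last 2 first.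
    by move=> n _; exact: (v_ge0 (j, n)).
    by move=> ? ? _ _; exact: (@can_inj _ _ _ snd).
  by congr esum; rewrite predeqE => -[a b]; split; move=> [i _ <-]; exists i.
apply: lee_nneseries.
- by move=> i _ _; apply: nneseries_ge0 => k _ _; exact: (v_ge0 (i, k)).
- by move=> n _; exact: (PG n).2.
Qed.

HB.instance Definition _ m := isOuterMeasure.Build R 'rV[R]_m.+1
  (@leb_outer R m.+1) (leb_outer0 m) (@leb_outer_ge0 m.+1)
  (@le_leb_outer m.+1) (@leb_outer_sigma_subadditive m.+1).

Lemma leb_outer_finU m (I : finType) (F : I -> set 'rV[R]_m.+1) :
  leb_outer (\bigcup_i F i) <= \sum_i leb_outer (F i).
Proof.
have -> : \bigcup_i F i = \big[setU/set0]_(i : I) F i.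
  by rewrite -bigcup_seq; apply: eq_bigcupl; split => i //= _; rewrite mem_index_enum.
elim/big_ind2: _ => [|A x B y Ax By|//]; first by rewrite leb_outer0.
by apply: le_trans (leeD Ax By); exact: outer_measureU2.
Qed.

Let tl m (a : 'rV[R]_m.+1) : 'rV[R]_m := \row_j a 0%R (lift ord0 j).

Let box_vol_tl m (a b : 'rV[R]_m.+1) :
  box_vol a b = (Num.max 0 (b 0 0 - a 0 0) * box_vol (tl a) (tl b))%R.
Proof.
rewrite /box_vol big_ord_recl; congr (_ * _)%R.
by apply: eq_bigr => j _; rewrite !mxE.
Qed.

Let integral_cst_itv (c u v : R) : (0 <= c)%R ->
  \int[lebesgue_measure]_t (c * \1_(`[u, v]%classic) t)%:E =
  (c * Num.max 0 (v - u))%:E.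
Proof.
move=> c0; under eq_integral do rewrite EFinM.
rewrite ge0_integralZl_EFin//; last first.
  by apply/measurable_EFinP; exact: measurable_indic.
rewrite integral_indic// setIT EFinM; congr (_ * _).
have /= -> := @lebesgue_measure_itv R `[u, v].
rewrite lte_fin; case: ltP => uv; first by rewrite max_r// subr_ge0 ltW.
by rewrite max_l// subr_le0.
Qed.

(* Induction on the dimension: slice along the first coordinate and integrate
   the inequality between the volumes of the slices. *)
Lemma box_vol_le_cover m (a b : 'rV[R]_m) (A B : nat -> 'rV[R]_m)
    (p : nat -> bool) :
  (forall j, a 0%R j <= b 0%R j)%R ->
  box a b `<=` \bigcup_(k in [set k | p k]) box (A k) (B k) ->
  (box_vol a b)%:E <= \sum_(k <oo) ((p k)%:R * box_vol (A k) (B k))%:E.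
Proof.
have vge0 d (x y : nat -> 'rV[R]_d) (q : nat -> bool) k :
    (0 <= (q k)%:R * box_vol (x k) (y k))%R by rewrite mulr_ge0 ?box_vol_ge0.
elim: m => [|m ih] in a b A B p *.
  (* In dimension 0 all volumes are 1, so a single box of the cover already gives the bound. *)
  move=> _ /(_ a)[[]//|k /= pk _].
  rewrite (nneseries_split _ k.+1); last by move=> i _; rewrite lee_fin.
  rewrite -[leLHS]adde0 leeD//; last first.
    by apply: nneseries_ge0 => i _ _; rewrite lee_fin.
  rewrite big_nat_recr//= pk mul1r /box_vol !big_ord0 -[leLHS]add0e leeD//.
  by apply: sume_ge0 => i _; rewrite lee_fin -/(box_vol (A i) (B i)) vge0.
move=> ab abAB.
pose F k t : R := ((p k)%:R * box_vol (tl (A k)) (tl (B k))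
                   * \1_(`[A k 0 0, B k 0 0]%classic) t)%R.
have F0 k t : (0 <= F k t)%R by rewrite !mulr_ge0 ?box_vol_ge0.
have mF k : measurable_fun [set: R] (fun t => (F k t)%:E).
  by apply/measurable_EFinP; apply: measurable_funM.
have -> : \sum_(k <oo) ((p k)%:R * box_vol (A k) (B k))%:E =
    \sum_(k <oo) \int[lebesgue_measure]_t (F k t)%:E.
  apply: eq_eseriesr => k _; rewrite [RHS]integral_cst_itv ?mulr_ge0 ?box_vol_ge0//.
  rewrite (box_vol_tl (A k)).
  by congr EFin; ring.
rewrite -integral_nneseries//; last by move=> k t _; rewrite lee_fin.
rewrite box_vol_tl mulrC -integral_cst_itv ?box_vol_ge0//.
apply: ge0_le_integral => //.
- by move=> t _; rewrite lee_fin mulr_ge0 ?box_vol_ge0.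
- by apply/measurable_EFinP; apply: measurable_funM.
- by apply: ge0_emeasurable_sum => [k t _ _|k _]; [rewrite lee_fin|exact: mF].
move=> t _; rewrite indicE.
case: (boolP (t \in `[(a 0 0)%R, (b 0 0)%R]%classic)) => [|_]; last first.
  by rewrite mulr0 nneseries_ge0// => k _ _; rewrite lee_fin.
rewrite inE/= in_itv/= => abt; rewrite mulr1.
(* Only the boxes whose first side contains [t] meet the slice at height [t]; the flag [p] carries
   this selection through the induction. *)
have /(ih (tl a) (tl b) (fun k => tl (A k)) (fun k => tl (B k))
    (fun k => p k && (t \in `[A k 0 0, B k 0 0])%R)) :
    forall j, (tl a 0 j <= tl b 0 j)%R by move=> j; rewrite !mxE.
move=> /(_ _)/le_trans; apply.
  move=> y aby; pose x : 'rV[R]_m.+1 := (\row_i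
    if unlift ord0 i is Some j then y 0 j else t)%R.
  have x0 : (x 0 0 = t)%R by rewrite mxE unlift_none.
  have xS j : (x 0 (lift ord0 j) = y 0 j)%R by rewrite mxE liftK.
  have [k pk ABk] : (\bigcup_(k in [set k | p k]) box (A k) (B k)) x.
    apply: abAB => j; case: (unliftP ord0 j) => [i|] ->.
      by have := aby i; rewrite xS !mxE.
    by rewrite x0.
  exists k; first by rewrite /= pk/= in_itv/= -x0.
  by move=> j; have := ABk (lift ord0 j); rewrite xS !mxE.
apply: lee_nneseries => [k _ _|k _].
  by rewrite lee_fin mulr_ge0 ?box_vol_ge0.
rewrite lee_fin /F indicE mem_setE.
by case: (p k); case: (t \in _)%R => /=; rewrite ?(mul1r, mulr1, mul0r, mulr0).
Qed.

Lemma leb_outer_box m (a b : 'rV[R]_m.+1) : (forall j, a 0 j <= b 0 j)%R ->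
  leb_outer (box a b) = (box_vol a b)%:E.
Proof.
move=> ab; apply/eqP; rewrite eq_le leb_outer_box_le/=.
apply: le_ereal_inf_tmp => _ [A [B [abAB ->]]].
have /(box_vol_le_cover ab) :
    box a b `<=` \bigcup_(k in [set k | xpredT k]) box (A k) (B k).
  by move=> x /abAB[k _ ?]; exists k.
by under [X in _ <= X -> _]eq_eseriesr do rewrite mul1r.
Qed.

End outer.

(** * Caratheodory measurability; outer measure under linear maps *)

Section cara.
Context {R : realType} {m : nat}.
Local Notation V := 'rV[R]_m.+1.

Let max_split (a b t : R) :
  Num.max 0 (Num.min b t - a) + Num.max 0 (b - Num.max a t) <= Num.max 0 (b - a).
Proof.
rewrite !maxEle !minEle; case: (leP b t) => ?; case: (leP a t) => ?;
repeat match goal with |- context [if ?x <= ?y then _ else _] =>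
  case: (leP x y) => ? end; lra.
Qed.

(** The hyperplane [x_j = t] cuts a box into two boxes whose volumes add up to at most its own, so
    every cover of [X] splits into covers of the two parts. *)
Lemma caratheodory_le_coord (j : 'I_m.+1) (t : R) :
  (@leb_outer R m.+1).-caratheodory [set x : V | (x 0 j <= t)].
Proof.
apply: le_caratheodory_measurable => X; set H := [set x | _].
apply: le_ereal_inf_tmp => _ [a [b [Xab ->]]].
pose b' k : V := \row_i (if i == j then Num.min (b k 0 i) t else b k 0 i).
pose a' k : V := \row_i (if i == j then Num.max (a k 0 i) t else a k 0 i).
have /leb_outer_cover X1 : X `&` H `<=` \bigcup_k box (a k) (b' k).
  move=> x [/Xab[k _ abx] xt]; exists k => // i; rewrite !mxE.
  case/andP: (abx i) => -> xb; case: eqP => [ij|//].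
  by rewrite le_min xb/= ij.
have /leb_outer_cover X2 : X `&` ~` H `<=` \bigcup_k box (a' k) (b k).
  move=> x [/Xab[k _ abx] /negP]; rewrite -ltNge => xt; exists k => // i.
  case/andP: (abx i) => ax xb; rewrite !mxE xb andbT; case: eqP => [ij|//].
  by rewrite ge_max ax/= ij ltW.
apply: le_trans (leeD X1 X2) _.
rewrite -nneseriesD; try by move=> k _ _; rewrite lee_fin box_vol_ge0.
apply: lee_nneseries => [k _ _|k _].
  by apply: adde_ge0; rewrite lee_fin box_vol_ge0.
rewrite -EFinD lee_fin /box_vol (bigD1 j)//= [X in _ + X <= _](bigD1 j)//=.
rewrite [leRHS](bigD1 j)//= !mxE eqxx.
under eq_bigr => i /negbTE ij do rewrite !mxE ij.
under [X in (_ + _ * X <= _)]eq_bigr => i /negbTE ij do rewrite !mxE ij.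
rewrite -mulrDl ler_wpM2r ?max_split//.
by apply: prodr_ge0 => i _; rewrite le_max lexx.
Qed.

(** A cover by boxes is mapped to a cover by images of boxes. Boxes with a reversed side are empty,
    hence the restriction to [a <= b]. *)
Lemma lin_le_of_box (A : 'M[R]_m.+1) : A \in unitmx ->
  (forall a b : V, (forall j, a 0 j <= b 0 j) ->
     (leb_outer [set x *m A | x in box a b] <= (`|\det A| * box_vol a b)%:E)%E) ->
  forall S, (leb_outer [set x *m A | x in S] <= (`|\det A|)%:E * leb_outer S)%E.
Proof.
move=> Au H S; have A0 : (0 < `|\det A|).
  by rewrite normr_gt0 -unitfE -unitmxE.
rewrite -lee_pdivrMl//; apply: le_ereal_inf_tmp => _ [a [b [Sab ->]]].
rewrite lee_pdivrMl// -nneseriesZl//; last first.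
  by move=> k _; rewrite lee_fin box_vol_ge0.
apply: (@le_trans _ _ (leb_outer (\bigcup_k [set x *m A | x in box (a k) (b k)]))).
  by apply: le_leb_outer => _ [x /Sab[k _ abx] <-]; exists k => //; exists x.
apply: le_trans (leb_outer_sigma_subadditive _) _.
apply: lee_nneseries => [k _ _|k _]; first exact: leb_outer_ge0.
have [ab|/existsNP[j /negP]] := pselect (forall j, (a k 0 j <= b k 0 j)).
  by rewrite -EFinM; exact: H.
rewrite -ltNge => ba; rewrite (_ : [set _ | _ in _] = set0); last first.
  apply/seteqP; split => [y [x /(_ j)/andP[ax xb] _]|//].
  by have := le_trans ax xb; rewrite leNgt ba.
by rewrite leb_outer0 -EFinM lee_fin mulr_ge0 ?box_vol_ge0.
Qed.

(** Only the upper inequality is recorded: it is stable under products, and equality follows by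
    applying it to the inverse matrix as well. *)
Definition lin_le (A : 'M[R]_m.+1) := A \in unitmx /\
  forall S : set V, (leb_outer [set x *m A | x in S] <= (`|\det A|)%:E * leb_outer S)%E.

Lemma lin_leM A B : lin_le A -> lin_le B -> lin_le (A *m B).
Proof.
move=> [Au HA] [Bu HB]; split=> [|S]; first by rewrite unitmx_mul Au Bu.
have -> : [set x *m (A *m B) | x in S] =
    [set x *m B | x in [set x *m A | x in S]].
  by rewrite image_comp; apply: eq_imagel => x _ /=; rewrite mulmxA.
apply: le_trans (HB _) _; rewrite det_mulmx normrM mulrC EFinM -muleA.
by rewrite lee_wpmul2l ?lee_fin.
Qed.

Lemma lin_le1 : lin_le 1%:M.
Proof.
split=> [|S]; first exact: unitmx1.
rewrite det1 normr1 mul1e (_ : [set _ | _ in _] = S)//.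
by rewrite -[RHS]image_id; apply: eq_imagel => x _; rewrite mulmx1.
Qed.

Lemma lin_le_perm (s : 'S_m.+1) : lin_le (perm_mx s).
Proof.
have u : (perm_mx s : 'M[R]_m.+1) \in unitmx by exact: unitmx_perm.
split=> //; apply: lin_le_of_box => // a b ab.
pose f (c : V) : V := col_perm s^-1%g c.
have : [set x *m perm_mx s | x in box a b] `<=` box (f a) (f b).
  by move=> _ [x abx <-] j; rewrite -{1 2}[s]invgK -col_permE !mxE.
move=> /le_leb_outer/le_trans; apply; apply: le_trans (leb_outer_box_le _ _) _.
rewrite lee_fin det_perm normrX normrN1 expr1n mul1r.
rewrite /box_vol [leRHS](reindex_inj (@perm_inj _ s^-1%g)).
by rewrite le_eqVlt; apply/orP; left; apply/eqP/eq_bigr => j _; rewrite !mxE.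
Qed.

Lemma lin_le_diag (d : V) : (forall j, d 0 j != 0) -> lin_le (diag_mx d).
Proof.
move=> d0; have u : diag_mx d \in unitmx.
  rewrite unitmxE unitfE det_diag; apply/prodf_neq0 => j _; exact: d0.
split=> //; apply: lin_le_of_box => // a b ab.
pose f (c : V) (c' : V) : V := \row_j (if 0 <= d 0 j then c 0 j * d 0 j else c' 0 j * d 0 j).
have : [set x *m diag_mx d | x in box a b] `<=` box (f a b) (f b a).
  move=> _ [x abx <-] j; rewrite mul_mx_diag !mxE; case/andP: (abx j) => ax xb.
  by case: (leP 0 (d 0 j)) => dj; [rewrite !ler_wpM2r|rewrite !ler_wnM2r// ltW].
move=> /le_leb_outer/le_trans; apply; apply: le_trans (leb_outer_box_le _ _) _.
rewrite lee_fin det_diag normr_prod -big_split/=; apply: ler_prod => j _.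
rewrite le_max lexx/= !mxE; have abj := ab j.
rewrite [X in _ <= _ * X]max_r ?subr_ge0// ge_max.
by case: (leP 0 (d 0 j)) => dj; [rewrite ger0_norm//|rewrite ltr0_norm//];
  apply/andP; split; nra.
Qed.

Let grid_cell (a h : R) (M : nat) x : (0 <= h) -> (a <= x <= a + M.+1%:R * h) ->
  exists p : 'I_M.+1, (a + p%:R * h <= x <= a + p%:R * h + h).
Proof.
move=> h0; elim: M => [|M ih] /andP[ax xM].
  by exists ord0; rewrite /= mul0r addr0 ax/=; lra.
have [xM'|Mx] := leP x (a + M.+1%:R * h).
  have [|p ?] := ih; first by rewrite ax.
  by exists (widen_ord (leqnSn _) p).
exists ord_max; rewrite /= (ltW Mx)/=; move: xM.
by rewrite -[X in (_ + X * h)]natr1 mulrDl mul1r addrA.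
Qed.

(* Cut the box into thin slabs along coordinate i: each slab is mapped into a
   slightly larger box, and the total excess volume tends to 0. *)
Lemma lin_le_shear (i k : 'I_m.+1) (c : R) : (k < i)%N ->
  lin_le (1%:M + c *: delta_mx i k).
Proof.
move=> ki; have nki : k != i by rewrite -val_eqE/= ltn_eqF.
set A := (_ + _).
have detA : \det A = 1.
  rewrite det_trig; last first.
    apply/is_trig_mxP => u v uv; rewrite !mxE -val_eqE/= (ltn_eqF uv) add0r.
    case: eqP => [ui|]; case: eqP => [vk|]; rewrite ?mulr0//.
    by move: uv; rewrite ui vk ltnNge ltnW.
  apply: big1 => u _; rewrite !mxE eqxx; case: eqP => [->|]; last by rewrite mulr0 addr0.
  by rewrite eq_sym (negbTE nki) mulr0 addr0.
have u : A \in unitmx by rewrite unitmxE detA unitr1.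
split=> //; apply: lin_le_of_box => // a b ab; rewrite detA normr1 mul1r.
apply/lee_addgt0Pr => e e0.
pose w := (b 0 i - a 0 i); have w0 : (0 <= w) by rewrite subr_ge0.
pose wk := (b 0 k - a 0 k); have wk0 : (0 <= wk) by rewrite subr_ge0.
pose rest := (\prod_(j < m.+1 | (j != i) && (j != k)) Num.max 0 (b 0 j - a 0 j)).
have rest0 : (0 <= rest) by apply: prodr_ge0 => j _; rewrite le_max lexx.
have volE (a' b' : V) : (forall j, j != i -> j != k -> a' 0 j = a 0 j /\ b' 0 j = b 0 j) ->
    box_vol a' b' = (Num.max 0 (b' 0 i - a' 0 i) * (Num.max 0 (b' 0 k - a' 0 k) * rest)).
  move=> H; rewrite /box_vol (bigD1 i)//= (bigD1 k)//=; congr (_ * (_ * _)).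
  by apply: eq_bigr => j /andP[ji jk]; have [-> ->] := H j ji jk.
(* [K / M.+1] is the total excess volume: [M.+1] slabs of width [h = w / M.+1], each lengthened by
   [2 * dl] along coordinate [k]. *)
pose K := (2 * `|c| * w * w * rest).
have K0 : (0 <= K) by rewrite !mulr_ge0.
have [M KM] : exists M : nat, (K / e < M.+1%:R).
  exists (Num.truncn (K / e)); exact: truncnS_gt.
have M0 : (0 < M.+1%:R :> R) by rewrite ltr0n.
pose h := (w / M.+1%:R); have h0 : (0 <= h) by rewrite divr_ge0.
have Mh : (M.+1%:R * h = w) by rewrite /h mulrC divfK// gt_eqF.
(* Inside a slab [x_i] varies by at most [h], so the displacement of [x_k] differs by at most [dl]
   from its value at the lower end of the slab. *)
pose dl := (`|c| * h); have dl0 : (0 <= dl) by rewrite mulr_ge0.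
pose a' (p : 'I_M.+1) : V := \row_j (if j == i then a 0 i + p%:R * h else
   if j == k then a 0 k + c * (a 0 i + p%:R * h) - dl else a 0 j).
pose b' (p : 'I_M.+1) : V := \row_j (if j == i then a 0 i + p%:R * h + h else
   if j == k then b 0 k + c * (a 0 i + p%:R * h) + dl else b 0 j).
have : [set x *m A | x in box a b] `<=` \bigcup_p box (a' p) (b' p).
  move=> _ [x abx <-].
  have [|p pP] := @grid_cell (a 0 i) h M (x 0 i) h0.
    by rewrite Mh /w addrC subrK.
  exists p => // j.
  have xA l : (x *m A) 0 l = (x 0 l + c * (x 0 i *+ (l == k))).
    rewrite mulmxDr mulmx1 -scalemxAr !mxE; congr (_ + c * _).
    rewrite (bigD1 i)//= big1 ?addr0 => [|v vi]; last first.
      by rewrite mxE (negbTE vi) mulr0.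
    by rewrite mxE eqxx/= mulr_natr.
  rewrite xA !mxE; case: eqP => [->|/eqP ji].
    by rewrite eq_sym (negbTE nki) mulr0n mulr0 addr0.
  case: eqP => [->|_]; last by rewrite mulr0n mulr0 addr0.
  rewrite mulr1n; case/andP: (abx k) => ak kb.
  have : (`|c * (x 0 i - (a 0 i + p%:R * h))| <= dl).
    rewrite normrM ler_wpM2l// ger0_norm; last by case/andP: pP => ? _; lra.
    by case/andP: pP => _ ?; lra.
  by rewrite ler_norml mulrBr => /andP[? ?]; lra.
move=> /le_leb_outer/le_trans; apply; apply: le_trans (leb_outer_finU _) _.
apply: (@le_trans _ _ (\sum_(p < M.+1) (h * ((wk + 2 * dl) * rest))%:E)%E).
  apply: lee_sum => p _; apply: le_trans (leb_outer_box_le _ _) _.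
  rewrite volE => [|j /negbTE ji /negbTE jk]; last by rewrite !mxE ji jk.
  rewrite !mxE !eqxx (negbTE nki) lee_fin.
  rewrite max_r; last by lra.
  rewrite max_r; last by rewrite /wk in wk0; lra.
  by rewrite le_eqVlt; apply/orP; left; apply/eqP; rewrite /wk; ring.
have -> : (\sum_(p < M.+1) (h * ((wk + 2 * dl) * rest))%:E =
    (w * ((wk + 2 * dl) * rest))%:E)%E.
  by rewrite sumEFin sumr_const card_ord -Mh -mulr_natl; congr EFin; ring.
rewrite -EFinD lee_fin.
rewrite (volE a b)//= -/w -/wk !max_r//.
have : (K / M.+1%:R <= e).
  by rewrite ler_pdivrMr// mulrC -ler_pdivrMr// ltW.
suff -> : (w * ((wk + 2 * dl) * rest) = w * (wk * rest) + K / M.+1%:R) by rewrite lerD2l.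
by rewrite /K /dl /h; ring.
Qed.

(** One shear is split off per row, starting with the last row; the cross products vanish because
    [k] is smaller than every row index involved. *)
Lemma lin_le_col (k : 'I_m.+1) (N : 'M[R]_m.+1) :
  (forall i j, N i j != 0 -> (j == k) && (k < i)%N) -> lin_le (1%:M + N).
Proof.
suff H (r : nat) (N' : 'M[R]_m.+1) :
    (forall i j, N' i j != 0 -> [&& j == k, (k < i)%N & (i < r)%N]) ->
    lin_le (1%:M + N').
  move=> NP; apply: (H m.+1) => i j /NP /andP[-> ->]; exact: ltn_ord.
elim: r N' => [|r ih] N' NP.
  suff -> : N' = 0 by rewrite addr0; exact: lin_le1.
  apply/matrixP => i j; rewrite mxE; apply/eqP/negPn/negP => /NP.
  by rewrite ltn0 !andbF.
have [rm|mr] := ltnP r m.+1; last first.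
  apply: ih => i j /NP /and3P[-> -> _]; exact: leq_trans (ltn_ord i) mr.
pose s := Ordinal rm.
have [ks|sk] := ltnP k s; last first.
  apply: ih => i j /NP /and3P[-> ki ir]; rewrite ki/=.
  by move: (leq_ltn_trans sk ki) ir => /=; lia.
pose N2 : 'M[R]_m.+1 := \matrix_(i, j) (N' i j *+ (i != s)).
have -> : (1%:M + N') = (1%:M + N2) *m (1%:M + N' s k *: delta_mx s k).
  rewrite mulmxDl mul1mx mulmxDr mulmx1 -scalemxAr.
  suff -> : N2 *m delta_mx s k = 0.
    rewrite scaler0 addr0 -addrA; congr (_ + _).
    apply/matrixP => i j; rewrite !mxE.
    case: eqP => [->|_] /=; last by rewrite mulr0 add0r mulr1n.
    case: eqP => [->|/eqP jk] /=; first by rewrite mulr1 mulr0n addr0.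
    rewrite mulr0 mulr0n addr0; apply/eqP/negPn/negP => /NP.
    by rewrite (negbTE jk).
  apply/matrixP => i j; rewrite !mxE big1// => l _; rewrite !mxE.
  case: (eqVneq l s) => [->|]; last by rewrite mulr0.
  case: (eqVneq (N' i s) 0) => [->|/NP]; first by rewrite mul0rn mul0r.
  by move=> /and3P[/eqP sk]; move: ks; rewrite sk ltnn.
apply: lin_leM; last exact: lin_le_shear.
apply: ih => i j; rewrite mxE; case: (eqVneq i s) => [_|ins]; first by rewrite eqxx.
rewrite mulr1n => /NP /and3P[-> -> ir] /=.
by rewrite ltn_neqAle -ltnS ir andbT; move: ins; rewrite -val_eqE.
Qed.

(** The last remaining column [k] is split off: [N1] lives in the columns before [k] and [N2] in the
    rows after [k], so [N1 *m N2 = 0]. *)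
Lemma lin_le_unitrig (L : 'M[R]_m.+1) : is_trig_mx L -> (forall i, L i i = 1) ->
  lin_le L.
Proof.
suff H (r : nat) (N : 'M[R]_m.+1) :
    (forall i j, N i j != 0 -> (j < i)%N && (j < r)%N) -> lin_le (1%:M + N).
  move=> /is_trig_mxP Lt L1; rewrite -(subrK 1%:M L) addrC; apply: (H m.+1) => i j.
  rewrite !mxE ltn_ord andbT; case: (ltngtP j i) => // ij.
    by rewrite Lt// -val_eqE/= (ltn_eqF ij) subrr eqxx.
  by rewrite (val_inj ij) L1 eqxx subrr eqxx.
elim: r N => [|r ih] N NP.
  suff -> : N = 0 by rewrite addr0; exact: lin_le1.
  apply/matrixP => i j; rewrite mxE; apply/eqP/negPn/negP => /NP.
  by rewrite ltn0 !andbF.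
have [rm|mr] := ltnP r m.+1; last first.
  apply: ih => i j /NP /andP[-> _]; exact: leq_trans (ltn_ord j) mr.
pose k := Ordinal rm.
pose N1 : 'M[R]_m.+1 := \matrix_(i, j) (N i j *+ (j != k)).
pose N2 : 'M[R]_m.+1 := \matrix_(i, j) (N i j *+ (j == k)).
have -> : (1%:M + N) = (1%:M + N1) *m (1%:M + N2).
  rewrite mulmxDl mul1mx mulmxDr mulmx1.
  suff -> : N1 *m N2 = 0.
    rewrite addr0 -addrA; congr (_ + _).
    by apply/matrixP => i j; rewrite !mxE; case: eqP => _; rewrite ?addr0 ?add0r.
  apply/matrixP => i j; rewrite !mxE big1// => l _; rewrite !mxE.
  case: (eqVneq (N l j *+ (j == k)) 0) => [->|]; first by rewrite mulr0.
  case: (eqVneq j k) => [->|_]; last by rewrite eqxx.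
  rewrite mulr1n => /NP /andP[kl _].
  case: (eqVneq (N i l) 0) => [->|/NP]; first by rewrite mul0rn mul0r.
  by rewrite ltnS => /andP[_]; rewrite leqNgt kl.
apply: lin_leM.
  apply: ih => i j; rewrite mxE; case: (eqVneq j k) => [_|jk]; first by rewrite eqxx.
  rewrite mulr1n => /NP /andP[-> jr] /=.
  by rewrite ltn_neqAle -ltnS jr andbT; move: jk; rewrite -val_eqE.
apply: (@lin_le_col k) => i j; rewrite mxE.
case: (eqVneq j k) => [->|]; last by rewrite eqxx.
by rewrite mulr1n => /NP /andP[].
Qed.

Lemma lin_le_trig (L : 'M[R]_m.+1) : is_trig_mx L -> (forall i, L i i != 0) ->
  lin_le L.
Proof.
move=> /is_trig_mxP Lt L0; pose d : V := \row_j L j j.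
have -> : L = diag_mx d *m (diag_mx (\row_j (L j j)^-1) *m L).
  rewrite mulmxA mulmx_diag (_ : \row_j _ = const_mx 1) ?diag_const_mx ?mul1mx//.
  by apply/rowP => j; rewrite !mxE mulfV.
apply: lin_leM; first by apply: lin_le_diag => j; rewrite mxE.
apply: lin_le_unitrig; last by move=> i; rewrite mul_diag_mx !mxE mulVf.
by apply/is_trig_mxP => i j ij; rewrite mul_diag_mx !mxE (Lt _ _ ij) mulr0.
Qed.

(** LUP decomposition. Conjugating [U] by the reversal of the coordinates makes it lower triangular,
    so lower shears are enough. *)
Lemma lin_le_unit (A : 'M[R]_m.+1) : A \in unitmx -> lin_le A.
Proof.
move=> Au.
have := cormen_lup_perm A; have := cormen_lup_correct A.
have := @cormen_lup_lower _ _ A; have := @cormen_lup_upper _ _ A.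
case: (cormen_lup A) => [[P L] U]/= Uup Llow PA /is_perm_mxP[s Ps].
have -> : A = perm_mx s^-1%g *m (L *m U).
  rewrite -[L *m U]PA Ps -[(_ * A)]/(_ *m _) mulmxA -perm_mxM mulVg perm_mx1.
  by rewrite mul1mx.
have Lt : is_trig_mx L.
  apply/is_trig_mxP => i j ij; rewrite (Llow _ _ (ltnW ij)).
  by rewrite -val_eqE/= (ltn_eqF ij) mulr0n.
have L1 i : L i i = 1 by rewrite Llow// eqxx.
have Uu : U \in unitmx.
  have : perm_mx s *m A \in unitmx by rewrite unitmx_mul unitmx_perm.
  have PA' : P *m A = L *m U := PA.
  by rewrite -Ps PA' unitmx_mul => /andP[].
pose rv : 'S_m.+1 := perm (@rev_ord_inj m.+1).
have rvE i : rv i = rev_ord i by rewrite permE.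
have rvV : (rv^-1 = rv)%g.
  by apply/permP => i; apply: (@perm_inj _ rv); rewrite permKV !rvE rev_ordK.
pose U' := perm_mx rv *m U *m perm_mx rv.
have U'E i j : U' i j = U (rev_ord i) (rev_ord j).
  by rewrite /U' -{2}rvV -col_permE -row_permE !mxE !rvE.
have -> : U = perm_mx rv *m U' *m perm_mx rv.
  rewrite /U' !mulmxA -perm_mxM -{1}rvV mulVg perm_mx1 mul1mx -mulmxA -perm_mxM.
  by rewrite -{1}rvV mulVg perm_mx1 mulmx1.
have U't : is_trig_mx U'.
  apply/is_trig_mxP => i j ij; rewrite U'E Uup//=.
  by move: ij (ltn_ord i) (ltn_ord j); lia.
apply: lin_leM; first exact: lin_le_perm.
apply: lin_leM; first exact: lin_le_unitrig.
apply: lin_leM; last exact: lin_le_perm.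
apply: lin_leM; first exact: lin_le_perm.
apply: lin_le_trig => // i.
have : U' \in unitmx by rewrite !unitmx_mul !unitmx_perm Uu.
by rewrite unitmxE det_trig// unitfE => /prodf_neq0; exact.
Qed.

Lemma leb_outer_lin (A : 'M[R]_m.+1) (S : set V) : A \in unitmx ->
  leb_outer [set x *m A | x in S] = ((`|\det A|)%:E * leb_outer S)%E.
Proof.
move=> Au; apply/eqP; rewrite eq_le (lin_le_unit Au).2/=.
have A0 : (0 < `|\det A|) by rewrite normr_gt0 -unitfE -unitmxE.
have Vu : invmx A \in unitmx by rewrite unitmx_inv.
have := (lin_le_unit Vu).2 [set x *m A | x in S].
rewrite det_inv normfV -lee_pdivrMl ?invr_gt0// invrK; apply: le_trans.
rewrite image_comp (_ : [set _ | _ in _] = S)//.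
by rewrite -[RHS]image_id; apply: eq_imagel => x _ /=; rewrite mulmxK.
Qed.

Lemma caratheodory_lin (A : 'M[R]_m.+1) (S : set V) : A \in unitmx ->
  (@leb_outer R m.+1).-caratheodory S ->
  (@leb_outer R m.+1).-caratheodory [set x *m A | x in S].
Proof.
move=> Au mS X; pose Y := [set x | X (x *m A)].
have inj : injective (fun x : V => x *m A) by exact: can_inj (mulmxK Au).
have -> : X = [set x *m A | x in Y].
  apply/seteqP; split => [x Xx|_ [x Xx <-]//].
  by exists (x *m invmx A); rewrite /Y/= mulmxKV.
have -> : [set x *m A | x in Y] `&` [set x *m A | x in S] =
    [set x *m A | x in Y `&` S].
  apply/seteqP; split => [_ [[x Yx <-] [y Sy /inj yx]]|_ [x [Yx Sx] <-]].
    by exists x => //; split => //; rewrite -yx.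
  by split; exists x.
have -> : [set x *m A | x in Y] `&` ~` [set x *m A | x in S] =
    [set x *m A | x in Y `&` ~` S].
  apply/seteqP; split => [_ [[x Yx <-] nS]|_ [x [Yx Sx] <-]].
    by exists x => //; split => //; apply: contra_not nS => Sx; exists x.
  by split; [exists x|move=> [y Sy /inj yx]; apply: Sx; rewrite -yx].
rewrite !leb_outer_lin// (mS Y) muleDr//.
by apply: ge0_adde_def; rewrite inE leb_outer_ge0.
Qed.

End cara.

(** * Lebesgue measure and the region under a graph *)

Section leb.
Context {R : realType} (m : nat).
Local Notation V := 'rV[R]_m.+1.

Definition lebO : {outer_measure set V -> \bar R} := @leb_outer R m.+1.
Definition lebT := caratheodory_type lebO.
HB.instance Definition _ := Measurable.on lebT.
Definition leb : {measure set lebT -> \bar R} := lebO.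
Arguments lebO : simpl never.
Arguments leb : simpl never.

Lemma measurable_coord j : measurable_fun [set: lebT] (fun x : lebT => (x : V) 0 j).
Proof.
apply: (measurability _ (RGenOInfty.measurableE R)) => _ [_ [t ->] <-].
rewrite setTI (_ : _ @^-1` _ = ~` [set x : lebT | (x : V) 0 j <= t]).
  by apply: measurableC; exact: caratheodory_le_coord.
by apply/seteqP; split => x /=; rewrite in_itv/= andbT ltNge => /negP.
Qed.

Lemma measurable_lin (A : 'M[R]_m.+1) : A \in unitmx ->
  measurable_fun [set: lebT] (fun x : lebT => ((x : V) *m A) : lebT).
Proof.
move=> Au _ S mS; rewrite setTI.
rewrite (_ : _ @^-1` _ = [set (x : V) *m invmx A | x in S]).
  by apply: caratheodory_lin => //; rewrite unitmx_inv.
apply/seteqP; split => [x Sx|_ [x Sx <-]] /=; last by rewrite mulmxKV.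
by exists (x *m A) => //; rewrite mulmxK.
Qed.

Lemma leb_lin (A : 'M[R]_m.+1) (S : set V) : A \in unitmx ->
  leb [set x *m A | x in S] = ((`|\det A|)%:E * leb S)%E.
Proof. exact: leb_outer_lin. Qed.

(** The pushforward of [leb] under right multiplication by [A] is [leb] divided by [|\det A|]. *)
Lemma integral_lin (A : 'M[R]_m.+1) (D : set lebT) (f : lebT -> \bar R) :
  A \in unitmx -> measurable D -> measurable_fun setT f ->
  (forall x, 0 <= f x)%E ->
  (\int[leb]_(x in [set (x : V) *m A | x in D]) f x =
   (`|\det A|)%:E * \int[leb]_(x in D) f ((x : V) *m A))%E.
Proof.
move=> Au mD mf f0; pose phi (x : lebT) : lebT := (x : V) *m A.
have mphi : measurable_fun setT phi by exact: measurable_lin.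
have A0 : 0 < `|\det A| by rewrite normr_gt0 -unitfE -unitmxE.
have A0' : 0 <= `|\det A|^-1 by rewrite invr_ge0.
have mDA : measurable (phi @` D) by exact: caratheodory_lin.
have pD : phi @^-1` (phi @` D) = D.
  apply/seteqP; split => [x [y Dy /(can_inj (mulmxK Au)) <-//]|x Dx].
  by exists x.
have := @ge0_integral_pushforward _ _ _ _ R phi mphi leb (phi @` D) f mDA.
rewrite pD => <-//; last exact: measurable_funTS.
rewrite [X in (_ * X)%E](@eq_measure_integral _ _ _ _ (mscale (NngNum A0') leb)); last first.
  move=> S mS _; rewrite /pushforward/= /mscale/=.
  have SE : leb_outer S = (`|\det A|%:E * leb_outer (phi @^-1` S))%E.
    rewrite -leb_outer_lin//; congr leb_outer.
    apply/seteqP; split => [x Sx|_ [x Sx <-]]//.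
    by exists ((x : V) *m invmx A); rewrite /phi/= mulmxKV.
  by rewrite SE muleA -EFinM mulVf ?gt_eqF// mul1e.
rewrite ge0_integral_mscale//=; last exact: measurable_funTS.
by rewrite muleA -EFinM mulfV ?gt_eqF// mul1e.
Qed.

Lemma leb_outer_slab (S : set V) (c : R) : 0 < c ->
  (leb_outer [set z : 'rV[R]_(m.+1 + 1) | S (lsubmx z) /\ (0 <= rsubmx z 0 0 <= c)%R]
   <= c%:E * leb_outer S)%E.
Proof.
move=> c0; rewrite -lee_pdivrMl//; apply: le_ereal_inf_tmp => _ [a [b [Sab ->]]].
rewrite lee_pdivrMl// -nneseriesZl//; last first.
  by move=> k _; rewrite lee_fin box_vol_ge0.
pose a' k : 'rV[R]_(m.+1 + 1) := row_mx (a k) 0.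
pose b' k : 'rV[R]_(m.+1 + 1) := row_mx (b k) (const_mx c).
have -> : (\sum_(k <oo) (c%:E * (box_vol (a k) (b k))%:E) =
    \sum_(k <oo) (box_vol (a' k) (b' k))%:E)%E.
  apply: eq_eseriesr => k _; rewrite -EFinM mulrC; congr EFin.
  rewrite /box_vol big_split_ord/= big_ord1 !row_mxEr !mxE subr0 max_r ?ltW//.
  by congr (_ * _); apply: eq_bigr => j _; rewrite !row_mxEl.
apply: leb_outer_cover => z [/Sab[k _ abz] zc]; exists k => // j.
rewrite -[z]hsubmxK; case: (split_ordP j) => i ->.
  by rewrite !row_mxEl; exact: abz.
by rewrite !row_mxEr ord1 !mxE; move: zc; rewrite !mxE.
Qed.

(** Over the piece of [K] where [k h <= f < (k + 1) h] the region lies in a cylinder of height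
    [(k + 1) h <= f + h]. The error [h] is kept: a bounded one ([h = 1] at the end) only changes the
    constant. *)
Lemma leb_outer_subgraph (K : set lebT) (f : V -> R) (h : R) :
  measurable K -> measurable_fun [set: lebT] (f : lebT -> R) ->
  (forall x, 0 <= f x) -> 0 < h ->
  (leb_outer (subgraph K f) <= \int[leb]_(x in K) (f x + h)%:E)%E.
Proof.
move=> mK mf f0 h0.
pose A k := K `&` [set x : lebT | k%:R * h <= f x < k.+1%:R * h].
have mA k : measurable (A k).
  have := mf measurableT `[k%:R * h, k.+1%:R * h[%classic (measurable_itv _).
  rewrite setTI => mk; rewrite (_ : A k = K `&` (f : lebT -> R) @^-1` `[k%:R * h, k.+1%:R * h[%classic).
    exact: measurableI.
  by rewrite /A; congr (_ `&` _); apply/seteqP; split => x /=; rewrite in_itv.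
have AK : \bigcup_k A k = K.
  apply/seteqP; split => [x [k _ []//]|x Kx].
  exists (Num.truncn (f x / h)) => //; split => //=.
  rewrite -ler_pdivlMr// -ltr_pdivrMr//; apply: truncn_itv.
  by rewrite divr_ge0// ltW.
have tA : trivIset setT A.
  apply/trivIsetP => i j _ _ ij; apply/seteqP; split => // x [[_ /= /andP[i1 i2]] [_ /= /andP[j1 j2]]].
  have := le_lt_trans i1 j2; have := le_lt_trans j1 i2.
  rewrite !ltr_pM2r// !ltr_nat !ltnS => ji ij'.
  by move: ij; rewrite eqn_leq ji ij'.
apply: (@le_trans _ _ (\sum_(k <oo) \int[leb]_(x in A k) (f x + h)%:E)%E).
  apply: (@le_trans _ _ (leb_outer (\bigcup_k [set z : 'rV[R]_(m.+1 + 1) |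
      A k (lsubmx z) /\ 0 <= rsubmx z 0 0 <= k.+1%:R * h]))).
    apply: le_leb_outer => z [Kz /andP[z0 zf]].
    move: Kz; rewrite -{1}AK => -[k _ Az]; exists k => //; split => //.
    by rewrite z0/= (le_trans zf)//; case: Az => _ /= /andP[_ /ltW].
  apply: le_trans (leb_outer_sigma_subadditive _) _.
  apply: lee_nneseries => [k _ _|k _]; first exact: leb_outer_ge0.
  apply: le_trans (leb_outer_slab _ _) _; first by rewrite mulr_gt0.
  rewrite -[leLHS](@integral_cst _ _ _ leb (A k) (mA k)).
  apply: ge0_le_integral => //.
  - by move=> x _; rewrite lee_fin mulr_ge0// ltW.
  - by apply/measurable_EFinP; apply: measurable_funTS; apply: measurable_funD.
  - move=> x [_ /= /andP[fk _]]; rewrite lee_fin -natr1 mulrDl mul1r lerD2r//.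
rewrite -ge0_integral_bigcup//= ?AK//.
- by apply/measurable_EFinP; apply: measurable_funTS; apply: measurable_funD.
- by move=> x _; rewrite lee_fin addr_ge0// ltW.
Qed.

End leb.

(** * Second moments of a simplex *)

Section simplex.
Context {R : realType} (m : nat).
Local Notation n := m.+2.
Local Notation V := 'rV[R]_n.
Local Notation mu := (@leb R m.+1).
Local Notation T := (@lebT R m.+1).

(** Strict positivity makes the images for different bases disjoint; the closed condition on the sum
    matches the cost inequality given by the linear program. *)
Definition simplexo : set T :=
  [set x : V | (forall j, 0 < x 0 j) /\ \sum_j x 0 j <= 1].

Lemma simplexo_le1 (x : V) i : simplexo x -> x 0 i <= 1.
Proof.
move=> [x0 x1]; apply: le_trans x1; rewrite (bigD1 i)//= lerDl.
by apply: sumr_ge0 => j _; exact: ltW.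
Qed.

Let measurable_lt_coord i j : measurable [set x : T | (x : V) 0 i < (x : V) 0 j].
Proof.
rewrite -[X in measurable X]setTI.
exact: (measurable_fun_ltr (measurable_coord i) (measurable_coord j)).
Qed.

Lemma measurable_simplexo : measurable simplexo.
Proof.
rewrite (_ : simplexo = (\bigcap_(j in [set: 'I_n]) [set x : T | 0 < (x : V) 0 j]) `&`
    [set x : T | \sum_j (x : V) 0 j <= 1]); last first.
  by apply/seteqP; split => x [] h1 h2; split => // j; [move=> _; exact: h1|exact: h1].
apply: measurableI.
  apply: fin_bigcap_measurable => // j _; rewrite -[X in measurable X]setTI.
  rewrite (_ : [set x : T | _] = ~` [set x : V | x 0 j <= 0]).
    by rewrite setTI; apply: measurableC; exact: caratheodory_le_coord.
  by apply/seteqP; split => x /=; rewrite ltNge => /negP.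
rewrite -[X in measurable X]setTI; apply: measurable_fun_le => //.
by apply: measurable_sum => j; exact: measurable_coord.
Qed.
Hint Resolve measurable_simplexo : core.

Lemma leb_simplexo_fin : mu simplexo \is a fin_num.
Proof.
rewrite ge0_fin_numE//; have : simplexo `<=` box (0 : V) (const_mx 1).
  move=> x Sx j; rewrite !mxE simplexo_le1// andbT; apply: ltW.
  by case: Sx.
move=> /le_leb_outer/le_lt_trans; apply.
by apply: le_lt_trans (leb_outer_box_le _ _) _; rewrite ltry.
Qed.

(** The absolute value changes nothing on the simplex, but makes the integrand nonnegative
    everywhere, as [integral_lin] requires. *)
Definition smom i k := fine (\int[mu]_(x in simplexo) (`|(x : V) 0 i * (x : V) 0 k|)%:E).

Let measurable_coordM (D : set T) i k :
  measurable_fun D (fun x : T => (x : V) 0 i * (x : V) 0 k).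
Proof. by apply: measurable_funTS; apply: measurable_funM; exact: measurable_coord. Qed.

Let integrable_coordM i k :
  mu.-integrable simplexo (fun x : T => ((x : V) 0 i * (x : V) 0 k)%:E).
Proof.
apply: measurable_bounded_integrable => //.
  by rewrite ltey_eq leb_simplexo_fin.
exists 1; split => // M M1 x Sx /=; apply: le_trans (ltW M1).
have [x0 _] := Sx; have [xi xk] := (ltW (x0 i), ltW (x0 k)).
by rewrite ger0_norm ?mulr_ge0// -[leRHS]mulr1 ler_pM ?simplexo_le1.
Qed.

Let integral_coordM i k :
  (\int[mu]_(x in simplexo) ((x : V) 0 i * (x : V) 0 k)%:E = (smom i k)%:E)%E.
Proof.
have E : (\int[mu]_(x in simplexo) (`|(x : V) 0 i * (x : V) 0 k|)%:E =
    \int[mu]_(x in simplexo) ((x : V) 0 i * (x : V) 0 k)%:E)%E.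
  apply: eq_integral => x; rewrite inE => -[x0 _].
  by rewrite ger0_norm// mulr_ge0 ?ltW.
rewrite /smom E fineK//; apply: integrable_fin_num => //; exact: integrable_coordM.
Qed.

Let integral_quad (g : 'I_n -> 'I_n -> R) :
  (\int[mu]_(x in simplexo) (\sum_i \sum_k g i k * ((x : V) 0 i * (x : V) 0 k))%:E =
   (\sum_i \sum_k g i k * smom i k)%:E)%E.
Proof.
transitivity (\int[mu]_(x in simplexo)
    \sum_(p : 'I_n * 'I_n) ((g p.1 p.2)%:E * ((x : V) 0 p.1 * (x : V) 0 p.2)%:E))%E.
  by apply: eq_integral => x _; rewrite pair_bigA -sumEFin.
rewrite integral_sum; [|exact: measurable_simplexo|]; last first.
  by move=> p; apply: integrableZl => //; exact: integrable_coordM.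
rewrite pair_bigA -sumEFin; apply: eq_bigr => p _.
by rewrite integralZl ?integral_coordM//; exact: integrable_coordM.
Qed.

Let measurable_normM (D : set T) i k :
  measurable_fun D (fun x : T => (`|(x : V) 0 i * (x : V) 0 k|)%:E).
Proof.
apply/measurable_EFinP; apply: measurableT_comp => //; exact: measurable_coordM.
Qed.

Let simplexo_perm (s : 'S_n) : [set (x : V) *m perm_mx s | x in simplexo] = simplexo.
Proof.
have H (t : 'S_n) (x : V) : simplexo x -> simplexo (x *m perm_mx t).
  move=> [x0 x1]; rewrite -[t]invgK -col_permE; split => [j|]; first by rewrite mxE.
  under eq_bigr do rewrite mxE.
  by rewrite (_ : \sum_i _ = \sum_i x 0 i)// [RHS](reindex_inj (@perm_inj _ t^-1%g)).
apply/seteqP; split => [_ [x Sx <-]|x Sx]; first exact: H.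
exists (x *m perm_mx s^-1%g); first exact: H.
by rewrite -mulmxA -perm_mxM mulVg perm_mx1 mulmx1.
Qed.

Let smom_perm (s : 'S_n) i k : smom (s i) (s k) = smom i k.
Proof.
rewrite /smom -{1}(simplexo_perm s); congr fine.
rewrite (integral_lin (f := fun x : T => (`|(x : V) 0 (s i) * (x : V) 0 (s k)|)%:E))//.
- rewrite det_perm normrX normrN1 expr1n mul1e; apply: eq_integral => x _.
  by rewrite -[s in perm_mx s]invgK -col_permE !mxE !permK.
- exact: unitmx_perm.
Qed.

Let i0 : 'I_n := ord0.
Let i1 : 'I_n := lift ord0 ord0.

Let smom_diag i : smom i i = smom i0 i0.
Proof. by rewrite -(smom_perm (tperm i i0) i i) tpermL. Qed.

Let smom_off i k : i != k -> smom i k = smom i0 i1.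
Proof.
move=> ik; have [i_0|ii0] := eqVneq i i0.
  by rewrite i_0 -(smom_perm (tperm k i1)) tpermL tpermD// eq_sym -i_0.
rewrite -(smom_perm (tperm i i0)) tpermL.
set k' := tperm i i0 k; have k'0 : k' != i0.
  by rewrite /k' -{2}(tpermL i i0) (inj_eq perm_inj) eq_sym.
by rewrite -(smom_perm (tperm k' i1)) tpermL tpermD// eq_sym.
Qed.

Let a := smom i0 i1.
Let b := smom i0 i0.

(** By permutation symmetry only two moments occur, [a] off the diagonal and [b] on it. *)
Let integral_sq (u : 'I_n -> R) :
  (\int[mu]_(x in simplexo) ((\sum_i u i * (x : V) 0 i) ^+ 2)%:E =
   (a * (\sum_i u i) ^+ 2 + (b - a) * \sum_i u i ^+ 2)%:E)%E.
Proof.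
have -> : (\int[mu]_(x in simplexo) ((\sum_i u i * (x : V) 0 i) ^+ 2)%:E =
   \int[mu]_(x in simplexo) (\sum_i \sum_k (u i * u k) * ((x : V) 0 i * (x : V) 0 k))%:E)%E.
  apply: eq_integral => x _; congr EFin; rewrite expr2 big_distrl/=.
  by apply: eq_bigr => i _; rewrite big_distrr/=; apply: eq_bigr => k _; ring.
rewrite integral_quad; congr EFin.
have -> : (\sum_i u i) ^+ 2 = \sum_i \sum_k u i * u k.
  by rewrite expr2 big_distrl/=; apply: eq_bigr => i _; rewrite big_distrr.
rewrite !big_distrr -big_split/=; apply: eq_bigr => i _.
rewrite (bigD1 i)//= [in RHS](bigD1 i)//= smom_diag mulrDr big_distrr/=.
rewrite addrAC; congr (_ + _); first by rewrite /a /b; ring.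
by apply: eq_bigr => k ki; rewrite smom_off 1?eq_sym// /a; ring.
Qed.

Let H : set T := simplexo `&` [set x : T | (x : V) 0 i1 < (x : V) 0 i0].
Let H' : set T := simplexo `&` [set x : T | (x : V) 0 i0 < (x : V) 0 i1].
Let Dg : set T := simplexo `&` [set x : T | (x : V) 0 i0 = (x : V) 0 i1].
Let f (x : T) : \bar R := (((x : V) 0 i0 - (x : V) 0 i1) ^+ 2)%:E.

Let mf (D : set T) : measurable_fun D f.
Proof.
apply/measurable_EFinP; apply: measurable_funTS; apply: measurable_funX.
by apply: measurable_funB; exact: measurable_coord.
Qed.

Let mH : measurable H.
Proof. by apply: measurableI => //; exact: measurable_lt_coord. Qed.

Let mH' : measurable H'.
Proof. by apply: measurableI => //; exact: measurable_lt_coord. Qed.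

Let mDg : measurable Dg.
Proof.
rewrite (_ : Dg = (simplexo `\` H) `\` H'); last first.
  apply/seteqP; split => x.
    by move=> [Sx /= xe]; split=> [|[_ /=]]; rewrite ?xe ?ltxx//; split => // -[_ /=]; rewrite xe ltxx.
  move=> [[Sx nH] nH']; split => //=; apply/eqP; rewrite eq_le !leNgt.
  by apply/andP; split; apply/negP => h; [apply: nH|apply: nH'].
by apply: measurableD => //; apply: measurableD.
Qed.

Let integral_HH' : (\int[mu]_(x in H') f x = \int[mu]_(x in H) f x)%E.
Proof.
pose s : 'S_n := tperm i0 i1.
have sE (x : V) j : (x *m perm_mx s) 0 j = x 0 (s j).
  by rewrite -[s in perm_mx s]invgK -col_permE !mxE tpermV.
have -> : H' = [set (x : V) *m perm_mx s | x in H].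
  apply/seteqP; split => [x [Sx /= lt]|_ [x [Sx /= lt] <-]]; last first.
    split => /=; last by rewrite !sE tpermL tpermR.
    by rewrite -(simplexo_perm s); exists x.
  exists (x *m perm_mx s); first split => /=.
  - by rewrite -(simplexo_perm s); exists x.
  - by rewrite !sE tpermL tpermR.
  - by rewrite -mulmxA -perm_mxM tperm2 perm_mx1 mulmx1.
rewrite integral_lin//; last 2 first.
- exact: unitmx_perm.
- by move=> x; rewrite lee_fin sqr_ge0.
rewrite det_perm normrX normrN1 expr1n mul1e; apply: eq_integral => x _.
by rewrite /f !sE tpermL tpermR; congr EFin; ring.
Qed.

(* [(x0, x1, ..) |-> (x0 - x1, 2 x1, ..)] maps the half [x1 < x0] of the simplex
   onto the whole simplex. *)
Let integral_half : (b%:E = 2%:E * \int[mu]_(x in H) f x)%E.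
Proof.
pose d : V := \row_j (if j == i1 then 2 else 1).
pose A := diag_mx d - delta_mx i1 i0.
have AE (x : V) j : (x *m A) 0 j = x 0 j * d 0 j - x 0 i1 *+ (j == i0).
  rewrite mulmxBr mul_mx_diag !mxE; congr (_ * _ - _).
  rewrite (bigD1 i1)//= big1 ?addr0 => [|v vi]; last by rewrite mxE (negbTE vi) mulr0.
  by rewrite mxE eqxx/= mulr_natr.
have detA : \det A = 2.
  rewrite det_trig; last first.
    apply/is_trig_mxP => u v uv; rewrite !mxE.
    have -> : (u == v) = false by rewrite -val_eqE/= ltn_eqF.
    rewrite mulr0n sub0r.
    case: eqP => [ui|]; case: eqP => [vk|]; rewrite ?oppr0//.
    by move: uv; rewrite ui vk.
  rewrite (bigD1 i1)//= big1 => [|j ji]; rewrite !mxE ?eqxx/= ?mulr1n ?subr0 ?mulr1//.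
  by rewrite (negbTE ji)/= subr0.
have Au : A \in unitmx by rewrite unitmxE detA unitfE.
have i10 : i1 != i0 by [].
have sumA (x : V) : \sum_j (x *m A) 0 j = \sum_j x 0 j.
  rewrite (bigD1 i0)//= (bigD1 i1)//= [RHS](bigD1 i0)//= [X in _ = _ + X](bigD1 i1)//=.
  rewrite !AE !mxE !eqxx/= mulr1n mulr0n.
  under eq_bigr => j /andP[j0 j1] do
    rewrite AE !mxE (negbTE j0) (negbTE j1) mulr0n subr0 mulr1.
  by rewrite !addrA; congr (_ + _); ring.
have -> : b%:E = (\int[mu]_(x in [set (x : V) *m A | x in H]) ((x : V) 0 i0 ^+ 2)%:E)%E.
  rewrite -integral_coordM; congr (integral _ _ _).
  apply/seteqP; split => [y [y0 y1]|_ [x [[x0 x1] /= lt] <-]]; last first.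
    split => [j|]; last by rewrite sumA.
    rewrite AE !mxE; have := x0 j; case: (eqVneq j i0) => [->|_] /=.
      by rewrite mulr1 mulr1n; lra.
    by rewrite mulr0n subr0; case: ifP => _; lra.
  pose x : V := \row_j (if j == i0 then y 0 i0 + y 0 i1 / 2
                        else if j == i1 then y 0 i1 / 2 else y 0 j).
  have xA : x *m A = y.
    apply/rowP => j; rewrite AE !mxE; case: (eqVneq j i0) => [->|ji0] /=.
      by rewrite mulr1n mulr1 addrK.
    rewrite mulr0n subr0; case: (eqVneq j i1) => [->|ji1]; last by rewrite mulr1.
    by field.
  exists x => //; split; first split.
  - move=> j; rewrite mxE; have := y0 i0; have := y0 i1; have := y0 j.
    by case: ifP => _; [lra|case: ifP => _; lra].
  - by rewrite -sumA xA.
  - by rewrite /= !mxE/=; have := y0 i0; lra.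
rewrite integral_lin//; last 2 first.
- apply/measurable_EFinP; apply: measurable_funX; exact: measurable_coord.
- by move=> x; rewrite lee_fin sqr_ge0.
rewrite detA ger0_norm//; congr (_ * _)%E; apply: eq_integral => x _.
by rewrite AE !mxE/= mulr1 mulr1n.
Qed.

(** The integral of [(x_0 - x_1)^2] is [2 (b - a)] by the quadratic form. It is also [b], since each
    of the halves [x_1 < x_0] and [x_0 < x_1] contributes [b / 2] by [integral_half]. *)
Let b2a : b = 2 * a.
Proof.
have := integral_sq (fun i => (i == i0)%:R - (i == i1)%:R).
have i10 : i1 != i0 by [].
have sumE (F : 'I_n -> R) : (forall j, j != i0 -> j != i1 -> F j = 0) ->
    \sum_j F j = F i0 + F i1.
  move=> F0; rewrite (bigD1 i0)//= (bigD1 i1)//= big1 ?addr0// => j /andP[].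
  by move=> *; apply: F0.
rewrite !sumE ?eqxx/=; try by move=> j /negbTE-> /negbTE->; rewrite subrr ?expr0n.
rewrite subr0 sub0r subrr expr0n/= mulr0 add0r sqrrN expr1n.
have -> : (\int[mu]_(x in simplexo)
    ((\sum_i ((i == i0)%:R - (i == i1)%:R) * (x : V) 0 i) ^+ 2)%:E =
    \int[mu]_(x in (H `|` H') `|` Dg) f x)%E.
  have -> : H `|` H' `|` Dg = simplexo.
    apply/seteqP; split => [x [[[]|[]]|[]]//|x Sx].
    by have [?|?|?] := ltgtP ((x : V) 0 i0) ((x : V) 0 i1); [left; right|left; left|right].
  apply: eq_integral => x _; rewrite sumE => [|j /negbTE-> /negbTE->].
    by rewrite !eqxx/= subr0 sub0r mul1r mulN1r.
  by rewrite subrr mul0r.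
have f0 x : (0 <= f x)%E by rewrite lee_fin sqr_ge0.
rewrite ge0_integral_setU//; last 2 first.
- exact: measurableU.
- apply/disj_setPS => x [[[_ /= lt]|[_ /= lt]] [_ /= e]]; move: lt; rewrite e ltxx//.
rewrite ge0_integral_setU//; last first.
  by apply/disj_setPS => x [[_ /= lt] [_ /=]]; rewrite ltNge (ltW lt).
rewrite (@integral0_eq _ _ _ _ Dg)//; last first.
  by move=> x [_ /= e]; rewrite /f e subrr expr0n.
rewrite adde0 integral_HH'; have := integral_half.
case: (integral mu H f) => [h| |]/=.
- by rewrite -EFinM -EFinD => -[bE] [hE]; lra.
- by rewrite gt0_muley ?lte_fin.
- by rewrite gt0_muleNy ?lte_fin.
Qed.

(** With all [u_i = 1] the form is [a n^2 + (b - a) n = a n (n + 1)], and the integrand is at most 1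
    on the simplex. *)
Let a_le : a * (n%:R * n.+1%:R) <= fine (mu simplexo).
Proof.
have := integral_sq (fun=> 1).
under eq_integral => x _ do under eq_bigr => i _ do rewrite mul1r.
under [X in _ = (_ + _ * X)%:E]eq_bigr => i _ do rewrite expr1n.
rewrite sumr_const card_ord b2a => E.
have : (\int[mu]_(x in simplexo) ((\sum_i (x : V) 0 i) ^+ 2)%:E <=
    \int[mu]_(x in simplexo) (cst 1 x))%E.
  apply: ge0_le_integral => //.
  - by move=> x _; rewrite lee_fin sqr_ge0.
  - apply/measurable_EFinP; apply: measurable_funTS; apply: measurable_funX.
    by apply: measurable_sum => j; exact: measurable_coord.
  - move=> x [x0 x1]; rewrite lee_fin expr_le1//.
    by apply: sumr_ge0 => j _; exact: ltW.
rewrite integral_cst// mul1e E -[mu simplexo]fineK ?leb_simplexo_fin// lee_fin.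
apply: le_trans; rewrite -[n.+1%:R]natr1 le_eqVlt; apply/orP; left; apply/eqP; ring.
Qed.

Lemma simplexo_second_moment (W : 'M[R]_n) : W \in unitmx ->
  (\int[mu]_(x in [set (x : V) *m W | x in simplexo]) (sqnorm (x : V))%:E <=
   ((sqnorm (\sum_i row i W) + \sum_i sqnorm (row i W)) / (n%:R * n.+1%:R))%:E
   * mu [set (x : V) *m W | x in simplexo])%E.
Proof.
move=> Wu; rewrite integral_lin//; last 2 first.
- apply/measurable_EFinP; apply: measurable_sum => j.
  by apply: measurable_funX; exact: measurable_coord.
- by move=> x; rewrite lee_fin sumr_ge0// => j _; rewrite sqr_ge0.
rewrite leb_lin// muleCA lee_wpmul2l ?lee_fin//.
have -> : (\int[mu]_(x in simplexo) (sqnorm ((x : V) *m W))%:E =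
    (a * (sqnorm (\sum_i row i W) + \sum_i sqnorm (row i W)))%:E)%E.
  transitivity (\int[mu]_(x in simplexo)
      (\sum_j ((\sum_i W i j * (x : V) 0 i) ^+ 2)%:E)%E)%E.
    apply: eq_integral => x _; rewrite sumEFin; congr EFin; apply: eq_bigr => j _.
    by rewrite mxE; congr (_ ^+ 2); apply: eq_bigr => i _; rewrite mulrC.
  rewrite ge0_integral_sum; [|exact: measurable_simplexo| |]; last first.
  - by move=> j x _; rewrite lee_fin sqr_ge0.
  - move=> j; apply/measurable_EFinP; apply: measurable_funTS; apply: measurable_funX.
    apply: measurable_sum => i.
    by apply: measurable_funM; [exact: measurable_cst|exact: measurable_coord].
  under eq_bigr => j _ do rewrite integral_sq b2a.
  rewrite sumEFin; congr EFin; rewrite /sqnorm exchange_big/= -big_split/= big_distrr/=.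
  apply: eq_bigr => j _; rewrite summxE.
  have -> : \sum_i row i W 0 j = \sum_i W i j by apply: eq_bigr => i _; rewrite mxE.
  have -> : \sum_i row i W 0 j ^+ 2 = \sum_i W i j ^+ 2.
    by apply: eq_bigr => i _; rewrite mxE.
  by ring.
rewrite -[mu simplexo]fineK ?leb_simplexo_fin// -EFinM lee_fin mulrAC mulrC.
have nn : (0 : R) < n%:R * n.+1%:R by rewrite mulr_gt0.
rewrite -mulrA ler_wpM2l//.
  by rewrite addr_ge0 ?sumr_ge0// => *; rewrite ?sqr_ge0 ?sumr_ge0// => *; rewrite sqr_ge0.
by rewrite ler_pdivlMr.
Qed.

End simplex.

(** * Bases, pivoting and generic costs *)

Section bases.
Context {R : realFieldType} (n : nat) (I : finType) (w : I -> 'rV[R]_n).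
Implicit Types (f : {ffun 'I_n -> I}) (x : 'rV[R]_n) (l : I -> R).

Definition bmx f : 'M[R]_n := \matrix_i w (f i).
Definition bcoord f x : 'rV[R]_n := x *m invmx (bmx f).
Definition bset f k j : {ffun 'I_n -> I} := [ffun i => if i == k then j else f i].
Definition spread f (a : 'I_n -> R) (i : I) : R := \sum_k a k *+ (i == f k).

Lemma bcoordE f x : bmx f \in unitmx -> x = \sum_k bcoord f x 0 k *: w (f k).
Proof.
move=> fu; rewrite -{1}[x](mulmxKV fu) mulmx_sum_row.
by apply: eq_bigr => k _; rewrite rowK.
Qed.

Lemma bcoord_uniq f (a : 'I_n -> R) : bmx f \in unitmx ->
  forall k, bcoord f (\sum_k a k *: w (f k)) 0 k = a k.
Proof.
move=> fu k; have -> : \sum_k a k *: w (f k) = (\row_k a k) *m bmx f.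
  by rewrite mulmx_sum_row; apply: eq_bigr => i _; rewrite rowK mxE.
by rewrite /bcoord mulmxK// mxE.
Qed.

Lemma bcoord_sum (J : finType) (a : J -> R) (u : J -> 'rV[R]_n) f k :
  bcoord f (\sum_j a j *: u j) 0 k = \sum_j a j * bcoord f (u j) 0 k.
Proof.
rewrite /bcoord mulmx_suml summxE; apply: eq_bigr => j _.
by rewrite -scalemxAl mxE.
Qed.

Lemma bcoord_row f i k : bmx f \in unitmx -> bcoord f (w (f i)) 0 k = (k == i)%:R.
Proof.
move=> fu; have -> : w (f i) = \sum_j (j == i)%:R *: w (f j).
  rewrite (bigD1 i)//= eqxx scale1r big1 ?addr0// => j /negbTE->.
  by rewrite scale0r.
by rewrite (bcoord_uniq (fun j => (j == i)%:R)).
Qed.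

Lemma bmx_inj f : bmx f \in unitmx -> injective f.
Proof.
move=> fu i k fik; apply/eqP; have := bcoord_row k i fu.
by rewrite -fik (bcoord_row i i fu) eqxx; case: (i == k) => // /eqP; rewrite oner_eq0.
Qed.

(** In a vanishing combination of the new vectors, the old [k]th coordinate comes from [w j] alone,
    so its coefficient is 0; the others then vanish too. *)
Lemma bmx_exchange f k j : bmx f \in unitmx -> bcoord f (w j) 0 k != 0 ->
  bmx (bset f k j) \in unitmx.
Proof.
move=> fu jk; rewrite -row_free_unit; apply: inj_row_free => u.
rewrite mulmx_sum_row (bigD1 k)//= rowK ffunE eqxx => u0.
have H i : u 0 k * bcoord f (w j) 0 i + u 0 i *+ (i != k) = 0.
  pose v := \sum_i (u 0 i *+ (i != k)) *: w (f i).
  have vE : v = \sum_(i < n | i != k) u 0 i *: row i (bmx (bset f k j)).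
    rewrite /v (bigD1 k)//= eqxx scale0r add0r; apply: eq_bigr => i' ik.
    by rewrite ik rowK ffunE (negbTE ik).
  rewrite -(bcoord_uniq (fun i => u 0 i *+ (i != k)) fu i) -/v.
  have -> : u 0 k * bcoord f (w j) 0 i + bcoord f v 0 i = bcoord f (u 0 k *: w j + v) 0 i.
    by rewrite /bcoord mulmxDl -scalemxAl [RHS]mxE [X in _ = X + _]mxE.
  by rewrite vE u0 /bcoord mul0mx mxE.
have uk : u 0 k = 0.
  have /eqP := H k; rewrite eqxx addr0 mulf_eq0 (negbTE jk) orbF => /eqP//.
apply/rowP => i; rewrite mxE; have [->//|ik] := eqVneq i k.
by have := H i; rewrite uk mul0r add0r ik.
Qed.

Lemma spread_codom f a k : injective f -> spread f a (f k) = a k.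
Proof.
move=> fi; rewrite /spread (bigD1 k)//= eqxx big1 ?addr0// => i ik.
by rewrite (inj_eq fi) eq_sym (negbTE ik).
Qed.

Lemma spread_notin f a i : i \notin codom f -> spread f a i = 0.
Proof.
move=> iN; rewrite /spread big1// => k _; case: eqP => // ifk.
by move: iN; rewrite ifk codom_f.
Qed.

Lemma sum_spread (U : lmodType R) (g : I -> U) f a :
  \sum_i spread f a i *: g i = \sum_k a k *: g (f k).
Proof.
under eq_bigr do rewrite scaler_suml.
rewrite exchange_big/=; apply: eq_bigr => k _.
rewrite (bigD1 (f k))//= eqxx big1 ?addr0// => i /negbTE->.
by rewrite scale0r.
Qed.

Lemma supported_spread f l : injective f ->
  (forall i, i \notin codom f -> l i = 0) -> l =1 spread f (l \o f).
Proof.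
move=> fi l0 i; have [/codomP[k ->]|iN] := boolP (i \in codom f).
  by rewrite spread_codom.
by rewrite l0// spread_notin.
Qed.

Variable c : I -> R.
Hypothesis c_gt0 : forall i, 0 < c i.

(** The linear functional that agrees with [c] on the basis [f]. Dual feasibility says that it
    solves the dual program, that is, all reduced costs are nonnegative. *)
Definition bcost f x := \sum_k bcoord f x 0 k * c (f k).
Definition dual_feasible f := forall j, bcost f (w j) <= c j.

Lemma bcost_sum (J : finType) (a : J -> R) (u : J -> 'rV[R]_n) f :
  bcost f (\sum_j a j *: u j) = \sum_j a j * bcost f (u j).
Proof.
rewrite /bcost; under eq_bigr do rewrite bcoord_sum mulr_suml.
rewrite exchange_big/=; apply: eq_bigr => j _; rewrite mulr_sumr.
by apply: eq_bigr => k _; rewrite mulrA.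
Qed.

Lemma bcost_row f k : bmx f \in unitmx -> bcost f (w (f k)) = c (f k).
Proof.
move=> fu; rewrite /bcost (bigD1 k)//= bcoord_row// eqxx mul1r big1 ?addr0// => i ik.
by rewrite bcoord_row// (negbTE ik) mul0r.
Qed.

Lemma supported_bcoord f l : bmx f \in unitmx ->
  (forall i, i \notin codom f -> l i = 0) ->
  (forall k, bcoord f (\sum_i l i *: w i) 0 k = l (f k)) /\
  bcost f (\sum_i l i *: w i) = \sum_i c i * l i.
Proof.
move=> fu l0; have fi := bmx_inj fu.
have E (U : lmodType R) (g : I -> U) : \sum_i l i *: g i = \sum_k l (f k) *: g (f k).
  rewrite -(sum_spread g f (l \o f)); apply: eq_bigr => i _.
  by rewrite -supported_spread.
have H k : bcoord f (\sum_i l i *: w i) 0 k = l (f k).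
  by rewrite E (bcoord_uniq (l \o f)).
split=> //; rewrite /bcost; under eq_bigr do rewrite H.
by under [RHS]eq_bigr do rewrite mulrC; exact/esym/(E R^o c).
Qed.

(** The ratio test of the simplex method: [t] is the largest step along [d] that keeps all
    coefficients nonnegative. *)
Lemma step_to_boundary l (d : I -> R) : (forall i, 0 <= l i) ->
  (exists i, d i < 0) -> exists t i0, [/\ t = l i0 / - d i0, d i0 < 0,
    l i0 + t * d i0 = 0 & forall i, 0 <= l i + t * d i].
Proof.
move=> l0 [j dj]; case: (@arg_minP _ _ _ j (fun i => d i < 0) (fun i => l i / - d i)) => //.
move=> i0 di0 imin; exists (l i0 / - d i0), i0; split => //.
  by field; rewrite lt_eqF.
move=> i; have t0 : 0 <= l i0 / - d i0 by rewrite divr_ge0// oppr_ge0 ltW.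
have [di|di] := ltP (d i) 0; last by rewrite addr_ge0// mulr_ge0.
have := imin i di; rewrite ler_pdivlMr ?oppr_gt0// mulrN; lra.
Qed.

(** The direction in which [j] enters the basis: one unit of [w j] minus its expansion in [f], a
    linear relation among the vectors. *)
Let dir f j i : R := (i == j)%:R - spread f (bcoord f (w j) 0) i.

Let dir_sum f j (U : lmodType R) (g : I -> U) :
  \sum_i dir f j i *: g i = g j - \sum_k bcoord f (w j) 0 k *: g (f k).
Proof.
rewrite /dir; under eq_bigr do rewrite scalerBl.
rewrite sumrB sum_spread; congr (_ - _).
rewrite (bigD1 j)//= eqxx scale1r big1 ?addr0// => i /negbTE->.
by rewrite scale0r.
Qed.

Let dir_w f j : bmx f \in unitmx -> \sum_i dir f j i *: w i = 0.
Proof. by move=> fu; rewrite dir_sum -bcoordE// subrr. Qed.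

Let dir_c f j : \sum_i c i * dir f j i = c j - bcost f (w j).
Proof.
by under eq_bigr do rewrite mulrC; exact: (dir_sum f j (U := R^o) c).
Qed.

Let dir_out f j i : i \notin codom f -> i != j -> dir f j i = 0.
Proof. by move=> iN ij; rewrite /dir spread_notin// (negbTE ij) subrr. Qed.

Let dir_self f j : j \notin codom f -> dir f j j = 1.
Proof. by move=> jN; rewrite /dir spread_notin// eqxx subr0. Qed.

Let dir_in f j k : bmx f \in unitmx -> j \notin codom f ->
  dir f j (f k) = - bcoord f (w j) 0 k.
Proof.
move=> fu jN; rewrite /dir spread_codom; last exact: bmx_inj.
case: eqP => [e|_]; last by rewrite sub0r.
by move: jN; rewrite -e codom_f.
Qed.

Let codom_bset f k j i : i != f k -> i \notin codom (bset f k j) -> (i \notin codom f) && (i != j).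
Proof.
move=> ifk iN; apply/andP; split; apply: contra iN.
  move=> /codomP[k' ik']; apply/codomP; exists k'; rewrite ffunE; case: eqP => [kk|//].
  by move: ifk; rewrite ik' kk eqxx.
by move=> /eqP ->; apply/codomP; exists k; rewrite ffunE eqxx.
Qed.

(* Simplex-method pivoting: move along a linear relation in the direction that does not
   increase the cost, until a coefficient vanishes. *)
Lemma basis_of_combination (D : nat) f l : bmx f \in unitmx -> (forall i, 0 <= l i) ->
  (#|[set i | (l i != 0%R) && (i \notin codom f)]%SET| <= D)%N ->
  exists g, [/\ bmx g \in unitmx, forall k, 0 <= bcoord g (\sum_i l i *: w i) 0 k &
    bcost g (\sum_i l i *: w i) <= \sum_i c i * l i].
Proof.
elim: D f l => [|D ih] f l fu l0.
  rewrite leqn0 cards_eq0 => /eqP S0.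
  have lN i : i \notin codom f -> l i = 0.
    move=> iN; apply/eqP/negPn/negP => li.
    by have : i \in (finset.set0 : {set I}); [rewrite -S0 inE li iN|rewrite inE].
  have [H1 H2] := supported_bcoord fu lN.
  by exists f; split => // [k|]; rewrite ?H1 ?H2.
set S := finset _ => SD.
have [S0|[j jS]] := set_0Vmem S; first by apply: (ih f) => //; rewrite -/S S0 cards0.
move: (jS); rewrite inE => /andP[lj jN].
pose s : R := if \sum_i c i * dir f j i <= 0 then 1 else -1.
have s0 : s != 0 by rewrite /s; case: ifP => _; rewrite ?oppr_eq0 oner_eq0.
pose d i := s * dir f j i.
have dw : \sum_i d i *: w i = 0.
  by under eq_bigr do rewrite -scalerA; rewrite -scaler_sumr dir_w// scaler0.
have dc : \sum_i c i * d i <= 0.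
  under eq_bigr do rewrite mulrCA; rewrite -mulr_sumr /s.
  by case: ifPn => [|/negbTE]; rewrite ?mul1r// mulN1r oppr_le0 => /negbT; rewrite -ltNge => /ltW.
(* Costs are positive, so a nonnegative [d] of nonpositive cost would vanish, whereas [d j = s] is
   not 0. *)
have [i di] : exists i, d i < 0.
  apply/not_existsP => dN; have d0 i : 0 <= d i by rewrite leNgt; apply/negP/dN.
  have : \sum_i c i * d i = 0.
    by apply/eqP; rewrite eq_le dc sumr_ge0// => i _; rewrite mulr_ge0// ltW.
  move=> /eqP; rewrite psumr_eq0; last by move=> i _; rewrite mulr_ge0// ltW.
  move=> /allP/(_ j); rewrite mem_index_enum => /(_ isT).
  by rewrite /d dir_self// mulr1 mulf_eq0 gt_eqF//= (negbTE s0).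
have [|t [i0 [tE di0 l'0 l'ge]]] := step_to_boundary l0 (d := d); first by exists i.
have t0 : 0 <= t by rewrite tE divr_ge0// oppr_ge0 ltW.
pose l' i := l i + t * d i.
have l'w : \sum_i l' i *: w i = \sum_i l i *: w i.
  under eq_bigr do rewrite scalerDl -scalerA.
  by rewrite big_split/= -scaler_sumr dw scaler0 addr0.
have l'c : \sum_i c i * l' i <= \sum_i c i * l i.
  under eq_bigr do rewrite mulrDr mulrCA.
  by rewrite big_split/= -mulr_sumr gerDl mulr_ge0_le0.
(* The induction runs on the number of support indices outside the basis. Either a basis element
   leaves and [j] replaces it, or [j] itself reaches 0; both remove [j] from that set. *)
have fin g : bmx g \in unitmx ->
    [set i | (l' i != 0) && (i \notin codom g)]%SET \subset (S :\ j)%SET ->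
    exists g, [/\ bmx g \in unitmx, forall k, 0 <= bcoord g (\sum_i l i *: w i) 0 k &
    bcost g (\sum_i l i *: w i) <= \sum_i c i * l i].
  move=> gu /subset_leq_card gS; have [||h [hu h1 h2]] := ih g l' gu.
  - exact: l'ge.
  - by rewrite (leq_trans gS)// -ltnS (leq_trans _ SD)// (cardsD1 j S) jS.
  by exists h; split => //; [rewrite -l'w|rewrite -l'w (le_trans h2)].
have [/codomP[k i0k]|i0N] := boolP (i0 \in codom f).
  apply: (fin (bset f k j)).
    apply: bmx_exchange => //; move: di0; rewrite /d i0k dir_in//.
    by apply: contraTneq => ->; rewrite oppr0 mulr0 ltxx.
  apply/fintype.subsetP => i'; rewrite !inE => /andP[l'i iN].
  have ifk : i' != f k by apply: contraNneq l'i => ->; rewrite /l' -i0k l'0.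
  have /andP[iNf ij] := codom_bset ifk iN.
  by move: l'i; rewrite /l' /d dir_out// !mulr0 addr0 => ->; rewrite ij iNf.
have i0j : i0 = j.
  apply/eqP/negPn/negP => ij; move: di0; rewrite /d dir_out// mulr0 ltxx//.
apply: (fin f) => //; apply/fintype.subsetP => i'; rewrite !inE => /andP[l'i iN].
have ij : i' != j by apply: contraNneq l'i => ->; rewrite /l' -{1 2}i0j l'0.
by move: l'i; rewrite /l' /d dir_out// !mulr0 addr0 => ->; rewrite ij iN.
Qed.

(** Take a cheapest basis with nonnegative coordinates of [x]. A negative reduced cost would allow a
    pivot, and as no coordinate of [x] vanishes the step is positive and strictly lowers the
    cost. *)
Lemma dual_feasible_basis x f0 : bmx f0 \in unitmx ->
  (forall k, 0 <= bcoord f0 x 0 k) ->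
  (forall f k, bmx f \in unitmx -> bcoord f x 0 k != 0) ->
  exists f, [/\ bmx f \in unitmx, dual_feasible f, forall k, 0 < bcoord f x 0 k &
    bcost f x <= bcost f0 x].
Proof.
move=> f0u f00 nd.
pose P f := (bmx f \in unitmx) && [forall k, 0 <= bcoord f x 0 k].
have Pf0 : P f0 by rewrite /P f0u; apply/forallP.
case: (@arg_minP _ _ _ f0 P (bcost^~ x) Pf0) => f /andP[fu /forallP fge] fmin.
have fgt k : 0 < bcoord f x 0 k by rewrite lt_def nd//=; exact: fge.
exists f; split => //; last exact: fmin.
move=> j; rewrite leNgt; apply/negP => cj.
have jN : j \notin codom f.
  by apply/negP => /codomP[k jk]; move: cj; rewrite jk bcost_row// ltxx.
have fi := bmx_inj fu.
pose l := spread f (bcoord f x 0).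
have l0 i : 0 <= l i.
  have [/codomP[k ->]|iN] := boolP (i \in codom f); first by rewrite /l spread_codom.
  by rewrite /l spread_notin.
(* Otherwise [w j] has no positive coordinate in [f], so its functional value is at most 0 and
   cannot exceed [c j > 0]. *)
have [i di] : exists i, dir f j i < 0.
  apply/not_existsP => dN; have d0 k : bcoord f (w j) 0 k <= 0.
    by rewrite leNgt; apply/negP => h; apply: (dN (f k)); rewrite dir_in// oppr_lt0.
  have : bcost f (w j) <= 0.
    by rewrite /bcost sumr_le0// => k _; rewrite mulr_le0_ge0// ltW.
  by move=> /(lt_le_trans cj); rewrite ltNge ltW.
have [|t [i0 [tE di0 l'0 l'ge]]] := step_to_boundary l0 (d := dir f j); first by exists i.
have [k i0k] : exists k, i0 = f k.
  apply/codomP/negPn/negP => iN; have [ij|ij] := eqVneq i0 j.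
    by move: di0; rewrite ij dir_self// ltNge ler01.
  by move: di0; rewrite dir_out// ltxx.
have t0 : 0 < t by rewrite tE divr_gt0 ?oppr_gt0// i0k /l spread_codom.
pose l' i := l i + t * dir f j i.
have lw : \sum_i l i *: w i = x by rewrite sum_spread -bcoordE.
have l'w : \sum_i l' i *: w i = x.
  under eq_bigr do rewrite scalerDl -scalerA.
  by rewrite big_split/= -scaler_sumr dir_w// scaler0 addr0.
have lc : \sum_i c i * l i = bcost f x.
  by under eq_bigr do rewrite mulrC; exact: (sum_spread (U := R^o) c).
have gu : bmx (bset f k j) \in unitmx.
  apply: bmx_exchange => //; move: di0; rewrite i0k dir_in//.
  by apply: contraTneq => ->; rewrite oppr0 ltxx.
have l'N i' : i' \notin codom (bset f k j) -> l' i' = 0.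
  move=> iN; have [->|ifk] := eqVneq i' (f k); first by rewrite /l' -i0k.
  have /andP[iNf ij] := codom_bset ifk iN.
  by rewrite /l' dir_out// mulr0 addr0 /l spread_notin.
have [H1 H2] := supported_bcoord gu l'N.
have : bcost f x <= bcost (bset f k j) x.
  by apply: fmin; rewrite /P gu; apply/forallP => k'; rewrite -l'w H1; exact: l'ge.
rewrite -{2}l'w H2; under eq_bigr do rewrite mulrDr mulrCA.
rewrite big_split/= lc -mulr_sumr dir_c leNgt => /negP; apply.
by rewrite gtrDl pmulr_rlt0// subr_lt0.
Qed.

(** Complementary slackness: both functionals take the same value at [x], whose coordinates in [g]
    are positive, so the functional of [f] equals the cost on every member of [g]. Genericity puts
    these members in [f]. *)
Lemma dual_feasible_codom f g x : bmx f \in unitmx -> bmx g \in unitmx ->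
  dual_feasible f -> dual_feasible g ->
  (forall j, j \notin codom f -> bcost f (w j) != c j) ->
  (forall k, 0 < bcoord f x 0 k) -> (forall k, 0 < bcoord g x 0 k) ->
  {subset codom g <= codom f}.
Proof.
move=> fu gu fd gd gen fx gx.
have E h h' : bmx h' \in unitmx ->
    bcost h x = \sum_k bcoord h' x 0 k * bcost h (w (h' k)).
  by move=> h'u; rewrite {1}(bcoordE x h'u) bcost_sum.
have le h h' : bmx h' \in unitmx -> dual_feasible h -> (forall k, 0 < bcoord h' x 0 k) ->
    bcost h x <= bcost h' x.
  move=> h'u hd h'x; rewrite (E h h')//; apply: ler_sum => k _.
  by apply: ler_wpM2l; [exact: ltW|exact: hd].
have e : bcost f x = bcost g x by apply/eqP; rewrite eq_le !le.
have /eqP : \sum_k bcoord g x 0 k * (c (g k) - bcost f (w (g k))) = 0.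
  under eq_bigr do rewrite mulrBr.
  by rewrite sumrB -E// e subrr.
rewrite psumr_eq0; last first.
  by move=> k _; rewrite mulr_ge0 ?subr_ge0// ltW.
move=> /allP H _ /codomP[k ->]; apply/negPn/negP => gN.
have := H k; rewrite mem_index_enum => /(_ isT); rewrite mulf_eq0 gt_eqF//=.
by rewrite subr_eq0 eq_sym (negbTE (gen _ gN)).
Qed.

End bases.

(** Costs [1 + e ^ (rank + 1)]: each coincidence to be avoided is a nonzero polynomial in [e], since
    the power attached to [j] occurs only once. Costs close to 1 keep the cost of a combination
    close to its sum of coefficients. *)
Lemma generic_costs (R : realFieldType) (n : nat) (I : finType) (w : I -> 'rV[R]_n)
    (del : R) : 0 < del <= 1 ->
  exists c : I -> R, (forall i, 1 <= c i <= 1 + del) /\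
    forall f j, bmx w f \in unitmx -> j \notin codom f -> bcost w c f (w j) != c j.
Proof.
move=> /andP[del0 del1].
pose p (fj : {ffun 'I_n -> I} * I) : {poly R} :=
  if fj.2 \in codom fj.1 then 1 else
  \sum_k bcoord w fj.1 (w fj.2) 0 k *: (1 + 'X^((enum_rank (fj.1 k)).+1))
    - (1 + 'X^((enum_rank fj.2).+1)).
have pn0 fj : p fj != 0.
  rewrite /p; case: ifPn => [_|jN]; first exact: oner_neq0.
  apply/eqP => /(congr1 (fun q : {poly R} => q`_((enum_rank fj.2).+1))).
  rewrite coefB coef_sum coefD coef1 coefXn eqxx coef0/= add0r big1 => [|k _].
    by rewrite sub0r => /eqP; rewrite oppr_eq0 oner_eq0.
  rewrite coefZ coefD coef1 coefXn/= add0r eqSS.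
  case: eqP => [/val_inj/enum_rank_inj e|_]; last by rewrite mulr0.
  by move: jN; rewrite e codom_f.
pose q := \prod_fj p fj.
have q0 : q != 0 by apply/prodf_neq0 => fj _.
(* [size q] distinct candidates in [(0, del]], more than [q] has roots. *)
pose rs := [seq del / s.+1%:R | s <- iota 0 (size q)].
have [e ers eq] : exists2 e, e \in rs & ~~ root q e.
  apply/hasP; rewrite has_predC; apply/negP => /max_poly_roots -/(_ q0).
  rewrite /rs map_inj_uniq ?iota_uniq ?size_map ?size_iota ?ltnn; first by move=> /(_ isT).
  by move=> s t /(mulfI (lt0r_neq0 del0))/invr_inj/eqP; rewrite eqr_nat => /eqP[].
have /mapP[s _ eE] := ers.
have e0 : 0 < e by rewrite eE divr_gt0.
have ed : e <= del by rewrite eE ler_pdivrMr// ler_peMr ?ler1n// ltW.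
exists (fun i => 1 + e ^+ (enum_rank i).+1); split => [i|f j fu jN].
  have ge0 := ltW e0; rewrite lerDl exprn_ge0//= lerD2l exprS (le_trans _ ed)//.
  by rewrite ler_piMr// exprn_ile1// (le_trans ed).
apply: contra eq => /eqP eq; rewrite rootE /q horner_prod (bigD1 (f, j))//=.
rewrite {1}/p/= (negbTE jN) hornerD hornerN horner_sum.
have -> : \sum_k (bcoord w f (w j) 0 k *: (1 + 'X^((enum_rank (f k)).+1))).[e] =
    bcost w (fun i => 1 + e ^+ (enum_rank i).+1) f (w j).
  by apply: eq_bigr => k _; rewrite hornerZ hornerD hornerC hornerXn.
by rewrite hornerD hornerC hornerXn eq subrr mul0r.
Qed.

(** * Inner products and squared norms *)

Section sqnorm.
Context {R : realType}.

Definition dotp m (x y : 'rV[R]_m) : R := \sum_j x 0 j * y 0 j.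

Lemma sqnorm_ge0 m (x : 'rV[R]_m) : 0 <= sqnorm x.
Proof. by apply: sumr_ge0 => j _; rewrite sqr_ge0. Qed.

Lemma sqnormD m (x y : 'rV[R]_m) : sqnorm (x + y) = sqnorm x + sqnorm y + 2 * dotp x y.
Proof.
rewrite /sqnorm /dotp mulr_sumr -!big_split/=; apply: eq_bigr => j _.
by rewrite mxE; ring.
Qed.

Lemma dotpZr m s (x y : 'rV[R]_m) : dotp x (s *: y) = s * dotp x y.
Proof. by rewrite /dotp mulr_sumr; apply: eq_bigr => j _; rewrite mxE; ring. Qed.

Lemma dotpZl m s (x y : 'rV[R]_m) : dotp (s *: x) y = s * dotp x y.
Proof. by rewrite /dotp mulr_sumr; apply: eq_bigr => j _; rewrite mxE; ring. Qed.

Lemma dotpDr m (x y z : 'rV[R]_m) : dotp x (y + z) = dotp x y + dotp x z.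
Proof. by rewrite /dotp -big_split/=; apply: eq_bigr => j _; rewrite mxE; ring. Qed.

Lemma dotpC m (x y : 'rV[R]_m) : dotp x y = dotp y x.
Proof. by rewrite /dotp; apply: eq_bigr => j _; rewrite mulrC. Qed.

Lemma sqnormZ m s (x : 'rV[R]_m) : sqnorm (s *: x) = s ^+ 2 * sqnorm x.
Proof. by rewrite /sqnorm mulr_sumr; apply: eq_bigr => j _; rewrite mxE exprMn. Qed.

End sqnorm.

(** * Triangulation of a hull and its second moment *)

Section hull.
Context {R : realType} (m : nat) (I : finType).
Local Notation n := m.+2.
Local Notation V := 'rV[R]_n.
Local Notation mu := (@leb R m.+1).
Local Notation T := (@lebT R m.+1).
Variable w : I -> V.

(** The sum is only bounded by 1, which adds the origin; for a nonempty family closed under sign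
    change the set is the convex hull itself. *)
Definition hull : set V := [set x | exists l : I -> R,
  [/\ forall i, 0 <= l i, \sum_i l i <= 1 & x = \sum_i l i *: w i]].

Lemma leb_hyperplane k : @leb_outer R n [set x : V | x 0 k = 0] = 0%E.
Proof.
apply/eqP; rewrite eq_le leb_outer_ge0 andbT.
pose a j : V := \row_i (if i == k then 0 else - j%:R).
pose b j : V := \row_i (if i == k then 0 else j%:R).
have /leb_outer_cover : [set x : V | x 0 k = 0] `<=` \bigcup_j box (a j) (b j).
  move=> x /= xk; pose s := \sum_i `|x 0 i|.
  exists (Num.truncn s).+1 => // i; rewrite !mxE; case: eqP => [->|_].
    by rewrite xk lexx.
  rewrite -ler_norml (@le_trans _ _ s)//; last exact/ltW/truncnS_gt.
  by rewrite /s (bigD1 i)//= lerDl sumr_ge0.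
move=> /le_trans; apply; rewrite eseries0// => j _ _.
by rewrite /box_vol (bigD1 k)//= !mxE eqxx subrr maxxx mul0r.
Qed.

Let S (s : R) f : set T := [set (x : V) *m (s *: bmx w f) | x in @simplexo R m].

Let sbmx_unit s f : 0 < s -> bmx w f \in unitmx -> s *: bmx w f \in unitmx.
Proof. by move=> s0 fu; rewrite unitmxZ ?unitfE ?gt_eqF. Qed.

Let S_coord s f (x : V) : 0 < s -> bmx w f \in unitmx ->
  S s f x <-> (forall k, 0 < bcoord w f x 0 k) /\ \sum_k bcoord w f x 0 k <= s.
Proof.
move=> s0 fu; split.
  move=> [y [y0 y1] <-]; have E k : bcoord w f ((y : V) *m (s *: bmx w f)) 0 k = s * (y : V) 0 k.
    by rewrite -scalemxAr /bcoord -scalemxAl mulmxK// mxE.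
  split => [k|]; first by rewrite E mulr_gt0.
  under eq_bigr do rewrite E.
  by rewrite -mulr_sumr -[leRHS]mulr1 ler_pM2l.
move=> [x0 x1]; exists (s^-1 *: bcoord w f x).
  split => [k|]; first by rewrite mxE mulr_gt0 ?invr_gt0.
  by under eq_bigr do rewrite mxE; rewrite -mulr_sumr ler_pdivrMl ?mulr1.
by rewrite -scalemxAr -scalemxAl scalerA divff ?gt_eqF// scale1r /bcoord mulmxKV.
Qed.

Let S_measurable s f : 0 < s -> bmx w f \in unitmx -> measurable (S s f).
Proof.
by move=> s0 fu; apply: caratheodory_lin; [exact: sbmx_unit|exact: measurable_simplexo].
Qed.

Let leb_S s f : 0 < s -> bmx w f \in unitmx -> mu (S s f) = ((s ^+ n)%:E * mu (S 1 f))%E.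
Proof.
move=> s0 fu; rewrite /S scale1r !leb_lin//; last exact: sbmx_unit.
by rewrite detZ normrM ger0_norm ?exprn_ge0 ?ltW// EFinM muleA.
Qed.

(** The null set where the pivoting argument could stall: some coordinate in some basis is 0. *)
Let degenerate : set T :=
  \bigcup_(p in [set p : {ffun 'I_n -> I} * 'I_n | bmx w p.1 \in unitmx])
    [set x : V | bcoord w p.1 x 0 p.2 = 0].

Let degenerate_piece (p : {ffun 'I_n -> I} * 'I_n) : bmx w p.1 \in unitmx ->
  [set x : V | bcoord w p.1 x 0 p.2 = 0] =
  [set x *m bmx w p.1 | x in [set x : V | x 0 p.2 = 0]].
Proof.
move=> fu; apply/seteqP; split => [x xk|_ [x xk <-]] /=.
  by exists (bcoord w p.1 x) => //; rewrite /bcoord mulmxKV.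
by rewrite /bcoord mulmxK.
Qed.

Let degenerate_measurable : measurable degenerate.
Proof.
apply: fin_bigcup_measurable => // p fu; rewrite degenerate_piece//.
apply: caratheodory_lin => //.
have := @measurable_coord R m.+1 p.2 measurableT [set 0] (measurable_set1 0).
by rewrite setTI; congr measurable; apply/seteqP; split.
Qed.

Let leb_degenerate : mu degenerate = 0%E.
Proof.
apply/eqP; rewrite eq_le measure_ge0 andbT.
have : degenerate `<=` \bigcup_(p : {ffun 'I_n -> I} * 'I_n)
    (if bmx w p.1 \in unitmx then [set x : V | bcoord w p.1 x 0 p.2 = 0] else set0).
  by move=> x [p /= fu xp]; exists p => //; rewrite fu.
move=> /le_leb_outer/le_trans; apply; apply: le_trans (leb_outer_finU _) _.
rewrite big1// => p _.
case: ifPn => fu; last by rewrite leb_outer0.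
by rewrite degenerate_piece// leb_outer_lin// leb_hyperplane mule0.
Qed.

Variables (c : I -> R) (del : R).
Hypothesis del0 : 0 < del.
Hypothesis c_itv : forall i, 1 <= c i <= 1 + del.
Hypothesis c_gen : forall f j, bmx w f \in unitmx -> j \notin codom f ->
  bcost w c f (w j) != c j.

Let c_gt0 i : 0 < c i.
Proof. by case/andP: (c_itv i) => /(lt_le_trans ltr01). Qed.

Let opt (f : {ffun 'I_n -> I}) :=
  (bmx w f \in unitmx) && [forall j, bcost w c f (w j) <= c j].
Let same (f g : {ffun 'I_n -> I}) := [forall i, (i \in codom f) == (i \in codom g)].
(** A basis is an ordered tuple, so a simplex appears once for each ordering of its vertices; [rep]
    selects one ordering per vertex set. *)
Let rep f := odflt f [pick g | opt g && same g f].
Let good f := opt f && (rep f == f).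

Let same_codomP (f g : {ffun 'I_n -> I}) : reflect (codom f =i codom g) (same f g).
Proof. by apply: (iffP forallP) => h i; apply/eqP; exact: h. Qed.

Let rep_opt f : opt f -> opt (rep f) && same (rep f) f.
Proof.
move=> fo; have ff : same f f by apply/same_codomP.
by rewrite /rep; case: pickP => [g //|/(_ f)]; rewrite fo ff.
Qed.

Let rep_same f g : opt f -> opt g -> same f g -> rep f = rep g.
Proof.
move=> fo go /same_codomP fg; rewrite /rep.
have -> : [pick h | opt h && same h f] = [pick h | opt h && same h g].
  apply: eq_pick => h; congr (_ && _).
  by apply/same_codomP/same_codomP => H i; rewrite H fg.
have gg : same g g by apply/same_codomP.
by case: pickP => [//|/(_ g)]; rewrite go gg.
Qed.

Let good_rep f : opt f -> good (rep f).
Proof.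
move=> fo; have /andP[ro rs] := rep_opt fo.
by rewrite /good ro; apply/eqP; exact: rep_same.
Qed.

Let F s f : set T := if good f then S s f else set0.

Let F_measurable s f : 0 < s -> measurable (F s f).
Proof.
move=> s0; rewrite /F; case: ifPn => // /andP[/andP[fu _] _]; exact: S_measurable.
Qed.

Let F_trivIset s : 0 < s -> trivIset setT (F s).
Proof.
move=> s0; apply/trivIsetP => f g _ _ fg; rewrite /F.
case: ifPn => [|_]; last by rewrite set0I.
case: ifPn => [|_]; last by rewrite setI0.
move=> /andP[go /eqP gr] /andP[fo /eqP fr]; apply/seteqP; split => // x [Sf Sg].
move: (fo) (go) => /andP[fu /forallP fd] /andP[gu /forallP gd].
have [fx _] := (S_coord x s0 fu).1 Sf; have [gx _] := (S_coord x s0 gu).1 Sg.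
move/eqP: fg; apply; rewrite -fr -gr; apply: rep_same => //; apply/same_codomP => i.
have gen h : bmx w h \in unitmx -> forall j, j \notin codom h -> bcost w c h (w j) != c j.
  by move=> hu j; exact: c_gen.
apply/idP/idP; first exact: (dual_feasible_codom gu fu gd fd (gen g gu) gx fx).
exact: (dual_feasible_codom fu gu fd gd (gen f fu) fx gx).
Qed.

Let F_sub_hull f : F 1 f `<=` hull.
Proof.
rewrite /F; case: ifPn => [/andP[/andP[fu _] _]|_ x//].
move=> x /(S_coord x ltr01 fu)[x0 x1].
exists (spread f (bcoord w f x 0)); split.
- by move=> i; apply: sumr_ge0 => k _; rewrite mulrn_wge0 ?ltW.
- have := sum_spread (U := R^o) (fun=> 1) f (bcoord w f x 0).
  under eq_bigr do rewrite -[_ *: _]/(_ * _) mulr1.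
  by under [X in _ = X -> _]eq_bigr do rewrite -[_ *: _]/(_ * _) mulr1; move=> ->.
- by rewrite sum_spread -bcoordE.
Qed.

(** A combination with coefficient sum at most 1 costs at most [1 + del]. Passing to an optimal
    basis does not raise the cost, and the cost bounds the new coefficient sum because [c >= 1]. *)
Let hull_cover f0 : bmx w f0 \in unitmx ->
  hull `<=` degenerate `|` \bigcup_f F (1 + del) f.
Proof.
move=> f0u x [l [l0 l1 xE]]; have s0 : 0 < 1 + del by rewrite addr_gt0.
have [|nd] := pselect (degenerate x); [by left|right].
have [g [gu g0 gc]] := basis_of_combination c_gt0 f0u l0 (leqnn _).
rewrite -xE in g0 gc.
have [|f [fu fd fx fc]] := dual_feasible_basis c_gt0 gu g0.
  by move=> f k fu; apply/eqP => fk; apply: nd; exists (f, k).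
have fo : opt f by rewrite /opt fu; apply/forallP.
exists (rep f) => //; rewrite /F good_rep//.
have /andP[/andP[ru _] /same_codomP rs] := rep_opt fo.
pose l' := spread f (bcoord w f x 0).
have l'w : \sum_i l' i *: w i = x by rewrite sum_spread -bcoordE.
have l'N i : i \notin codom (rep f) -> l' i = 0 by rewrite rs; exact: spread_notin.
have l'Nf i : i \notin codom f -> l' i = 0 by exact: spread_notin.
have [H1 H2] := supported_bcoord c ru l'N; have [_ H3] := supported_bcoord c fu l'Nf.
rewrite l'w in H1 H2 H3.
have r0 k : 0 < bcoord w (rep f) x 0 k.
  have : rep f k \in codom f by rewrite -rs codom_f.
  by rewrite H1 => /codomP[k' ->]; rewrite /l' spread_codom//; exact: bmx_inj fu.
apply/S_coord => //; split => //.
apply: (@le_trans _ _ (bcost w c (rep f) x)).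
  apply: ler_sum => k _; apply: ler_peMr; first exact: ltW.
  by case/andP: (c_itv (rep f k)).
rewrite H2 -H3 (le_trans fc)// (le_trans gc)//.
apply: (@le_trans _ _ ((1 + del) * \sum_i l i)); last first.
  by rewrite -[leRHS]mulr1 ler_pM2l.
rewrite mulr_sumr; apply: ler_sum => i _; rewrite ler_wpM2r//.
by case/andP: (c_itv i).
Qed.

Variables (B h : R).
Hypothesis h0 : 0 < h.
Hypothesis wB : forall f, bmx w f \in unitmx ->
  sqnorm (\sum_k w (f k)) + \sum_k sqnorm (w (f k)) <= B.

Let B_ge0 f : bmx w f \in unitmx -> 0 <= B.
Proof.
move=> fu; apply: le_trans (wB fu); rewrite addr_ge0 ?sqnorm_ge0//.
by apply: sumr_ge0 => k _; exact: sqnorm_ge0.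
Qed.

Let msq : measurable_fun [set: T] (fun x : T => sqnorm (x : V)).
Proof.
by apply: measurable_sum => j; apply: measurable_funX; exact: measurable_coord.
Qed.

Let msqh (D : set T) : measurable_fun D (fun x : T => (sqnorm (x : V) + h)%:E).
Proof.
by apply/measurable_EFinP; apply: measurable_funTS; apply: measurable_funD.
Qed.

Let bnd := (1 + del) ^+ 2 * B / (n%:R * n.+1%:R) + h.

Let integral_F f : (\int[mu]_(x in F (1 + del) f) (sqnorm (x : V) + h)%:E <=
   ((1 + del) ^+ n * bnd)%:E * mu (F 1 f))%E.
Proof.
have s0 : 0 < 1 + del by rewrite addr_gt0.
rewrite /F; case: ifPn => [/andP[/andP[fu _] _]|_]; last first.
  by rewrite integral_set0 measure0 mule0.
have mS := S_measurable s0 fu.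
rewrite EFinM muleAC -leb_S//.
under eq_integral do rewrite EFinD.
rewrite ge0_integralD//; last first.
- by move=> x _; rewrite lee_fin ltW.
- by apply/measurable_EFinP; exact: measurable_funTS.
- by move=> x _; rewrite lee_fin sqnorm_ge0.
have B0 := B_ge0 fu.
have n0 : (0 : R) < n%:R * n.+1%:R by rewrite mulr_gt0.
have t0 : 0 <= (1 + del) ^+ 2 * B / (n%:R * n.+1%:R).
  by apply: divr_ge0; [apply: mulr_ge0; [exact: sqr_ge0|]|exact: ltW].
rewrite integral_cst// /bnd EFinD ge0_muleDr ?lee_fin ?(ltW h0)//.
apply: leeD; last by rewrite muleC.
rewrite [leRHS]muleC.
apply: le_trans (simplexo_second_moment (sbmx_unit s0 fu)) _.
rewrite lee_wpmul2r// lee_fin ler_pM2r ?invr_gt0//.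
have rE i : row i ((1 + del) *: bmx w f) = (1 + del) *: w (f i).
  by apply/rowP => j; rewrite !mxE.
under [X in sqnorm X]eq_bigr do rewrite rE.
under [X in _ + X]eq_bigr do rewrite rE sqnormZ.
by rewrite -scaler_sumr sqnormZ -mulr_sumr -mulrDr ler_wpM2l ?sqr_ge0 ?wB.
Qed.

(** The inflated simplices cover the hull up to a null set, while the original ones are disjoint and
    lie inside it. Comparing them one by one costs the factor [(1 + del) ^ n] in volume. *)
Lemma hull_second_moment_generic f0 : bmx w f0 \in unitmx ->
  (leb_outer (subgraph hull (@sqnorm R n)) <=
   ((1 + del) ^+ n * bnd)%:E * leb_outer hull)%E.
Proof.
move=> f0u; have s0 : 0 < 1 + del by rewrite addr_gt0.
pose U s : set T := \big[setU/set0]_(f <- index_enum {ffun 'I_n -> I}) F s f.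
have UE s : U s = \bigcup_f F s f.
  by rewrite /U -bigcup_seq; apply: eq_bigcupl; split => // f _ /=; rewrite mem_index_enum.
have mU s : 0 < s -> measurable (U s).
  by move=> s1; apply: bigsetU_measurable => f _; exact: F_measurable.
have tF s : 0 < s -> trivIset [set` index_enum {ffun 'I_n -> I}] (F s).
  by move=> s1; apply: sub_trivIset (F_trivIset s1).
have uniqI : uniq (index_enum {ffun 'I_n -> I}) by exact: index_enum_uniq.
pose K' : set T := degenerate `|` U (1 + del).
have mK' : measurable K' by apply: measurableU => //; exact: mU.
apply: le_trans (_ : _ <= leb_outer (subgraph K' (@sqnorm R n)))%E _.
  apply: le_leb_outer => z [Kz zz]; split => //.
  by rewrite /K' UE; exact: (hull_cover f0u).
apply: le_trans (leb_outer_subgraph mK' msq (@sqnorm_ge0 R n) h0) _.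
have sqh0 (x : T) : (0 <= (sqnorm (x : V) + h)%:E)%E.
  by rewrite lee_fin addr_ge0 ?sqnorm_ge0// ltW.
have -> : K' = degenerate `|` (U (1 + del) `\` degenerate).
  apply/seteqP; split => x [dx|]; [by left| |by left|by case=> ? _; right].
  by move=> Ux; have [dx|ndx] := pselect (degenerate x); [left|right].
rewrite ge0_integral_setU//; last first.
- apply/disj_setPS => x [dx [_ ndx]]; exact: ndx.
- by apply: measurableD => //; exact: mU.
rewrite (null_set_integral degenerate_measurable (@msqh degenerate) leb_degenerate) add0e.
apply: (@le_trans _ _ (\int[mu]_(x in U (1 + del)%R) (sqnorm (x : V) + h)%:E)%E).
  apply: ge0_subset_integral => //; first by apply: measurableD => //; exact: mU.
  exact: mU.
rewrite ge0_integral_bigsetU//; last first.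
- exact: tF.
- by move=> f; exact: F_measurable.
apply: (@le_trans _ _ (((1 + del) ^+ n * bnd)%:E * \sum_f mu (F 1 f))%E).
  rewrite ge0_sume_distrr//; apply: lee_sum => f _; exact: integral_F.
have bnd0 : 0 <= (1 + del) ^+ n * bnd.
  have B0 := B_ge0 f0u.
  rewrite mulr_ge0 ?exprn_ge0 ?(ltW s0)// /bnd addr_ge0 ?(ltW h0)//.
  by apply: divr_ge0; [apply: mulr_ge0; [exact: sqr_ge0|]|exact: mulr_ge0].
rewrite lee_wpmul2l ?lee_fin//.
have -> : \sum_f mu (F 1 f) = mu (U 1).
  have := @ge0_integral_bigsetU _ _ _ mu _ (F 1) (cst 1%E) (index_enum {ffun 'I_n -> I})
    (fun f => F_measurable f ltr01) uniqI (tF 1 ltr01).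
  move=> /(_ (measurable_cst _) (fun _ _ => lee01)).
  rewrite integral_cst; [rewrite mul1e => ->|exact: mU].
  by apply: eq_bigr => f _; rewrite integral_cst ?mul1e//; exact: F_measurable.
by apply: le_leb_outer => x; rewrite UE => -[f _ /F_sub_hull].
Qed.

End hull.

(** * Symmetric hulls: isotropic constant from signed sums and a parallelepiped *)

Section sym_hull.
Context {R : realType}.

(** Each sign is chosen so that the cross term with the partial sum is nonnegative. Hence the sum of
    the squared lengths of the vertices also reduces to signed sums. *)
Lemma exists_signs m k (x : 'I_k -> 'rV[R]_m) : exists e : 'I_k -> bool,
  \sum_i sqnorm (x i) <= sqnorm (\sum_i (-1) ^+ e i *: x i).
Proof.
elim: k x => [|k ih] x; first by exists xpredT; rewrite big_ord0 sqnorm_ge0.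
have [e he] := ih (fun i => x (widen_ord (leqnSn k) i)).
pose s := \sum_(i < k) (-1) ^+ e i *: x (widen_ord (leqnSn k) i).
pose b := dotp s (x ord_max) < 0.
pose e' i := if unlift ord_max i is Some j then e j else b.
have Hs : \sum_(i < k) (-1) ^+ e' (widen_ord (leqnSn k) i) *: x (widen_ord (leqnSn k) i) = s.
  apply: eq_bigr => i _; have -> : widen_ord (leqnSn k) i = lift ord_max i.
    by apply: val_inj; rewrite /= /bump leqNgt ltn_ord add0n.
  by rewrite /e' liftK.
have eb : e' ord_max = b by rewrite /e' unlift_none.
exists e'; rewrite !big_ord_recr/= Hs eb sqnormD sqnormZ sqrr_sign mul1r.
rewrite -[leLHS]addr0 lerD// ?lerD// dotpZr /b; case: ltP => h.
  by rewrite expr1 mulN1r mulr_ge0// oppr_ge0 ltW.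
by rewrite expr0 mul1r mulr_ge0.
Qed.

Definition sgn3 (o : option bool) : R := if o is Some b then (-1) ^+ b else 0.

Lemma continuous_sum (T : topologicalType) (U : normedModType R) k
    (f : 'I_k -> T -> U) (u : T) :
  (forall i, continuous_at u (f i)) -> continuous_at u (fun x => \sum_i f i x).
Proof.
elim: k f => [|k ih] f fc.
  have -> : (fun x => \sum_(i < 0) f i x) = cst 0.
    by apply/funext => x; rewrite big_ord0.
  exact: cst_continuous.
have -> : (fun x => \sum_(i < k.+1) f i x) =
    (fun x => \sum_(i < k) f (widen_ord (leqnSn k) i) x) \+ f ord_max.
  by apply/funext => x; rewrite big_ord_recr.
have c1 := ih (fun i => f (widen_ord (leqnSn k) i)) (fun i => fc _).
exact: (continuousD c1 (fc ord_max)).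
Qed.

Variables (m N : nat).
Local Notation n := m.+2.
Local Notation V := 'rV[R]_n.
Variable v : 'I_N -> V.

Let w (p : 'I_N * bool) : V := (-1) ^+ p.2 *: v p.1.

Lemma sym_conv_hull_hull : (0 < N)%N -> sym_conv_hull v = hull w.
Proof.
move=> N0; have sumP (F : 'I_N * bool -> R) : \sum_p F p = \sum_i (F (i, false) + F (i, true)).
  rewrite (eq_bigr (fun p => F (p.1, p.2))) => [|[]//].
  rewrite -(pair_bigA _ (fun i b => F (i, b)))/=; apply: eq_bigr => i _.
  by rewrite big_bool addrC.
have sumV (F : 'I_N * bool -> V) : \sum_p F p = \sum_i (F (i, false) + F (i, true)).
  rewrite (eq_bigr (fun p => F (p.1, p.2))) => [|[]//].
  rewrite -(pair_bigA _ (fun i b => F (i, b)))/=; apply: eq_bigr => i _.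
  by rewrite big_bool addrC.
apply/seteqP; split => x.
  move=> [l [l' [l0 [l'0 [l1 ->]]]]]; exists (fun p => if p.2 then l' p.1 else l p.1); split.
  - by move=> [i b]; case: b => /=.
  - by rewrite sumP l1.
  - rewrite sumV; apply: eq_bigr => i _; rewrite /w/= expr0 expr1 scale1r scaleN1r scalerN.
    by rewrite scalerBl.
(* The missing mass is shared equally between [v i0] and [- v i0], where it cancels. *)
move=> [l [l0 l1 ->]]; pose s := (1 - \sum_p l p) / 2.
have s0 : 0 <= s by rewrite divr_ge0// subr_ge0.
pose i0 := Ordinal N0.
exists (fun i => l (i, false) + s *+ (i == i0)), (fun i => l (i, true) + s *+ (i == i0)).
have sumi0 : \sum_(i < N) s *+ (i == i0) = s.
  by rewrite (bigD1 i0)//= big1 ?addr0 // => i /negbTE->.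
split; first by move=> i; rewrite addr_ge0// mulrn_wge0.
split; first by move=> i; rewrite addr_ge0// mulrn_wge0.
split.
  transitivity (\sum_p l p + (s + s)).
    have -> : s + s = \sum_(i < N) (s *+ (i == i0) + s *+ (i == i0)) by rewrite big_split/= sumi0.
    rewrite sumP -big_split/=; apply: eq_bigr => i _; move: (s *+ _) => z; ring.
  by rewrite /s; field.
rewrite sumV; apply: eq_bigr => i _; rewrite /w/= expr0 expr1 scale1r scaleN1r scalerN.
by rewrite -scalerBl; congr (_ *: _); ring.
Qed.

Variable M : R.
Hypothesis vM : forall s : {ffun 'I_N -> option bool}, (#|[pred i | s i]| <= n)%N ->
  sqnorm (\sum_i sgn3 (s i) *: v i) <= M.

(** A basis cannot contain both [v i] and [- v i]; so a signed sum over a basis is a signed sum of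
    distinct [v i], to which [vM] applies. *)
Let basis_fst_inj f : bmx w f \in unitmx -> injective (fun k => (f k).1).
Proof.
move=> fu k k' e; apply/eqP/negPn/negP => kk'.
have : w (f k) = (-1) ^+ ((f k).2 (+) (f k').2) *: w (f k').
  by rewrite /w/= e scalerA -signr_addb -addbA addbb addbF.
move=> /(congr1 (fun x => bcoord w f x 0 k)); rewrite bcoord_row// eqxx.
rewrite /bcoord -scalemxAl mxE -/(bcoord w f _) bcoord_row// (negbTE kk') mulr0.
by move=> /eqP; rewrite oner_eq0.
Qed.

Let signed_sum_le f (e : 'I_n -> bool) : bmx w f \in unitmx ->
  sqnorm (\sum_k (-1) ^+ e k *: w (f k)) <= M.
Proof.
move=> fu; have fi := basis_fst_inj fu.
pose s : {ffun 'I_N -> option bool} :=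
  [ffun i => omap (fun k => e k (+) (f k).2) [pick k | (f k).1 == i]].
have -> : \sum_k (-1) ^+ e k *: w (f k) = \sum_i sgn3 (s i) *: v i.
  rewrite (partition_big (fun k => (f k).1) xpredT)//=; apply: eq_bigr => i _.
  rewrite ffunE; case: pickP => [k /= ki|noi]; last first.
    by rewrite big_pred0 ?scale0r// => k; rewrite noi.
  rewrite (bigD1 k)//= big1 ?addr0 => [|k' /andP[/eqP k'i k'k]]; last first.
    by move: k'k; rewrite -(inj_eq fi) k'i (eqP ki) eqxx.
  by rewrite /w scalerA -signr_addb (eqP ki).
apply: vM; apply: leq_trans (_ : #|[seq (f k).1 | k in 'I_n]| <= _)%N; last first.
  by apply: leq_trans (card_size _) _; rewrite size_image card_ord.
apply: subset_leq_card; apply/fintype.subsetP => i; rewrite !inE ffunE.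
by case: pickP => //= k /eqP <- _; apply: map_f; rewrite mem_enum.
Qed.

Let basis_sqnorm f : bmx w f \in unitmx ->
  sqnorm (\sum_k w (f k)) + \sum_k sqnorm (w (f k)) <= 2 * M.
Proof.
move=> fu; have := signed_sum_le (fun=> false) fu.
under eq_bigr do rewrite expr0 scale1r.
have [e he] := exists_signs (fun k => w (f k)).
by have := signed_sum_le e fu; lra.
Qed.

Variables (A : 'M[R]_n) (h rho : R).
Hypothesis h0 : 0 < h.
Hypothesis rho0 : 0 < rho.
Hypothesis KA : forall x : V, (forall j, `|x 0 j| <= 1) -> sym_conv_hull v (x *m A).
Hypothesis detA : rho ^+ n <= `|\det A|.

Let K := sym_conv_hull v.

Let Au : A \in unitmx.
Proof.
by rewrite unitmxE unitfE -normr_gt0 (lt_le_trans _ detA)// exprn_gt0.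
Qed.

Let N0 : (0 < N)%N.
Proof.
have [|l [l' [_ [_ [l1 _]]]]] := KA (x := 0); first by move=> j; rewrite mxE normr0.
rewrite lt0n; apply/eqP => N0; move: l1; rewrite big1 => [/eqP|i _].
  by rewrite eq_sym oner_eq0.
by have := ltn_ord i; rewrite {2}N0.
Qed.

Let exists_basis : exists f0, bmx w f0 \in unitmx.
Proof.
pose W : 'M[R]_(#|{: 'I_N * bool}|, n) := \matrix_i w (enum_val i).
have Wfull : row_full W.
  rewrite -sub1mx -(mulVmx Au); apply: submx_trans (submxMl _ _) _.
  apply/row_subP => i; have : K (delta_mx 0 i *m A).
    apply: KA => j; rewrite !mxE eqxx/=; case: (j == i); rewrite ?normr1 ?normr0//.
  rewrite /K sym_conv_hull_hull// -rowE => -[l [_ _ ->]].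
  apply: summx_sub => p _; apply: scalemx_sub.
  have -> : w p = row (enum_rank p) W by rewrite rowK enum_rankK.
  exact: row_sub.
exists [ffun k => enum_val (fullrankfun Wfull k)].
have := fullrowsub_unit Wfull; congr (_ \in unitmx).
apply/row_matrixP => i; rewrite row_rowsub /W /bmx !rowK; congr w; rewrite [RHS]ffunE.
idtac.
set Z := enum_val _; reflexivity.
Qed.

(** The hull contains the image under [A] of [[-1, 1]^n]; the factor [2 ^ n] is dropped. *)
Lemma leb_outer_sym_hull_ge : ((rho ^+ n)%:E <= leb_outer K)%E.
Proof.
have : [set x *m A | x in box (const_mx (-1) : V) (const_mx 1)] `<=` K.
  by move=> _ [x xb <-]; apply: KA => j; rewrite ler_norml; have := xb j; rewrite !mxE.
move=> /le_leb_outer; apply: le_trans.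
rewrite leb_outer_lin// leb_outer_box => [|j]; last by rewrite !mxE; lra.
rewrite -EFinM lee_fin (le_trans detA)// ler_peMr//.
rewrite /box_vol; under eq_bigr do rewrite !mxE.
by rewrite prodr_const card_ord exprn_ege1// le_max; apply/orP; right; lra.
Qed.

Let leb_outer_hull_fin : (leb_outer K < +oo)%E.
Proof.
pose b : V := \row_j \sum_i `|v i 0 j|.
have : K `<=` box (- b) b.
  rewrite /K sym_conv_hull_hull// => _ [l [l0 l1 ->]] j.
  rewrite !mxE -ler_norml summxE.
  apply: le_trans (ler_norm_sum _ _ _) _.
  have lle p : l p <= 1.
    by apply: le_trans l1; rewrite (bigD1 p)//= lerDl sumr_ge0.
  apply: (@le_trans _ _ (\sum_p l p * `|v p.1 0 j|)).
    apply: ler_sum => p _; rewrite !mxE !normrM normr_sign mul1r ger0_norm//.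
  rewrite [leRHS](_ : _ = \sum_p l p * (\sum_i `|v i 0 j|) + (1 - \sum_p l p) * (\sum_i `|v i 0 j|)); last first.
    by rewrite -mulr_suml; ring.
  rewrite -[leLHS]addr0 lerD//; last by rewrite mulr_ge0 ?subr_ge0// sumr_ge0.
  by apply: ler_sum => p _; rewrite ler_wpM2l// (bigD1 p.1)//= lerDl sumr_ge0.
move=> /le_leb_outer/le_lt_trans; apply.
by apply: le_lt_trans (leb_outer_box_le _ _) _; rewrite ltry.
Qed.

Lemma sym_hull_second_moment :
  integral_nonneg K (@sqnorm R n) <= expR 1 * (8 * M / n%:R ^+ 2 + h) * vol K.
Proof.
have [f0 f0u] := exists_basis.
(* The choice [del = 1 / n] keeps [(1 + del) ^ n] below [e]; [(1 + del) ^ 2 <= 4] turns the vertex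
   bound [2 M] into [8 M]. *)
have n1 : (0 : R) < n%:R^-1 by rewrite invr_gt0.
have n2 : 0 < (n%:R^-1 : R) <= 1 by apply/andP; split => //; rewrite invf_le1 ?ltr0n// ler1n.
have [c [c1 c2]] := generic_costs w n2.
have M0 : 0 <= M.
  have := vM (s := [ffun=> None]); move=> /(_ _)/le_trans h'; apply: le_trans (sqnorm_ge0 _) (h' _ _ (lexx _)).
  by rewrite eq_card0// => i; rewrite inE ffunE.
have := hull_second_moment_generic n1 c1 c2 h0 basis_sqnorm f0u.
rewrite -sym_conv_hull_hull// -/K.
have -> : leb_outer K = (vol K)%:E.
  by rewrite /vol fineK// ge0_fin_numE ?leb_outer_ge0.
rewrite -EFinM => H; rewrite /integral_nonneg.
have fin : leb_outer (subgraph K (sqnorm (m:=n))) \is a fin_num.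
  by rewrite ge0_fin_numE ?leb_outer_ge0// (le_lt_trans H)// ltry.
rewrite -lee_fin fineK//; apply: le_trans H _; rewrite lee_fin ler_wpM2r//.
  by rewrite /vol fine_ge0// leb_outer_ge0.
have e1 : (1 + n%:R^-1) ^+ n <= expR (1 : R).
  rewrite -[X in expR X](@mulfV R n%:R)// mulrC -[X in _ * X]mulr1 mulr1 expRM_natr.
  by rewrite lerXn2r ?nnegrE ?addr_ge0 ?expR_ge0 ?expR_ge1Dx// ltW.
apply: ler_pM => //.
- by rewrite addr_ge0 ?(ltW h0)// divr_ge0 ?mulr_ge0 ?sqr_ge0.
rewrite lerD2r; have nn : (0 : R) < n%:R by [].
have : (1 + n%:R^-1) ^+ 2 <= (4 : R).
  have -> : 4 = 2 ^+ 2 :> R by ring.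
  have h1 : 1 + n%:R^-1 <= (2 : R) by case/andP: n2 => _; move: (n%:R^-1) => z; lra.
  by rewrite lerXn2r ?nnegrE// addr_ge0// ltW.
move=> h4; apply: (@le_trans _ _ (4 * (2 * M) / n%:R ^+ 2)).
  apply: ler_pM; rewrite ?mulr_ge0 ?sqr_ge0 ?invr_ge0//.
  - by rewrite ler_wpM2r// mulr_ge0.
  - by rewrite lef_pV2 ?posrE ?mulr_gt0 ?exprn_gt0// expr2 ler_pM2l// ler_nat.
by rewrite le_eqVlt; apply/orP; left; apply/eqP; ring.
Qed.

Lemma isotropic_constant_sym_hull :
  isotropic_constant K <=
    Num.sqrt (expR 1 * (8 * M / n%:R ^+ 2 + h) / (rho ^+ 2 * n%:R)).
Proof.
have nn : (0 : R) < n%:R by [].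
have volge : rho ^+ n <= vol K.
  by rewrite -lee_fin /vol fineK ?ge0_fin_numE ?leb_outer_ge0 ?leb_outer_hull_fin ?leb_outer_sym_hull_ge.
have vol0 : 0 < vol K by rewrite (lt_le_trans _ volge)// exprn_gt0.
rewrite /isotropic_constant; apply: ler_wsqrtr; rewrite (invfM (rho ^+ 2)) (mulrA (_ * _)); apply: ler_wpM2r; first by rewrite invr_ge0.
set C := expR 1 * _.
apply: (@le_trans _ _ (integral_nonneg K (@sqnorm R n) / (vol K `^ (1 + 2 / n%:R)))).
  apply: ge_inf.
    exists 0 => _ [T [_ ->]]; rewrite divr_ge0 ?powR_ge0//.
    by rewrite /integral_nonneg fine_ge0// leb_outer_ge0.
  exists id; split => //; exists 1%:M, 0; rewrite det1 normr1; split => // x.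
  by rewrite mulmx1 addr0.
rewrite ler_pdivrMr ?powR_gt0//; apply: le_trans sym_hull_second_moment _; rewrite -/C.
have C0 : 0 <= C.
  rewrite mulr_ge0 ?expR_ge0// addr_ge0 ?(ltW h0)// divr_ge0 ?mulr_ge0 ?sqr_ge0//.
  have := vM (s := [ffun=> None]); move=> /(_ _)/le_trans h'; apply: le_trans (sqnorm_ge0 _) (h' _ _ (lexx _)).
  by rewrite eq_card0// => i; rewrite inE ffunE.
rewrite -(mulrA C); apply: ler_wpM2l => //; rewrite powRD; last by rewrite gt_eqF ?implybT// ltW.
rewrite (powRr1 (ltW vol0)) mulrCA; apply: ler_peMr; first exact: ltW.
rewrite ler_pdivlMl ?exprn_gt0// mulr1.
have -> : rho ^+ 2 = (rho ^+ n) `^ (2 / n%:R).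
  rewrite -[rho ^+ n]powR_mulrn ?ltW// -powRrM mulrCA mulfV ?gt_eqF// mulr1 powR_mulrn ?ltW//.
apply: ge0_ler_powR; rewrite ?nnegrE ?volge ?(ltW vol0) ?exprn_ge0 ?(ltW rho0)//.
Qed.

(** Compactness: the hull is the continuous image of a closed part of a cube of coefficients.
    Interior: the inverse of [A] sends a neighbourhood of 0 into the unit cube. *)
Lemma sym_hull_convex_body : convex_body K.
Proof.
split; last split.
- rewrite /K sym_conv_hull_hull//.
  pose D := [set u : 'rV[R]_#|{: 'I_N * bool}| |
    (forall i, `[0, 1]%classic (u ord0 i)) /\ \sum_i u 0 i <= 1].
  pose g (u : 'rV[R]_#|{: 'I_N * bool}|) : V := \sum_i u 0 i *: w (enum_val i).
  have bev (U : nmodType) (F : 'I_N * bool -> U) :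
      \sum_p F p = \sum_(i < #|{: 'I_N * bool}|) F (enum_val i).
    by rewrite -big_enum_val; apply: eq_bigl => p; rewrite inE.
  have -> : hull w = g @` D.
    apply/seteqP; split => [_ [l [l0 l1 ->]]|_ [u [u01 u1] <-]].
      have lle p : l p <= 1 by apply: le_trans l1; rewrite (bigD1 p)//= lerDl sumr_ge0.
      exists (\row_i l (enum_val i)).
        split => [i|]; first by rewrite /= in_itv/= mxE l0 lle.
        under eq_bigr do rewrite mxE.
        by rewrite -(bev _ l).
      rewrite /g; under eq_bigr do rewrite mxE.
      by rewrite -(bev _ (fun p => l p *: w p)).
    exists (fun p => u 0 (enum_rank p)); split.
    - by move=> p; have := u01 (enum_rank p); rewrite /= in_itv/= => /andP[].
    - rewrite (bev _ (fun p => u 0 (enum_rank p))).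
      by under eq_bigr do rewrite enum_valK.
    - rewrite (bev _ (fun p => u 0 (enum_rank p) *: w p)) /g.
      by apply: eq_bigr => i _; rewrite enum_valK.
  apply: continuous_compact.
    apply: continuous_subspaceT => u.
    apply: (@continuous_sum _ _ _ (fun i (u : 'rV[R]_#|{: 'I_N * bool}|) => u 0 i *: w (enum_val i))) => i.
    by apply: continuousZr_tmp; exact: coord_continuous.
  pose cube := [set u : 'rV[R]_#|{: 'I_N * bool}| | forall i, `[0, 1]%classic (u ord0 i)].
  have cc : compact cube by apply: (@rV_compact R _ (fun=> `[0, 1]%classic)) => i; exact: segment_compact.
  apply: (subclosed_compact _ cc); last by move=> u [].
  have -> : D = cube `&` [set u | \sum_i u 0 i <= 1] by apply/seteqP; split.
  apply: closedI; first exact: compact_closed (@norm_hausdorff _ _) cc.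
  apply: (@preimage_closed _ _ (fun u : 'rV[R]_#|{: 'I_N * bool}| => \sum_i u 0 i) [set x | x <= 1]); last exact: closed_le.
  move=> u _.
  apply: (@continuous_sum _ R^o _ (fun i (u : 'rV[R]_#|{: 'I_N * bool}|) => u 0 i)) => i.
  exact: coord_continuous.
- move=> x y t; rewrite /K sym_conv_hull_hull// => -[l [l0 l1 ->]] [l' [l'0 l'1 ->]] /andP[t0 t1].
  have t2 : 0 <= 1 - t by rewrite subr_ge0.
  exists (fun p => t * l p + (1 - t) * l' p); split.
  - by move=> p; rewrite addr_ge0// mulr_ge0.
  - rewrite big_split/= -!mulr_sumr; nra.
  - rewrite !scaler_sumr -big_split/=; apply: eq_bigr => p _.
    by rewrite (scalerA t) (scalerA (1 - t)) -scalerDl.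
- exists 0.
  have H : \forall x \near (0 : V), forall j, `|(x *m invmx A) 0 j| < 1.
    apply: (@filter_forall _ _ (fun j (x : V) => `|(x *m invmx A) 0 j| < 1) _ (nbhs_filter (0 : V))) => j.
    have c : {for (0 : V), continuous (fun x : V => `|(x *m invmx A) 0 j|)}.
      apply: continuous_comp; last exact: norm_continuous.
      have -> : (fun x : V => (x *m invmx A) 0 j) =
          (fun x => \sum_i x 0 i *: (invmx A i j : R^o)).
        by apply/funext => x; rewrite mxE.
      apply: (@continuous_sum _ R^o _ (fun i (x : V) => x 0 i *: (invmx A i j : R^o))) => i.
      by apply: continuousZr_tmp; exact: coord_continuous.
    apply: (cvgr_lt _ c); by rewrite mul0mx mxE normr0.
  rewrite /interior/=; apply: filterS H => x xA.
  rewrite -(mulmxKV Au x); apply: KA => j; exact/ltW/xA.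
Qed.

End sym_hull.

(** * Independence and decoupling *)

Section independence.
Context {R : realType} {d : measure_display} {Omega : measurableType d}.
Variable P : probability Omega R.
Variables (I : finType) (X : I -> Omega -> R).
Hypothesis indX : mutually_independent P X.
Implicit Types J : {set I}.

Definition cyl (J : {set I}) : set (set Omega) :=
  [set A | exists2 B : I -> set R, (forall i, measurable (B i)) &
    A = \bigcap_(i in [set i | i \in J]) (X i @^-1` B i)].

(** [Omega] with the sigma-algebra generated by the variables of index in [J]. The carrier stays
    [Omega], so functions need no factorisation through coordinates. *)
Definition coords (J : {set I}) := g_sigma_algebraType (cyl J).

Definition adapted (J : {set I}) (f : Omega -> R) :=
  measurable_fun (setT : set (coords J)) (f : coords J -> R).

Let mX i : measurable_fun setT (X i). Proof. by case: indX. Qed.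

Let cyl_measurable J : cyl J `<=` measurable.
Proof.
move=> _ [B mB ->]; apply: fin_bigcap_measurable => // i _.
by rewrite -[X in measurable X]setTI; exact: mX.
Qed.

Let cylT J : cyl J setT.
Proof. by exists (fun=> setT) => //; apply/seteqP; split. Qed.

Let cylI J : setI_closed (cyl J).
Proof.
move=> _ _ [B mB ->] [B' mB' ->]; exists (fun i => B i `&` B' i).
  by move=> i; exact: measurableI.
by rewrite -bigcapI; apply: eq_bigcapr => i _; rewrite preimage_setI.
Qed.

Lemma coords_measurable J : (measurable : set (set (coords J))) `<=` (measurable : set (set Omega)).
Proof. by apply: smallest_sub; [exact: sigma_algebra_measurable|exact: cyl_measurable]. Qed.

Lemma coords_sub J J' : J \subset J' ->
  (measurable : set (set (coords J))) `<=` (measurable : set (set (coords J'))).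
Proof.
move=> JJ'; apply: smallest_sub; first exact: sigma_algebra_measurable.
move=> _ [B mB ->]; apply: sub_sigma_algebra.
exists (fun i => if i \in J then B i else setT) => [i|]; first by case: ifP.
apply/seteqP; split => w h i /= iJ.
  by case: ifP => // iJ2; exact: h.
by have := h i (fintype.subsetP JJ' _ iJ); rewrite iJ.
Qed.

Lemma adapted_sub J J' f : J \subset J' -> adapted J f -> adapted J' f.
Proof. by move=> JJ' fJ _ B mB; apply: (coords_sub JJ'); exact: fJ. Qed.

Lemma adapted_measurable J f : adapted J f -> measurable_fun setT f.
Proof. by move=> fJ _ B mB; apply: (@coords_measurable J); exact: fJ. Qed.

Lemma adapted_coord J i : i \in J -> adapted J (X i).
Proof.
move=> iJ _ B mB; rewrite setTI; apply: sub_sigma_algebra.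
exists (fun k => if k == i then B else setT) => [k|]; first by case: ifP.
apply/seteqP; split => w /= h.
  by move=> k /= kJ; case: eqP => // ->.
by have := h i iJ; rewrite /= eqxx.
Qed.

(** [A |-> P (A & B)] and [A |-> P A P B] are finite measures that agree on a class closed under
    intersection, hence on the sigma-algebra it generates. *)
Lemma indep_generated (G : set (set Omega)) (B : set Omega) : G `<=` measurable ->
    setI_closed G -> G setT -> measurable B ->
    (forall A, G A -> P (A `&` B) = (P A * P B)%E) ->
  forall A, <<s G >> A -> P (A `&` B) = (P A * P B)%E.
Proof.
move=> Gm GI GT mB GB A sA.
have PBfin : P B \is a fin_num by exact: fin_num_measure.
have PB0 : (0 <= fine (P B))%R by rewrite fine_ge0.
have := g_sigma_algebra_measure_unique G Gm (fun=> setT) (fun=> GT) _ (mrestr P mB) (mscale (NngNum PB0) P) GI.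
have e C : mscale (NngNum PB0) P C = (P C * P B)%E by rewrite /mscale/= fineK// muleC.
move=> H; rewrite -e -H//.
- by apply/seteqP; split => // x _; exists 0%N.
- by move=> C GC; apply: etrans (GB _ GC) (esym (e C)).
- by move=> _; apply: le_lt_trans (probability_le1 _ _) (ltry _); exact: measurableI.
Qed.

Lemma indep_coords J1 J2 (A B : set Omega) : [disjoint J1 & J2]%B ->
  (measurable : set (set (coords J1))) A -> (measurable : set (set (coords J2))) B ->
  P (A `&` B) = (P A * P B)%E.
Proof.
move=> dJ mA mB; apply: (indep_generated (@cyl_measurable J1) (@cylI J1) (cylT J1)) => //.
  exact: (coords_measurable mB).
move=> {mA}{}A cA; rewrite setIC muleC.
apply: (indep_generated (@cyl_measurable J2) (@cylI J2) (cylT J2)) => //.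
  exact: (@cyl_measurable J1).
move=> _ [B2 mB2 ->]; case: cA => [B1 mB1 ->].
pose B3 i := if i \in J1 then B1 i else B2 i.
have e1 : \bigcap_(i in [set i | i \in J1]) (X i @^-1` B1 i) =
    \bigcap_(i in [set i | i \in J1]) (X i @^-1` B3 i).
  by apply: eq_bigcapr => i /= iJ; rewrite /B3 iJ.
have e2 : \bigcap_(i in [set i | i \in J2]) (X i @^-1` B2 i) =
    \bigcap_(i in [set i | i \in J2]) (X i @^-1` B3 i).
  apply: eq_bigcapr => i /= iJ; rewrite /B3 ifF//.
  by apply/negP => iJ1; move/disjointFr: dJ => /(_ _ iJ1); rewrite iJ.
have mB3 i : measurable (B3 i) by rewrite /B3; case: ifP.
have -> : \bigcap_(i in [set i | i \in J2]) (X i @^-1` B2 i) `&`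
    \bigcap_(i in [set i | i \in J1]) (X i @^-1` B1 i) =
    \bigcap_(i in [set i | i \in J1 :|: J2]) (X i @^-1` B3 i).
  rewrite e1 e2; apply/seteqP; split => w.
    by move=> [h2 h1] i /=; rewrite !inE => /orP[] ?; [exact: h1|exact: h2].
  by move=> h; split => i /= iJ; apply: h; rewrite /= !inE iJ ?orbT.
rewrite e1 e2 !(indX.2 _ B3)// -EFinM; congr EFin.
rewrite mulrC -(@bigU _ _ _ _ _ _ _ dJ); apply: eq_bigl => i.
by rewrite !inE.
Qed.


(** By independence the diagonal map into [coords J1 * coords J2] has the product law, and Tonelli
    applies. This replaces conditional expectation: the first argument may be frozen while the
    second is integrated. *)
Lemma integral_decoupled J1 J2 (f : coords J1 * coords J2 -> \bar R) :
    [disjoint J1 & J2]%B -> measurable_fun setT f -> (forall z, (0 <= f z)%E) ->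
  (\int[P]_w f (w, w) = \int[P]_w \int[P]_w' f (w, w'))%E.
Proof.
move=> dJ mf f0.
have mid J : measurable_fun setT (id : Omega -> coords J).
  by move=> _ B mB; rewrite setTI; exact: (coords_measurable mB).
pose id_ J : {mfun Omega >-> coords J} :=
  HB.pack (id : Omega -> coords J) (isMeasurableFun.Build _ _ _ _ _ (mid J)).
have mdiag : measurable_fun setT ((fun w => (w, w)) : Omega -> coords J1 * coords J2).
  by apply: measurable_fun_pair; exact: mid.
pose diag : {mfun Omega >-> (coords J1 * coords J2)%type} :=
  HB.pack ((fun w => (w, w)) : Omega -> coords J1 * coords J2)
    (isMeasurableFun.Build _ _ _ _ _ mdiag).
pose m1 := distribution P (id_ J1); pose m2 := distribution P (id_ J2).
transitivity (\int[distribution P diag]_z f z)%E.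
  by rewrite ge0_integral_distribution.
transitivity (\int[(m1 \x m2)%E]_z f z)%E.
  apply: eq_measure_integral => A mA _; apply/esym.
  apply: product_measure_unique => // B C mB mC.
  exact: (indep_coords dJ mB mC).
rewrite fubini_tonelli1//.
rewrite (ge0_integral_distribution (id_ J1)).
- apply: eq_integral => w _; rewrite /fubini_F /=.
  rewrite (ge0_integral_distribution (id_ J2))//.
  by apply: measurableT_comp => //; exact: measurable_pair1.
- exact: measurable_fun_fubini_tonelli_F.
- by move=> w; exact: integral_ge0.
Qed.


Lemma measurable_decoupled J1 J2 (f : coords J1 * coords J2 -> \bar R) :
    measurable_fun setT f -> (forall z, (0 <= f z)%E) ->
  measurable_fun [set: Omega] (fun w : Omega => (\int[P]_w' f (w, w'))%E).
Proof.
move=> mf f0.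
have mid J : measurable_fun setT (id : Omega -> coords J).
  by move=> _ B mB; rewrite setTI; exact: (coords_measurable mB).
pose id2 : {mfun Omega >-> coords J2} :=
  HB.pack (id : Omega -> coords J2) (isMeasurableFun.Build _ _ _ _ _ (mid J2)).
have mF : measurable_fun setT (fubini_F (distribution P id2) f).
  exact: measurable_fun_fubini_tonelli_F.
have FE : fubini_F (distribution P id2) f =
    (fun w : coords J1 => (\int[P]_w' f (w, w'))%E).
  apply/funext => w; rewrite /fubini_F (ge0_integral_distribution id2)//.
  by apply: measurableT_comp => //; exact: measurable_pair1.
by move: mF; rewrite FE => mF _ B mB; apply: (@coords_measurable J1); exact: mF.
Qed.

Let ge0_indep_integral J1 J2 (u v : Omega -> R) : [disjoint J1 & J2]%B ->
    adapted J1 u -> adapted J2 v -> (forall w, 0 <= u w) -> (forall w, 0 <= v w) ->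
  (\int[P]_w (u w * v w)%:E = \int[P]_w (u w)%:E * \int[P]_w (v w)%:E)%E.
Proof.
move=> dJ mu mv u0 v0.
rewrite (@integral_decoupled J1 J2 (fun z => (u z.1 * v z.2)%:E) dJ).
- transitivity (\int[P]_w ((u w)%:E * \int[P]_w' (v w')%:E))%E.
    apply: eq_integral => w _; rewrite -ge0_integralZl ?lee_fin//.
      exact/measurable_EFinP/(adapted_measurable mv).
    by move=> ? _; rewrite lee_fin.
  rewrite ge0_integralZr ?integral_ge0//.
  - exact/measurable_EFinP/(adapted_measurable mu).
  - by move=> ? _; rewrite lee_fin.
  - by move=> ? _; rewrite lee_fin.
- apply/measurable_EFinP; apply: measurable_funM.
  + exact: (measurableT_comp mu).
  + exact: (measurableT_comp mv).
- by move=> z; rewrite lee_fin mulr_ge0.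
Qed.

Lemma indep_integrable J1 J2 (u v : Omega -> R) : [disjoint J1 & J2]%B ->
    adapted J1 u -> adapted J2 v ->
    P.-integrable setT (EFin \o u) -> P.-integrable setT (EFin \o v) ->
  P.-integrable setT (EFin \o (u \* v)).
Proof.
move=> dJ mu mv iu iv; apply/integrableP; split.
  apply/measurable_EFinP/measurable_funM; first exact: adapted_measurable mu.
  exact: adapted_measurable mv.
under eq_integral do rewrite /= normrM.
rewrite (ge0_indep_integral dJ)//; last 2 first.
- exact: measurableT_comp mu.
- exact: measurableT_comp mv.
have /integrableP[_ iu'] := iu; have /integrableP[_ iv'] := iv.
by apply: lte_mul_pinfty; rewrite ?integral_ge0// ge0_fin_numE ?integral_ge0.
Qed.

Lemma indep_Rintegral J1 J2 (u v : Omega -> R) : [disjoint J1 & J2]%B ->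
    adapted J1 u -> adapted J2 v ->
    P.-integrable setT (EFin \o u) -> P.-integrable setT (EFin \o v) ->
  \int[P]_w (u w * v w) = (\int[P]_w u w) * \int[P]_w v w.
Proof.
move=> dJ mu mv iu iv.
have ipos (f : Omega -> R) : P.-integrable setT (EFin \o f) ->
    P.-integrable setT (EFin \o f^\+)%R.
  by move=> fi; rewrite -funerpos; exact: integrable_funepos.
have ineg (f : Omega -> R) : P.-integrable setT (EFin \o f) ->
    P.-integrable setT (EFin \o f^\-)%R.
  by move=> fi; rewrite -funerneg; exact: integrable_funeneg.
have apos J (f : Omega -> R) : adapted J f -> adapted J f^\+%R.
  by move=> fJ; exact: measurable_funrpos.
have aneg J (f : Omega -> R) : adapted J f -> adapted J f^\-%R.
  by move=> fJ; exact: measurable_funrneg.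
have prodE (f g : Omega -> R) : (forall w, 0 <= f w) -> (forall w, 0 <= g w) ->
    adapted J1 f -> adapted J2 g -> P.-integrable setT (EFin \o f) ->
    P.-integrable setT (EFin \o g) ->
    \int[P]_w (f w * g w) = (\int[P]_w f w) * \int[P]_w g w.
  move=> f0 g0 fa ga fi gi; rewrite /Rintegral (ge0_indep_integral dJ fa ga)//.
  by rewrite fineM//; exact: integrable_fin_num.
have decomp (f : Omega -> R) : f = (fun w => f^\+%R w - f^\-%R w).
  by apply/funext => w; rewrite -{1}(funrposBneg f).
have Edecomp f : P.-integrable setT (EFin \o f) ->
    \int[P]_w f w = (\int[P]_w f^\+%R w) - \int[P]_w f^\-%R w.
  by move=> fi; rewrite {1}(decomp f) RintegralB//; [exact: ipos|exact: ineg].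
rewrite (Edecomp u iu) (Edecomp v iv) mulrBl !mulrBr.
rewrite -!prodE//; try by [exact: ipos|exact: ineg|exact: apos|exact: aneg].
have ii (f g : Omega -> R) : adapted J1 f -> adapted J2 g ->
    P.-integrable setT (EFin \o f) -> P.-integrable setT (EFin \o g) ->
    P.-integrable setT (EFin \o (f \* g)) by exact: indep_integrable.
have i1 := ii _ _ (apos _ _ mu) (apos _ _ mv) (ipos _ iu) (ipos _ iv).
have i2 := ii _ _ (apos _ _ mu) (aneg _ _ mv) (ipos _ iu) (ineg _ iv).
have i3 := ii _ _ (aneg _ _ mu) (apos _ _ mv) (ineg _ iu) (ipos _ iv).
have i4 := ii _ _ (aneg _ _ mu) (aneg _ _ mv) (ineg _ iu) (ineg _ iv).
have iB (f g : Omega -> R) : P.-integrable setT (EFin \o f) ->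
    P.-integrable setT (EFin \o g) -> P.-integrable setT (EFin \o (f \- g)).
  by move=> fi gi; have := integrableB measurableT fi gi.
rewrite -!RintegralB//; [|exact: iB|exact: iB].
by apply: eq_Rintegral => w _; rewrite {1}(decomp u) {1}(decomp v); ring.
Qed.


Lemma indep_prod (K : finType) (J_ : K -> {set I}) (f : K -> Omega -> R) :
    (forall k l, k != l -> [disjoint J_ k & J_ l]%B) ->
    (forall k, adapted (J_ k) (f k)) ->
    (forall k, P.-integrable setT (EFin \o f k)) ->
  P.-integrable setT (EFin \o (fun w => \prod_k f k w)) /\
  \int[P]_w (\prod_k f k w) = \prod_k \int[P]_w f k w.
Proof.
move=> dJ fJ fi.
suff H (r : seq K) : uniq r ->
  [/\ adapted (\bigcup_(k <- r) J_ k)%SET (fun w => \prod_(k <- r) f k w),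
   P.-integrable setT (EFin \o (fun w => \prod_(k <- r) f k w)) &
   \int[P]_w (\prod_(k <- r) f k w) = \prod_(k <- r) \int[P]_w f k w].
  by have [] := H (index_enum K) (index_enum_uniq K).
elim: r => [_|k r ih /= /andP[kr ur]].
  have -> : (fun w : Omega => \prod_(k <- [::]) f k w) = cst 1.
    by apply/funext => w; rewrite big_nil.
  split.
  - exact: measurable_cst.
  - by apply: finite_measure_integrable_cst.
  - rewrite big_nil Rintegral_cst// mul1r.
    by have /= -> := @probability_setT _ _ _ P.
have [a i e] := ih ur.
have -> : (fun w : Omega => \prod_(k <- k :: r) f k w) =
    f k \* (fun w => \prod_(k <- r) f k w).
  by apply/funext => w; rewrite big_cons.
have dk : [disjoint J_ k & (\bigcup_(k <- r) J_ k)%SET]%B.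
  rewrite (big_uniq _ ur)/=; apply: bigcup_disjoint => l lr; apply: dJ.
  by apply: contraNneq kr => ->.
split.
- apply: measurable_funM.
  + apply: adapted_sub (fJ k); by rewrite big_cons finset.subsetUl.
  + apply: adapted_sub a; by rewrite big_cons finset.subsetUr.
- exact: indep_integrable dk (fJ k) a (fi k) i.
- by rewrite (indep_Rintegral dk (fJ k) a (fi k) i) e big_cons.
Qed.

End independence.

(** * Two exponential inequalities *)

Section expR_bounds.
Context {R : realType}.
Implicit Types u s : R.

(** Keeps the linear term exact, so that it can be replaced by the mean after integration. For
    [u >= 0] apply [exp u <= 1 + u exp u] twice; for [u = - v < 0] use [exp (- v) (1 + v) <= 1]. *)
Lemma expR_le_quadratic u : expR u <= 1 + u + u ^+ 2 * expR `|u|.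
Proof.
have [u0|u0] := leP 0 u.
  rewrite ger0_norm//; have h : expR u <= 1 + u * expR u.
    have := expR_ge1Dx (- u); rewrite -(ler_pM2r (expR_gt0 u)) -expRD addNr expR0; lra.
  have := ler_wpM2l u0 h; rewrite expr2; lra.
rewrite ltr0_norm//; set v := - u; have v0 : 0 < v by rewrite oppr_gt0.
have -> : u = - v by rewrite opprK.
clearbody v.
have e1 : expR (- v) * (1 + v) <= 1.
  by rewrite -[leRHS](expRxMexpNx_1 v) [leRHS]mulrC ler_wpM2l ?expR_ge0 ?expR_ge1Dx.
have e2 : 1 <= expR v by rewrite -expR0 ler_expR ltW.
have e3 : expR (- v) <= 1 - v + v ^+ 2.
  rewrite -(ler_pM2r (_ : 0 < 1 + v)); last by lra.
  apply: le_trans e1 _; have : 0 <= v * v ^+ 2 by rewrite mulr_ge0 ?sqr_ge0 ?ltW.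
  rewrite expr2; lra.
apply: le_trans e3 _; rewrite sqrrN lerD2l; apply: ler_peMr => //; exact: sqr_ge0.
Qed.

Lemma sqr_le_expR u : u ^+ 2 <= 4 * expR `|u|.
Proof.
have h : 0 <= 1 + `|u| / 2 <= expR (`|u| / 2).
  by rewrite expR_ge1Dx andbT addr_ge0// divr_ge0.
have : (1 + `|u| / 2) ^+ 2 <= expR `|u|.
  have -> : expR `|u| = expR (`|u| / 2) ^+ 2 by rewrite -expRM_natl; congr expR; field.
  by case/andP: h => h1 h2; rewrite lerXn2r// nnegrE expR_ge0.
rewrite -(real_normK (num_real u)); have := normr_ge0 u; nra.
Qed.

End expR_bounds.

(** * Expectations of real variables *)

Section expectation_tools.
Context {R : realType} {d : measure_display} {Omega : measurableType d}.
Variable P : probability Omega R.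
Implicit Types f g : Omega -> R.

Definition intg f := P.-integrable setT (EFin \o f).

Lemma intg_le f g : measurable_fun setT f -> (forall w, `|f w| <= g w) ->
  intg g -> intg f.
Proof.
move=> mf fg; apply: le_integrable => //; first exact/measurable_EFinP.
by move=> w _ /=; rewrite lee_fin (le_trans (fg w))// ler_norm.
Qed.

Lemma intg_cst k : intg (cst k).
Proof. exact: finite_measure_integrable_cst. Qed.

Lemma intgZ k f : intg f -> intg (fun w => k * f w).
Proof. by move=> fi; have := integrableZl measurableT k fi. Qed.

Lemma intgD f g : intg f -> intg g -> intg (fun w => f w + g w).
Proof. by move=> fi gi; have := integrableD measurableT fi gi. Qed.

Lemma intgB f g : intg f -> intg g -> intg (fun w => f w - g w).
Proof. by move=> fi gi; have := integrableB measurableT fi gi. Qed.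

Lemma intg_measurable f : intg f -> measurable_fun setT f.
Proof. by move=> /integrableP[/measurable_EFinP]. Qed.

Lemma Ex_cst k : \int[P]_w k = k :> R.
Proof. by rewrite Rintegral_cst//; have /= -> := @probability_setT _ _ _ P; rewrite mulr1. Qed.

Lemma Ex_le f g : intg f -> intg g -> (forall w, f w <= g w) ->
  \int[P]_w f w <= \int[P]_w g w.
Proof. by move=> fi gi fg; apply: le_Rintegral. Qed.

Lemma ExD f g : intg f -> intg g ->
  \int[P]_w (f w + g w) = \int[P]_w f w + \int[P]_w g w.
Proof. exact: RintegralD. Qed.

Lemma ExB f g : intg f -> intg g ->
  \int[P]_w (f w - g w) = \int[P]_w f w - \int[P]_w g w.
Proof. exact: RintegralB. Qed.

Lemma ExZ k f : intg f -> \int[P]_w (k * f w) = k * \int[P]_w f w.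
Proof. exact: RintegralZl. Qed.

Lemma intg_sum (K : finType) (f : K -> Omega -> R) : (forall k, intg (f k)) ->
  intg (fun w => \sum_k f k w).
Proof.
move=> fi; have -> : (fun w => \sum_k f k w) = \sum_k f k by apply/funext => w; rewrite fct_sumE.
elim/big_ind: _ => // [|g h gi hi]; first exact: intg_cst.
exact: intgD.
Qed.

Lemma Ex_sum (K : finType) (f : K -> Omega -> R) : (forall k, intg (f k)) ->
  \int[P]_w (\sum_k f k w) = \sum_k \int[P]_w f k w.
Proof.
move=> fi; suff H (r : seq K) : intg (fun w => \sum_(k <- r) f k w) /\
    \int[P]_w (\sum_(k <- r) f k w) = \sum_(k <- r) \int[P]_w f k w by have [] := H (index_enum K).
elim: r => [|k r [ih1 ih2]].
  rewrite big_nil; have -> : (fun w => \sum_(k <- [::]) f k w) = cst 0.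
    by apply/funext => w; rewrite big_nil.
  by split; [exact: intg_cst|exact: Ex_cst].
have -> : (fun w => \sum_(k <- k :: r) f k w) = (fun w => f k w + \sum_(k <- r) f k w).
  by apply/funext => w; rewrite big_cons.
by split; [exact: intgD|rewrite ExD// ih2 big_cons].
Qed.

Lemma ge0_markov1 f : measurable_fun setT f -> (forall w, 0 <= f w) ->
  (P [set w | 1 <= f w]%R <= \int[P]_w (f w)%:E)%E.
Proof.
move=> mf f0; have mA : measurable [set w | 1 <= f w].
  by rewrite -[X in measurable X]setTI; exact: (measurable_fun_le _ _).
rewrite -[X in (P X <= _)%E]setIT -(integral_indic P measurableT mA).
apply: ge0_le_integral => //; [exact/measurable_EFinP|exact/measurable_EFinP|].
move=> w _; rewrite lee_fin indicE; case: (boolP (w \in _)) => [|_]; last exact: f0.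
by rewrite inE.
Qed.

Lemma markov1 f : intg f -> (forall w, 0 <= f w) ->
  (P [set w | 1 <= f w]%R <= (\int[P]_w f w)%R%:E)%E.
Proof.
move=> fi f0; rewrite /Rintegral fineK ?(integrable_fin_num _ fi)//.
by apply: ge0_markov1 => //; exact: intg_measurable.
Qed.

End expectation_tools.

(** * Consequences of the moment hypotheses for one coordinate *)

Section subgaussian.
Context {R : realType} {d : measure_display} {Omega : measurableType d}.
Variable P : probability Omega R.
Variable g : Omega -> R.
Hypothesis mg : measurable_fun setT g.
Hypothesis g1 : expectation P g = 0%E.
Hypothesis g2 : expectation P (fun w => g w ^+ 2) = 1%E.
Hypothesis gexp : (expectation P (fun w => expR (g w ^+ 2 / 10)) <= 10%:E)%E.

Let psi w : R := expR (g w ^+ 2 / 10).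

Let mpsi : measurable_fun setT psi.
Proof.
apply: measurableT_comp => //; apply: measurable_funM => //.
exact: measurable_funX.
Qed.

Let psi_int : intg P psi.
Proof.
apply/integrableP; split; first exact/measurable_EFinP.
under eq_integral do rewrite /= ger0_norm ?expR_ge0//.
by move: gexp; rewrite unlock => /le_lt_trans; apply; rewrite ltry.
Qed.

Let psi10 : \int[P]_w psi w <= 10.
Proof.
by rewrite -lee_fin /Rintegral fineK ?(integrable_fin_num _ psi_int)//; move: gexp; rewrite unlock.
Qed.

(** The exponential hypothesis is applied in this form: each moment follows from a pointwise bound
    by a multiple of [psi], whose mean is at most 10. *)
Lemma psi_dominated (k : R) (f : Omega -> R) : measurable_fun setT f -> 0 <= k ->
  (forall w, `|f w| <= k * psi w) -> intg P f /\ \int[P]_w f w <= 10 * k.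
Proof.
move=> mf k0 fk; have fi : intg P f by apply: intg_le fk (intgZ k psi_int).
split => //; apply: (@le_trans _ _ (\int[P]_w (k * psi w))).
  by apply: Ex_le => // [|w]; [exact: intgZ|rewrite (le_trans _ (fk w))// ler_norm].
by rewrite ExZ// mulrC ler_wpM2r.
Qed.

Let g2_le w : g w ^+ 2 <= 20 * expR (g w ^+ 2 / 20).
Proof. have := expR_ge1Dx (g w ^+ 2 / 20); lra. Qed.

Let g_le w : `|g w| <= 20 * psi w.
Proof.
have : `|g w| <= 1 + g w ^+ 2.
  rewrite -(real_normK (num_real (g w))); have := normr_ge0 (g w); nra.
move/le_trans; apply; have := expR_ge1Dx (g w ^+ 2 / 10); rewrite /psi.
have := sqr_ge0 (g w); lra.
Qed.

Lemma subg_intg : intg P g.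
Proof. exact: (psi_dominated mg (ler0n _ 20) g_le).1. Qed.

Lemma subg_sqr_intg : intg P (fun w => g w ^+ 2).
Proof.
apply: (psi_dominated (measurable_funX _ mg) (ler0n _ 20) _).1 => w.
rewrite ger0_norm ?sqr_ge0//; have := expR_ge1Dx (g w ^+ 2 / 10); rewrite /psi.
have := sqr_ge0 (g w); lra.
Qed.

Lemma subg_mean : \int[P]_w g w = 0.
Proof. by rewrite /Rintegral; move: g1; rewrite unlock => ->. Qed.

Lemma subg_var : \int[P]_w g w ^+ 2 = 1.
Proof. by rewrite /Rintegral; move: g2; rewrite unlock => ->. Qed.

(** Squaring [g^2 <= 20 exp (g^2 / 20)] gives [g^4 <= 400 psi]. *)
Lemma subg_pow4 : intg P (fun w => g w ^+ 4) /\ \int[P]_w g w ^+ 4 <= 4000.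
Proof.
have -> : 4000 = 10 * 400 :> R by ring.
apply: psi_dominated; [exact: measurable_funX|exact: ler0n|].
move=> w; rewrite (exprM _ 2 2) ger0_norm ?sqr_ge0//.
have -> : psi w = expR (g w ^+ 2 / 20) ^+ 2.
  by rewrite /psi -expRM_natl; congr expR; field.
have -> : 400 = 20 ^+ 2 :> R by ring.
by rewrite -exprMn lerXn2r// nnegrE ?sqr_ge0// mulr_ge0 ?expR_ge0.
Qed.

(** For [|s| > 1], [s g <= 5/2 s^2 + g^2 / 10] and the factor 10 is absorbed since [s^2 >= 1]. For
    [|s| <= 1] the quadratic bound applies, the linear term has mean 0, and
    [g^2 exp |g| <= 20 e^5 psi] by [|g| <= 5 + g^2 / 20]. *)
Lemma subg_mgf s : intg P (fun w => expR (s * g w)) /\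
  \int[P]_w expR (s * g w) <= expR (200 * expR 5 * s ^+ 2).
Proof.
have ms : measurable_fun setT (fun w => expR (s * g w)).
  by apply: measurableT_comp => //; exact: measurable_funM.
have sg w : s * g w <= 5 / 2 * s ^+ 2 + g w ^+ 2 / 10.
  have := sqr_ge0 (5 * s - g w); rewrite !expr2; nra.
have dom w : `|expR (s * g w)| <= expR (5 / 2 * s ^+ 2) * psi w.
  by rewrite ger0_norm ?expR_ge0// -expRD ler_expR.
have [si sle] := psi_dominated ms (expR_ge0 _) dom.
split => //; have e5 : 1 <= expR (5 : R) by rewrite -expR0 ler_expR.
have [s1|s1] := leP `|s| 1; last first.
  apply: le_trans sle _; apply: (@le_trans _ _ (expR 9 * expR (5 / 2 * s ^+ 2))).
    by rewrite ler_wpM2r ?expR_ge0// (le_trans _ (expR_ge1Dx 9)).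
  have s2 : 1 <= s ^+ 2 by rewrite -real_normK ?num_real// -(expr1n _ 2) lerXn2r ?nnegrE// ltW.
  by rewrite -expRD ler_expR; nra.
pose q w := g w ^+ 2 * expR `|g w|.
have mq : measurable_fun setT q.
  apply: measurable_funM; first exact: measurable_funX.
  by apply: measurableT_comp => //; exact: measurableT_comp.
have qle w : `|q w| <= 20 * expR 5 * psi w.
  rewrite /q ger0_norm; last by apply: mulr_ge0; [exact: sqr_ge0|exact: expR_ge0].
  apply: (@le_trans _ _ (20 * expR (g w ^+ 2 / 20) * expR (5 + g w ^+ 2 / 20))).
    apply: ler_pM => //; rewrite ?sqr_ge0 ?expR_ge0// ler_expR.
    rewrite -(real_normK (num_real (g w))).
    have := sqr_ge0 (`|g w| - 10); rewrite !expr2; nra.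
  rewrite expRD mulrACA -mulrA -mulrA ler_wpM2l//.
  apply: ler_wpM2l; first exact: expR_ge0.
  rewrite -expRD /psi ler_expR; lra.
have [qi qi'] := psi_dominated mq (mulr_ge0 (ler0n _ 20) (expR_ge0 _)) qle.
have bound w : expR (s * g w) <= 1 + s * g w + s ^+ 2 * q w.
  apply: le_trans (expR_le_quadratic _) _; rewrite lerD2l exprMn -mulrA.
  rewrite ler_wpM2l ?sqr_ge0// ler_wpM2l ?sqr_ge0// ler_expR normrM.
  by rewrite ler_piMl.
apply: (@le_trans _ _ (1 + s ^+ 2 * (\int[P]_w q w))).
  apply: (@le_trans _ _ (\int[P]_w (1 + s * g w + s ^+ 2 * q w))).
    apply: Ex_le => //; apply: intgD; last exact: intgZ.
    by apply: intgD; [exact: intg_cst|exact: intgZ subg_intg].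
  rewrite ExD; [|by apply: intgD; [exact: intg_cst|exact: intgZ subg_intg]|exact: intgZ].
  rewrite ExD; [|exact: intg_cst|exact: intgZ subg_intg].
  by rewrite Ex_cst !ExZ ?subg_mean ?mulr0 ?addr0//; exact: subg_intg.
apply: le_trans (expR_ge1Dx _); rewrite lerD2l mulrC ler_wpM2r ?sqr_ge0//.
by apply: le_trans qi' _; rewrite mulrA; lra.
Qed.

(** [phi] is [g] clipped to [[-90, 90]], centred and divided by [theta = E (clip g * g)]. Clipping
    at 90 gives [theta >= 1 - 4000 / 8100 >= 1/2], whence [|phi| <= 180 / (1/2) = 360]. *)
Lemma subg_dual : exists phi : R -> R, [/\ measurable_fun setT phi,
  forall x, `|phi x| <= 360, \int[P]_w phi (g w) = 0 &
  \int[P]_w (phi (g w) * g w) = 1].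
Proof.
pose clip (x : R) : R := Num.max (-90) (Num.min 90 x).
have mclip : measurable_fun setT clip.
  by apply: measurable_maxr => //; exact: measurable_minr.
have clip90 x : `|clip x| <= 90.
  by rewrite /clip ler_norml; case: (leP (-90) (Num.min 90 x)); case: (leP 90 x); lra.
have mcg : measurable_fun setT (clip \o g) by exact: measurableT_comp.
have ci : intg P (clip \o g).
  by apply: intg_le mcg _ (intg_cst P 90) => w; exact: clip90.
have cgi : intg P (fun w => clip (g w) * g w).
  apply: (psi_dominated (measurable_funM mcg mg) (mulr_ge0 (ler0n _ 90) (ler0n _ 20)) _).1.
  by move=> w; rewrite normrM -mulrA; apply: ler_pM => //; exact: clip90.
pose mu := \int[P]_w clip (g w).
have mu90 : `|mu| <= 90.
  apply: le_trans (le_normr_Rintegral measurableT ci) _.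
  rewrite -[leRHS](Ex_cst P); apply: Ex_le.
  - apply: (intg_le _ _ (intg_cst P 90)) => [|w]; first exact: measurableT_comp.
    by rewrite normr_id; exact: clip90.
  - exact: intg_cst.
  - by move=> w; exact: clip90.
pose theta := \int[P]_w (clip (g w) * g w).
have th : 1 / 2 <= theta.
  have h w : g w ^+ 2 - 8100^-1 * g w ^+ 4 <= clip (g w) * g w.
    have g4 : g w ^+ 4 = g w ^+ 2 * g w ^+ 2 by rewrite -exprD.
    rewrite g4 /clip; case: (leP 90 (g w)) => h1; last first.
      case: (leP (-90) (g w)) => h2; first by have := sqr_ge0 (g w); rewrite !expr2; nra.
      have : 8100 <= g w ^+ 2 by rewrite expr2; nra.
      nra.
    have : 8100 <= g w ^+ 2 by rewrite expr2; nra.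
    case: (leP (-90) 90) => h3; nra.
  have := Ex_le (intgB subg_sqr_intg (intgZ 8100^-1 subg_pow4.1)) cgi h.
  rewrite ExB ?ExZ ?subg_var -/theta//; [|exact: subg_pow4.1|exact: subg_sqr_intg|exact: (intgZ _ subg_pow4.1)].
  have := subg_pow4.2; lra.
have th0 : 0 < theta by lra.
exists (fun x => (clip x - mu) / theta); split.
- by apply: measurable_funM => //; exact: measurable_funB.
- move=> x; rewrite normrM normfV (gtr0_norm th0) ler_pdivrMr//.
  have := ler_normB (clip x) mu; have := clip90 x; nra.
- under eq_Rintegral do rewrite mulrC.
  rewrite ExZ; last by apply: intgB => //; exact: intg_cst.
  by rewrite ExB ?Ex_cst ?subrr ?mulr0//; exact: intg_cst.
- have -> : (fun w => (clip (g w) - mu) / theta * g w) =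
      (fun w => theta^-1 * (clip (g w) * g w - mu * g w)).
    by apply/funext => w; ring.
  rewrite ExZ; last by apply: intgB => //; exact: intgZ subg_intg.
  rewrite ExB//; last exact: intgZ subg_intg.
  by rewrite ExZ ?subg_mean ?mulr0 ?subr0 ?mulVf ?gt_eqF//; exact: subg_intg.
Qed.

End subgaussian.

(** * A net of the unit ball, and counting bounds *)

Section net.
Context {R : realType}.
Variable n : nat.

(** Sign and magnitude of points of the grid of mesh [1 / (2 sqrt n)]. In this form coordinates are
    rounded towards 0, which keeps the point in the ball; magnitudes up to [2 n] suffice as
    [2 sqrt n <= 2 n]. *)
Definition net_index := {ffun 'I_n -> bool * 'I_(2 * n).+1}.
Definition netP (z : net_index) := (\sum_j (z j).2 ^ 2 <= 4 * n)%N.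
Definition netv (z : net_index) : 'rV[R]_n :=
  \row_j ((-1) ^+ (z j).1 * ((z j).2%:R / (2 * Num.sqrt n%:R))).

Lemma netv_sqnorm z : netP z -> sqnorm (netv z) <= 1.
Proof.
move=> zP; have [n0|n0] := posnP n.
  rewrite /sqnorm big1 ?ler01// => j _; have := ltn_ord j; rewrite {2}n0//.
have nn : (0 : R) < n%:R by rewrite ltr0n.
rewrite (_ : sqnorm _ = (\sum_j (z j).2 ^ 2)%:R / (4 * n%:R)).
  by rewrite ler_pdivrMr ?mulr_gt0// mul1r -natrM ler_nat.
rewrite natr_sum mulr_suml; apply: eq_bigr => j _; rewrite !mxE exprMn sqrr_sign mul1r.
rewrite expr_div_n natrX; congr (_ / _); rewrite exprMn sqr_sqrtr ?ler0n//; ring.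
Qed.

(** Rounding moves each coordinate by at most the mesh, so the squared error is at most
    [n / (4 n)]. *)
Lemma net_cover (y : 'rV[R]_n) : sqnorm y <= 1 ->
  exists2 z, netP z & sqnorm (y - netv z) <= 1 / 4.
Proof.
move=> y1; have [n0|n0] := posnP n.
  exists [ffun=> (false, ord0)].
    by rewrite /netP big1// => j _; have := ltn_ord j; rewrite {2}n0.
  by rewrite /sqnorm big1 ?divr_ge0// => j _; have := ltn_ord j; rewrite {2}n0.
have nn : (0 : R) < n%:R by rewrite ltr0n.
have n1 : (1 : R) <= n%:R by rewrite ler1n.
have s0 : 0 < Num.sqrt n%:R :> R by rewrite sqrtr_gt0.
have ss : Num.sqrt n%:R ^+ 2 = n%:R :> R by rewrite sqr_sqrtr ?ler0n.
have s1 : Num.sqrt n%:R <= n%:R :> R by move: s0 ss n1; set s := Num.sqrt _; rewrite expr2; nra.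
have yj j : `|y 0 j| <= 1.
  rewrite -(@ler_pXn2r _ 2)// ?nnegrE// expr1n real_normK ?num_real//.
  apply: le_trans y1; rewrite /sqnorm (bigD1 j)//= lerDl sumr_ge0// => i _; exact: sqr_ge0.
pose a j : R := 2 * Num.sqrt n%:R * `|y 0 j|.
have a0 j : 0 <= a j by rewrite !mulr_ge0// ltW.
have tle j : (Num.truncn (a j))%:R <= a j.
  by have /andP[] := truncn_itv (a0 j).
have tgt j : a j < (Num.truncn (a j)).+1%:R by have /andP[] := truncn_itv (a0 j).
have tn j : (Num.truncn (a j) < (2 * n).+1)%N.
  rewrite ltnS -(ler_nat R) natrM; apply: le_trans (tle j) _.
  rewrite /a -mulrA ler_wpM2l//.
  by apply: le_trans s1; rewrite ler_piMr// ltW.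
exists [ffun j => (y 0 j < 0, Ordinal (tn j))].
  rewrite /netP -(ler_nat R) natr_sum natrM.
  apply: (@le_trans _ _ (4 * n%:R * sqnorm y)).
    rewrite /sqnorm mulr_sumr; apply: ler_sum => j _; rewrite ffunE/= natrX.
    apply: (@le_trans _ _ (a j ^+ 2)); first by rewrite lerXn2r ?nnegrE.
    by rewrite /a !exprMn ss real_normK ?num_real//; lra.
  by rewrite ler_piMr ?mulr_ge0// ltW.
apply: (@le_trans _ _ (\sum_(j < n) (1 / (4 * n%:R)))).
  apply: ler_sum => j _; rewrite !mxE ffunE/=.
  set b := (y 0 j < 0)%R.
  have -> : y 0 j = (-1) ^+ b * (a j / (2 * Num.sqrt n%:R)).
    have -> : a j / (2 * Num.sqrt n%:R) = `|y 0 j|.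
      by rewrite /a mulrC mulKf// mulf_neq0// gt_eqF.
    by rewrite /b; case: ltP => h; [rewrite ltr0_norm// expr1; ring|rewrite ger0_norm// expr0 mul1r].
  rewrite -mulrBr exprMn sqrr_sign mul1r -mulrBl expr_div_n [(2 * _) ^+ 2]exprMn ss.
  have -> : 2 ^+ 2 = 4 :> R by ring.
  rewrite mul1r; apply: ler_piMl; first by rewrite invr_ge0 mulr_ge0// ltW.
  have := tle j; have := tgt j; rewrite -natr1 => h1 h2.
  by rewrite expr_le1// ?subr_ge0//; lra.
rewrite sumr_const card_ord -mulr_natl.
by rewrite le_eqVlt; apply/orP; left; apply/eqP; field; rewrite gt_eqF.
Qed.

Lemma net_norm (S : 'rV[R]_n) :
  exists2 z, netP z & Num.sqrt (sqnorm S) <= 2 * dotp S (netv z).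
Proof.
have [S0|S0] := eqVneq (sqnorm S) 0.
  have Sj j : S 0 j = 0.
    have := psumr_eq0P (fun j _ => sqr_ge0 (S 0 j)) S0.
    by move=> /(_ j isT)/eqP; rewrite sqrf_eq0 => /eqP.
  exists [ffun=> (false, ord0)]; first by rewrite /netP big1// => j _; rewrite ffunE.
  by rewrite S0 sqrtr0 /dotp big1 ?mulr0// => j _; rewrite Sj mul0r.
have Sp : 0 < sqnorm S by rewrite lt_def S0 sqnorm_ge0.
pose s := Num.sqrt (sqnorm S); have s0 : 0 < s by rewrite sqrtr_gt0.
have ss : s ^+ 2 = sqnorm S by rewrite sqr_sqrtr// ltW.
pose y := s^-1 *: S.
have y1 : sqnorm y = 1 by rewrite sqnormZ -ss exprVn mulVf// expf_neq0// gt_eqF.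
have [|z zP zy] := net_cover (y := y); first by rewrite y1.
exists z => //; rewrite -/s.
have -> : S = s *: y by rewrite scalerA mulfV ?scale1r// gt_eqF.
rewrite dotpZl mulrCA ler_peMr ?(ltW s0)//.
(* Expanding [|(y - z) - y / 2|^2 >= 0] with [|y| = 1] and [|y - z|^2 <= 1/4] gives
   [<y, z> >= 1/2]. *)
have := sqnorm_ge0 (- (1/2) *: y + (y - netv z)).
rewrite sqnormD sqnormZ y1 dotpZl dotpDr.
have -> : dotp y y = 1 by rewrite -y1 /dotp /sqnorm; apply: eq_bigr => j _; rewrite expr2.
have -> : dotp y (- netv z) = - dotp y (netv z) by rewrite -scaleN1r dotpZr mulN1r.
by rewrite sqrrN; lra.
Qed.

Lemma geometric_sum_le k : \sum_(i < k) (2 : R) ^- i <= 2.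
Proof.
suff -> : \sum_(i < k) (2 : R) ^- i = 2 - 2 * 2 ^- k.
  by rewrite lerBlDr lerDl mulr_ge0// invr_ge0 exprn_ge0.
elim: k => [|k ih]; first by rewrite big_ord0 expr0 invr1; ring.
by rewrite big_ord_recr/= ih exprS invfM; field; rewrite expf_neq0.
Qed.

(** Magnitudes of a net point satisfy [\sum t_j <= \sum t_j^2 <= 4 n], so the indicator is at most
    [\prod_j 16 * 2 ^- t_j]. The sum factors, with at most [16 * 2 * 2 = 64] per coordinate. *)
Lemma card_net : #|netP|%:R <= (64 : R) ^+ n.
Proof.
rewrite -sum1_card natr_sum.
apply: (@le_trans _ _ (\sum_(z : net_index) \prod_j (16 * 2 ^- (z j).2))).
  rewrite [leRHS](bigID netP)/= -[leLHS]addr0 lerD//; last first.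
    by apply: sumr_ge0 => z _; apply: prodr_ge0 => j _; rewrite mulr_ge0// invr_ge0 exprn_ge0.
  apply: ler_sum => z zP; rewrite big_split/= prodr_const card_ord.
  rewrite prodfV prodrXr ler_pdivlMr ?exprn_gt0// mul1r.
  have -> : (16 : R) = 2 ^+ 4 by rewrite -natrX.
  rewrite -exprM ler_weXn2l ?ler1n//.
  apply: leq_trans zP; apply: leq_sum => j _.
  by case: ((z j).2 : nat) => [//|k]; rewrite expnS expn1 leq_pmull.
rewrite -(bigA_distr_bigA (fun (j : 'I_n) (p : bool * 'I_(2 * n).+1) => 16 * (2 : R) ^- p.2)).
rewrite -[in leRHS](card_ord n) -prodr_const; apply: ler_prod => j _.
apply/andP; split; first by apply: sumr_ge0 => p _; rewrite mulr_ge0// invr_ge0 exprn_ge0.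
rewrite -mulr_sumr -(pair_bigA _ (fun (b : bool) (i : 'I_(2 * n).+1) => (2 : R) ^- i))/=.
rewrite big_bool/=; have := geometric_sum_le (2 * n).+1; lra.
Qed.

End net.

(** The same weighting: with [q = N / n] and weight [1/q] per nonzero entry, the count is at most
    [q ^ n * (1 + 2/q) ^ N], and [N * 2/q = 2 n]. *)
Lemma card_support_le {R : realType} (N n : nat) : (0 < n)%N -> (n <= N)%N ->
  #|[pred s : {ffun 'I_N -> option bool} | (#|[pred i | s i]| <= n)%N]|%:R <=
    expR (n%:R * (ln (N%:R / n%:R) + 2)) :> R.
Proof.
move=> n0 nN; pose q : R := N%:R / n%:R.
have nn : (0 : R) < n%:R by rewrite ltr0n.
have q1 : 1 <= q by rewrite ler_pdivlMr// mul1r ler_nat.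
have q0 : 0 < q by lra.
pose f (o : option bool) : R := if o then q^-1 else 1.
rewrite -sum1_card natr_sum.
apply: (@le_trans _ _ (\sum_(s : {ffun 'I_N -> option bool}) q ^+ n * \prod_i f (s i))).
  have f0 s : 0 <= q ^+ n * \prod_(i < N) f (s i).
    apply: mulr_ge0; first by rewrite exprn_ge0// ltW.
    apply: prodr_ge0 => i _; rewrite /f.
    by case: (s i) => // b; rewrite invr_ge0 ltW.
  rewrite [leRHS](bigID [pred s : {ffun 'I_N -> option bool} | (#|[pred i | s i]| <= n)%N])/=.
  rewrite -[leLHS]addr0 lerD//; last by apply: sumr_ge0 => s _; exact: f0.
  apply: ler_sum => s sn; rewrite (bigID (fun i => isSome (s i)))/=.
  rewrite [X in _ * (_ * X)]big1 ?mulr1 => [|i]; last by rewrite /f; case: (s i).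
  rewrite (eq_bigr (fun=> q^-1)) => [|i]; last by rewrite /f; case: (s i).
  rewrite prodr_const exprVn ler_pdivlMr ?exprn_gt0// mul1r ler_weXn2l//.
rewrite -mulr_sumr -(bigA_distr_bigA (fun (_ : 'I_N) o => f o)).
rewrite prodr_const card_ord.
have -> : \sum_o f o = 1 + 2 / q.
  rewrite (bigD1 None)//= (bigD1 (Some true))//= (bigD1 (Some false))//= big1 ?addr0 => [|[[]|]//].
  by rewrite /f/=; lra.
rewrite mulrDr expRD mulrC expRM_natl lnK ?posrE// mulrC; apply: ler_pM => //.
- by rewrite exprn_ge0// ltW.
- by rewrite exprn_ge0// addr_ge0// divr_ge0// ltW.
have -> : n%:R * 2 = N%:R * (2 / q) :> R.
  by rewrite /q; field; rewrite !gt_eqF ?ltr0n// (leq_trans n0).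
rewrite expRM_natl lerXn2r ?nnegrE ?expR_ge0 ?expR_ge1Dx//.
by rewrite addr_ge0// divr_ge0// ltW.
Qed.

(** * Union bound and Chernoff bound *)

Section union_bound.
Context {R : realType} {d : measure_display} {Omega : measurableType d}.
Variable P : probability Omega R.

Lemma union_bound (K : finType) (Q : pred K) (A : K -> set Omega) (p : R) :
    (forall k, Q k -> measurable (A k)) -> (forall k, Q k -> (P (A k) <= p%:E)%E) ->
  exists B, [/\ measurable B, (P B <= (#|Q|%:R * p)%:E)%E &
    forall w, ~ B w -> forall k, Q k -> ~ A k w].
Proof.
move=> mA PA; suff H (r : seq K) : exists B, [/\ measurable B,
    (P B <= ((count Q r)%:R * p)%:E)%E &
    forall w, ~ B w -> forall k, k \in r -> Q k -> ~ A k w].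
  have [B [mB PB AB]] := H (enum K); exists B; split => //.
    rewrite (le_trans PB)// lee_fin le_eqVlt; apply/orP; left; apply/eqP.
    by rewrite cardE -size_filter enumT.
  by move=> w Bw k; apply: AB => //; rewrite mem_enum.
elim: r => [|k r [B [mB PB AB]]].
  by exists set0; split => //; rewrite measure0 mul0r.
have [Qk|Qk] := boolP (Q k); last first.
  exists B; split => //=; first by rewrite (negbTE Qk).
  move=> w Bw l; rewrite in_cons => /orP[/eqP ->|]; last exact: AB.
  by rewrite (negbTE Qk).
exists (A k `|` B); split.
- by apply: measurableU => //; exact: mA.
- apply: le_trans (measureU2 _ _ _) _ => //; first exact: mA.
  rewrite /= Qk natrD mulrDl mul1r EFinD; apply: leeD => //; exact: PA.
- move=> w /not_orP[Aw Bw] l; rewrite in_cons => /orP[/eqP ->//|]; exact: AB.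
Qed.

Variables (I : finType) (X : I -> Omega -> R).
Hypothesis indX : mutually_independent P X.

Lemma chernoff_indep (K : finType) (J_ : K -> {set I}) (Z : K -> Omega -> R)
    (b : K -> R) (lam t : R) : 0 <= lam ->
    (forall k l, k != l -> [disjoint J_ k & J_ l]%B) ->
    (forall k, adapted X (J_ k) (Z k)) ->
    (forall k, intg P (fun w => expR (lam * Z k w))) ->
    (forall k, \int[P]_w expR (lam * Z k w) <= expR (b k)) ->
  measurable [set w | t <= \sum_k Z k w] /\
  (P [set w | t <= \sum_k Z k w]%R <= (expR (\sum_k b k - lam * t))%:E)%E.
Proof.
move=> l0 dJ aZ iZ bZ.
have mS : measurable [set w | t <= \sum_k Z k w].
  rewrite -[X in measurable X]setTI; apply: measurable_fun_le => //.
  by apply: measurable_sum => k; exact: (adapted_measurable indX (aZ k)).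
split => //.
have aE k : adapted X (J_ k) (fun w => expR (lam * Z k w)).
  by apply: measurableT_comp => //; apply: measurable_funM => //; exact: aZ.
have [ip ep] := indep_prod indX dJ aE iZ.
pose Y w := expR (- (lam * t)) * \prod_k expR (lam * Z k w).
have iY : intg P Y by exact: intgZ.
have Y0 w : 0 <= Y w by rewrite mulr_ge0 ?expR_ge0// prodr_ge0// => k _; exact: expR_ge0.
apply: le_trans (_ : P [set w | 1 <= Y w]%R <= _)%E.
  apply: le_measure; rewrite ?inE//.
    rewrite -[X in measurable X]setTI; apply: measurable_fun_le => //; exact: intg_measurable iY.
  move=> w /= tS; rewrite /Y -expR_sum -expRD -expR0 ler_expR -mulr_sumr addrC subr_ge0.
  by rewrite ler_wpM2l.
apply: le_trans (markov1 iY Y0) _; rewrite lee_fin ExZ// ep expRD mulrC.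
rewrite ler_wpM2r ?expR_ge0// expR_sum; apply: ler_prod => k _.
rewrite bZ andbT; apply: Rintegral_ge0 => w _; exact: expR_ge0.
Qed.

End union_bound.

(** * Signed sums of at most [n] of the vectors *)

Section supported_sums.
Context {R : realType} {d : measure_display} {Omega : measurableType d}.
Variable P : probability Omega R.
Variables (n N : nat) (G : 'I_N -> 'I_n -> Omega -> R).
Hypothesis indG : mutually_independent P (fun ij : 'I_N * 'I_n => G ij.1 ij.2).
Variable k1 : R.
Hypothesis k10 : 0 < k1.
Hypothesis mgf : forall i j s, intg P (fun w => expR (s * G i j w)) /\
  \int[P]_w expR (s * G i j w) <= expR (k1 * s ^+ 2).

Lemma supported_sums_bound : (0 < n)%N -> (n <= N)%N ->
  exists B : set Omega, [/\ measurable B, (P B <= (expR (- n%:R))%:E)%E &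
    forall w, ~ B w -> forall s : {ffun 'I_N -> option bool}, (#|[pred i | s i]| <= n)%N ->
      sqnorm (\sum_i sgn3 (s i) *: (\row_j G i j w)) <=
        16 * k1 * n%:R ^+ 2 * (ln (N%:R / n%:R) + 3 + ln 64)].
Proof.
(* [ln (N/n) + 2] pays for the sign patterns, [ln 64] for the net, and the remaining 1 leaves
   [exp (- n)]. *)
move=> n0 nN; pose al : R := ln (N%:R / n%:R) + 3 + ln 64.
have nn : (0 : R) < n%:R by rewrite ltr0n.
have al0 : 0 < al.
  rewrite ltr_pwDl// ?ln_ge0 ?ler1n// ltr_wpDl// ln_ge0// ler_pdivlMr// mul1r ler_nat//.
pose lam := Num.sqrt (al / k1).
have lam2 : lam ^+ 2 = al / k1 by rewrite sqr_sqrtr// divr_ge0// ltW.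
have lam0 : 0 < lam by rewrite sqrtr_gt0 divr_gt0.
(* The Chernoff exponent is at most [k1 lam^2 n - lam t]. As [lam^2 = al / k1], this is
   [al n - 2 al n = - al n]. *)
pose t := 2 * n%:R * al / lam.
pose K := ({ffun 'I_N -> option bool} * net_index n)%type.
pose Q (k : K) := (#|[pred i | k.1 i]| <= n)%N && netP k.2.
pose Z (k : K) (ij : 'I_N * 'I_n) w := sgn3 (k.1 ij.1) * netv k.2 0 ij.2 * G ij.1 ij.2 w.
pose A (k : K) := [set w | t <= \sum_ij Z k ij w].
have chern k : Q k -> measurable (A k) /\ (P (A k) <= (expR (- (n%:R * al)))%:E)%E.
  move=> /andP[k1n k2].
  pose b ij := k1 * (lam * (sgn3 (k.1 ij.1) * netv k.2 0 ij.2)) ^+ 2.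
  have [|ij|ij|ij|] := @chernoff_indep _ _ _ P _ _ indG ('I_N * 'I_n)%type (fun ij => [set ij]%SET)
    (Z k) b lam t (ltW lam0).
  - by move=> i j ij; rewrite finset.disjoints1 finset.inE.
  - apply: measurable_funM => //; apply: (@adapted_coord _ _ _ _ (fun ij => G ij.1 ij.2)); by rewrite finset.inE.
  - rewrite (_ : (fun w => _) = (fun w => expR (lam * (sgn3 (k.1 ij.1) * netv k.2 0 ij.2) * G ij.1 ij.2 w))).
      exact: (mgf _ _ _).1.
    by apply/funext => w; rewrite /Z mulrA.
  - rewrite /b; under eq_Rintegral do rewrite /Z mulrA.
    exact: (mgf _ _ _).2.
  move=> mA PA; split => //; apply: le_trans PA _; rewrite lee_fin ler_expR.
  have -> : lam * t = 2 * n%:R * al by rewrite /t; field; rewrite gt_eqF.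
  have sb : \sum_ij b ij = al * (\sum_i sgn3 (k.1 i) ^+ 2) * sqnorm (netv k.2).
    rewrite -mulrA /sqnorm mulr_suml mulr_sumr.
    rewrite (eq_bigr (fun ij => b (ij.1, ij.2))) => [|[]//].
    rewrite -(pair_bigA _ (fun i j => b (i, j)))/=; apply: eq_bigr => i _.
    rewrite !mulr_sumr; apply: eq_bigr => j _.
    by rewrite /b/= !exprMn lam2; field; rewrite gt_eqF.
  have sgnle : \sum_i sgn3 (k.1 i) ^+ 2 <= n%:R :> R.
    apply: le_trans (_ : #|[pred i | k.1 i]|%:R <= _); last by rewrite ler_nat.
    rewrite -sum1_card natr_sum [leRHS]big_mkcond/=; apply: ler_sum => i _.
    rewrite inE /sgn3; case: (k.1 i) => [e|]; rewrite /= ?sqrr_sign// expr0n//.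
  have sgn0 : 0 <= \sum_i sgn3 (k.1 i) ^+ 2 :> R by apply: sumr_ge0 => i _; exact: sqr_ge0.
  have : \sum_ij b ij <= al * n%:R.
    rewrite sb -mulrA ler_wpM2l ?(ltW al0)// -[leRHS]mulr1; apply: ler_pM => //.
      exact: sqnorm_ge0.
    exact: netv_sqnorm.
  by lra.
have [B [mB PB AB]] := union_bound (fun k Qk => (chern k Qk).1) (fun k Qk => (chern k Qk).2).
exists B; split => //.
  apply: le_trans PB _; rewrite lee_fin.
  have -> : #|Q| = (#|[pred s : {ffun 'I_N -> option bool} | (#|[pred i | s i]| <= n)%N]| * #|@netP n|)%N.
    by rewrite -cardX; apply: eq_card => -[s z]; rewrite !inE.
  rewrite natrM.
  apply: (@le_trans _ _ (expR (n%:R * (ln (N%:R / n%:R) + 2)) * 64 ^+ n * expR (- (n%:R * al)))).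
    rewrite ler_wpM2r ?expR_ge0//; apply: ler_pM => //; first exact: card_support_le.
    exact: card_net.
  have -> : (64 : R) ^+ n = expR (n%:R * ln 64) by rewrite expRM_natl lnK// posrE.
  by rewrite -!expRD ler_expR /al; lra.
move=> w Bw s sn.
set S := \sum_i _; have [z zP Sz] := net_norm S.
have := AB w Bw (s, z); rewrite /Q/= sn zP => /(_ isT)/negP; rewrite -ltNge.
have -> : \sum_ij Z (s, z) ij w = dotp S (netv z).
  rewrite /dotp /S; under [RHS]eq_bigr do rewrite summxE mulr_suml.
  rewrite exchange_big/= pair_bigA/=; apply: eq_bigr => -[i j] _.
  by rewrite /Z/= !mxE; ring.
move=> Szt; have : Num.sqrt (sqnorm S) <= 2 * t by lra.
have t0 : 0 <= t by rewrite divr_ge0 ?mulr_ge0 ?ltW.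
have t20 : 0 <= 2 * t by lra.
rewrite -(@ler_pXn2r _ 2)// ?nnegrE ?sqrtr_ge0//.
rewrite sqr_sqrtr ?sqnorm_ge0// => /le_trans; apply.
rewrite /t !exprMn exprVn lam2 -/al le_eqVlt; apply/orP; left; apply/eqP.
by field; rewrite !gt_eqF.
Qed.

End supported_sums.

Section rank_one.
Context {R : comUnitRingType}.

(** The matrix determinant lemma, by factoring one block matrix in two ways. *)
Lemma det_rank_one_update n (a : 'cV[R]_n) (b : 'rV[R]_n) :
  \det (1%:M + a *m b) = 1 + (b *m a) 0 0.
Proof.
pose M := block_mx 1%:M (- b) a 1%:M.
have e1 : M = block_mx 1%:M 0 a 1%:M *m block_mx 1%:M (- b) 0 (1%:M + a *m b).
  rewrite mulmx_block !mul1mx !mul0mx !mulmx1 !addr0.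
  by rewrite mulmxN addrCA addNr addr0.
have e2 : M = block_mx (1%:M + b *m a) (- b) 0 1%:M *m block_mx 1%:M 0 a 1%:M.
  by rewrite mulmx_block !mul1mx !mul0mx !mulmx1 !mulmx0 !add0r mulNmx addrK.
have := congr1 determinant e1; rewrite {1}e2 !det_mulmx !det_lblock !det_ublock !det1 !mul1r !mulr1.
by move=> <-; rewrite det_mx11 !mxE.
Qed.

End rank_one.

(** * Greedy choice of rows *)

Section greedy.
Context {R : realType}.
Variable n : nat.
Implicit Types (Q B : 'M[R]_n) (g x u : 'rV[R]_n).

(** [Q] is the projection to the complement of the kept rows. Its trace is its rank, and also the
    mean of [|g Q|^2] for a row with independent centred entries of variance 1. *)
Definition accepts Q g := \tr Q / 2 <= sqnorm (g *m Q).

Definition greedy_step Q g : 'M[R]_n :=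
  if accepts Q g then Q - (sqnorm (g *m Q))^-1 *: ((g *m Q)^T *m (g *m Q)) else Q.

Fixpoint greedy (r : nat -> 'rV[R]_n) (k : nat) : 'M[R]_n :=
  if k is k'.+1 then greedy_step (greedy r k') (r k') else 1%:M.

Definition projection_rank Q (d : nat) := [/\ Q *m Q = Q, Q^T = Q & \tr Q = d%:R].

Lemma mulmx_tr_sqnorm u : u *m u^T = (sqnorm u)%:M.
Proof.
rewrite [LHS]mx11_scalar mxE; congr (_%:M); apply: eq_bigr => j _.
by rewrite mxE expr2.
Qed.

Lemma projection_rank0 Q : projection_rank Q 0 -> Q = 0.
Proof.
move=> [QQ QT Q0]; apply/matrixP => i j; rewrite mxE.
have : \tr (Q *m Q^T) = 0 by rewrite QT QQ.
rewrite /mxtrace => /psumr_eq0P H.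
have /H/(_ i isT) : forall i, true -> 0 <= (Q *m Q^T) i i.
  by move=> k _; rewrite mxE sumr_ge0// => l _; rewrite !mxE -expr2 sqr_ge0.
rewrite mxE => /psumr_eq0P H2.
have /H2/(_ j isT) : forall l, true -> 0 <= Q i l * Q^T l i.
  by move=> l _; rewrite !mxE -expr2 sqr_ge0.
by rewrite !mxE -expr2 => /eqP; rewrite sqrf_eq0 => /eqP.
Qed.

Lemma greedy_step_accepted Q g d : projection_rank Q d.+1 -> accepts Q g ->
  exists s (h : 'rV[R]_n), [/\ 0 < s, s ^+ 2 >= d.+1%:R / 2, g *m Q = s *: h,
    [/\ h *m h^T = 1%:M, h *m Q = h, Q *m h^T = h^T & g *m h^T = s%:M] &
    greedy_step Q g = Q - h^T *m h].
Proof.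
move=> [QQ QT Qd] acc; pose u := g *m Q.
have acc' : d.+1%:R / 2 <= sqnorm u by move: acc; rewrite /accepts Qd.
have u0 : 0 < sqnorm u by rewrite (lt_le_trans _ acc')// divr_gt0.
pose s := Num.sqrt (sqnorm u); have s0 : 0 < s by rewrite sqrtr_gt0.
have ss : s ^+ 2 = sqnorm u by rewrite sqr_sqrtr// ltW.
have sn : s != 0 by rewrite gt_eqF.
have uE : u = s *: (s^-1 *: u) by rewrite scalerA mulfV// scale1r.
have hQ : s^-1 *: u *m Q = s^-1 *: u by rewrite -scalemxAl /u -mulmxA QQ.
have Qh : Q *m (s^-1 *: u)^T = (s^-1 *: u)^T by rewrite -{1}QT -trmx_mul hQ.
exists s, (s^-1 *: u); split => //; first by rewrite ss.
- split => //.
  + rewrite linearZ/= -scalemxAl -scalemxAr scalerA mulmx_tr_sqnorm -ss scale_scalar_mx.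
    by congr (_%:M); field.
  + rewrite -Qh mulmxA -/u linearZ/= -scalemxAr mulmx_tr_sqnorm -ss scale_scalar_mx.
    by congr (_%:M); field.
- rewrite /greedy_step acc -/u; congr (_ - _).
  have -> : (s^-1 *: u)^T = s^-1 *: u^T by rewrite linearZ.
  by rewrite -scalemxAl -scalemxAr scalerA -ss expr2 invfM.
Qed.

Lemma projection_rank_step Q g d : projection_rank Q d.+1 -> accepts Q g ->
  projection_rank (greedy_step Q g) d.
Proof.
move=> Qp acc; have [s [h [s0 _ uE [hh hQ Qh gh] ->]]] := greedy_step_accepted Qp acc.
have [QQ QT Qd] := Qp; split.
- rewrite mulmxBl !mulmxBr QQ -(mulmxA _ h Q) hQ (mulmxA Q) Qh.
  by rewrite mulmxA -(mulmxA _ h) hh mulmx1 subrr subr0.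
- by rewrite linearB/= QT trmx_mul trmxK.
- rewrite linearB/= Qd mxtrace_mulC hh mxtrace1 -natr1; ring.
Qed.

(** At rank 0 the test reads [0 <= 0] and accepts, but the update then subtracts a zero matrix. *)
Lemma projection_rank_id Q g d : projection_rank Q d -> d = 0%N \/ ~~ accepts Q g ->
  greedy_step Q g = Q.
Proof.
move=> Qp [d0|]; last by rewrite /greedy_step => /negbTE ->.
have -> : Q = 0 by apply: projection_rank0; rewrite -d0.
by rewrite /greedy_step mulmx0 mulmx0 scaler0 subr0 if_same.
Qed.

Lemma projection_rank1 : projection_rank 1%:M n.
Proof. by split; rewrite ?mulmx1 ?trmx1 ?mxtrace1. Qed.

Lemma greedy_rank r k : exists2 d, (d <= n)%N & projection_rank (greedy r k) d.
Proof.
elim: k => [|k [d dn ih]]; first by exists n => //; exact: projection_rank1.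
have [acc|nacc] := boolP (accepts (greedy r k) (r k)); last first.
  by exists d => //=; rewrite (projection_rank_id ih)//; right.
case: d dn ih => [|d] dn ih.
  by exists 0%N => //=; rewrite (projection_rank_id ih)//; left.
by exists d; [exact: ltnW|exact: projection_rank_step].
Qed.

(** [B] sends the orthonormal directions used so far to the kept rows and fixes the range of [Q].
    The [c i] are the coordinates of [x] along these directions, hence the Pythagorean identity; the
    determinant has gained a squared factor of at least half the rank at each kept row, from [n]
    down to [d + 1]. *)
Definition greedy_spans (r : nat -> 'rV[R]_n) k Q d := exists B,
  [/\ B *m Q = Q, n`!%:R / 2 ^+ n <= \det B ^+ 2 * (d`!%:R / 2 ^+ d) &
   forall x, exists c : nat -> R, x *m B = \sum_(i < k) c i *: r i + x *m Q /\
     \sum_(i < k) c i ^+ 2 + sqnorm (x *m Q) = sqnorm x].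

Lemma greedy_spansP r k : exists2 d, projection_rank (greedy r k) d &
  greedy_spans r k (greedy r k) d.
Proof.
elim: k => [|k [d Qp [B [BQ detB ih]]]].
  exists n; first exact: projection_rank1.
  exists 1%:M; split; rewrite ?mulmx1 ?det1 ?expr1n ?mul1r// => x.
  by exists (fun=> 0); rewrite !big_ord0 /= !mulmx1 !add0r.
have same : greedy_step (greedy r k) (r k) = greedy r k ->
    exists2 d, projection_rank (greedy r k.+1) d & greedy_spans r k.+1 (greedy r k.+1) d.
  move=> /= ->; exists d => //; exists B; split => // x; have [c [c1 c2]] := ih x.
  have ck (i : 'I_k) : (widen_ord (leqnSn k) i == k :> nat) = false.
    by rewrite /= ltn_eqF.
  exists (fun i => if i == k then 0 else c i); rewrite !big_ord_recr/= eqxx scale0r addr0.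
  rewrite expr0n/= addr0; split.
    by rewrite c1; congr (_ + _); apply: eq_bigr => i _; rewrite ck.
  by rewrite -c2; congr (_ + _); apply: eq_bigr => i _; rewrite ck.
have [acc|nacc] := boolP (accepts (greedy r k) (r k)); last first.
  by apply: same; apply: projection_rank_id Qp _; right.
case: d Qp detB same => [|d] Qp detB same.
  by apply: same; apply: projection_rank_id Qp _; left.
have Qp' := projection_rank_step Qp acc.
have [s [h [s0 sd uE [hh hQ Qh gh] stepE]]] := greedy_step_accepted Qp acc.
exists d => //=; set Q := greedy r k in Qp BQ detB ih acc uE hQ Qh stepE Qp' *.
set g := r k in acc uE gh stepE Qp' *; rewrite stepE.
have Bh : B *m h^T = h^T by rewrite -Qh mulmxA BQ.
(* The update sends [h] to [g]. As [B h^T = h^T] it factors as [B (1 + h^T (g - h))], so the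
   determinant is multiplied by [<g, h> = s], with [s^2 >= (d + 1) / 2]. *)
exists (B + h^T *m (g - h)); split.
- have e0 : (g - h) *m (Q - h^T *m h) = 0.
    rewrite mulmxBl !mulmxBr hQ uE (mulmxA g) gh (mulmxA h) hh !mul_scalar_mx scale1r.
    by rewrite !subrr.
  by rewrite mulmxDl -mulmxA e0 mulmx0 addr0 mulmxBr BQ mulmxA Bh.
- have -> : B + h^T *m (g - h) = B *m (1%:M + h^T *m (g - h)).
    by rewrite mulmxDr mulmx1 mulmxA Bh.
  rewrite det_mulmx det_rank_one_update mulmxBl gh hh !mxE eqxx !mulr1n.
  have -> : 1 + (s - 1) = s by ring.
  rewrite exprMn.
  apply: le_trans detB _; rewrite -(mulrA (\det B ^+ 2)); apply: ler_wpM2l; first exact: sqr_ge0.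
  rewrite factS natrM exprS invfM mulrACA; exact: ler_wpM2r.
- move=> x; have [c [c1 c2]] := ih x; pose al := (x *m h^T) 0 0.
  have xh : x *m h^T = al%:M by rewrite -mx11_scalar.
  have ck (i : 'I_k) : (widen_ord (leqnSn k) i == k :> nat) = false.
    by rewrite /= ltn_eqF.
  exists (fun i => if i == k then al else c i); rewrite !big_ord_recr/= eqxx.
  rewrite (eq_bigr (fun i : 'I_k => c i *: r i)) => [|i _]; last by rewrite ck.
  rewrite (eq_bigr (fun i : 'I_k => c i ^+ 2)) => [|i _]; last by rewrite ck.
  rewrite mulmxDr c1 !mulmxBr !mulmxA xh !mul_scalar_mx; split.
    by rewrite addrACA.
  have -> : sqnorm (x *m Q - al *: h) = sqnorm (x *m Q) - al ^+ 2.
    rewrite -scaleNr sqnormD sqnormZ dotpZr.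
    have -> : dotp (x *m Q) h = al.
      have : x *m Q *m h^T = al%:M by rewrite -mulmxA Qh.
      move=> /(congr1 (fun A : 'M[R]_1 => A 0 0)); rewrite !mxE eqxx mulr1n => <-.
      by apply: eq_bigr => j _; rewrite [h^T _ _]mxE.
    have -> : sqnorm h = 1.
      have := congr1 (fun A : 'M[R]_1 => A 0 0) (mulmx_tr_sqnorm h).
      by rewrite hh !mxE eqxx !mulr1n => <-.
    ring.
  by rewrite -c2; ring.
Qed.

End greedy.

(** * Probability that a row is rejected *)

Section row_variance.
Context {R : realType} {d : measure_display} {Omega : measurableType d}.
Variable P : probability Omega R.
Variables (I : finType) (X : I -> Omega -> R).
Hypothesis indX : mutually_independent P X.
Variables (n : nat) (ix : 'I_n -> I).
Hypothesis ix_inj : injective ix.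
Let g j := X (ix j).
Hypothesis gi : forall j, intg P (g j).
Hypothesis g2i : forall j, intg P (fun w => g j w ^+ 2).
Hypothesis g4i : forall j, intg P (fun w => g j w ^+ 4).
Hypothesis g1 : forall j, \int[P]_w g j w = 0.
Hypothesis g2 : forall j, \int[P]_w g j w ^+ 2 = 1.
Variable k4 : R.
Hypothesis k41 : 4 <= k4.
Hypothesis g4 : forall j, \int[P]_w g j w ^+ 4 <= k4.

Let dJ k l : k != l -> [disjoint [set ix k]%SET & [set ix l]%SET]%B.
Proof. by move=> kl; rewrite finset.disjoints1 finset.inE (inj_eq ix_inj). Qed.

Let ga j : adapted X [set ix j]%SET (g j).
Proof. by apply: adapted_coord; rewrite finset.inE. Qed.

Lemma Ex_orthogonal (K : finType) (e : K -> Omega -> R) (c : K -> R) :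
    (forall p q, intg P (fun w => e p w * e q w)) ->
    (forall p q, p != q -> \int[P]_w (e p w * e q w) = 0) ->
  intg P (fun w => (\sum_p c p * e p w) ^+ 2) /\
  \int[P]_w (\sum_p c p * e p w) ^+ 2 = \sum_p c p ^+ 2 * \int[P]_w (e p w * e p w).
Proof.
move=> ei e0.
have E : (fun w => (\sum_p c p * e p w) ^+ 2) =
    (fun w => \sum_p \sum_q c p * c q * (e p w * e q w)).
  apply/funext => w; rewrite expr2 mulr_suml; apply: eq_bigr => p _.
  by rewrite mulr_sumr; apply: eq_bigr => q _; ring.
have si p : intg P (fun w => \sum_q c p * c q * (e p w * e q w)).
  by apply: intg_sum => q; exact: intgZ.
rewrite E; split; first exact: intg_sum.
rewrite Ex_sum//; apply: eq_bigr => p _; rewrite Ex_sum => [|q]; last exact: intgZ.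
rewrite (bigD1 p)//= big1 ?addr0 => [|q qp]; first by rewrite ExZ// expr2.
by rewrite ExZ// e0 ?mulr0// eq_sym.
Qed.

(** A product of two off-diagonal terms has all exponents at most 2, so its mean follows from
    independence and the first two moments. *)
Let mono (m : 'I_n -> nat) w : R := \prod_j g j w ^+ m j.

Let monoE (m : 'I_n -> nat) : (forall j, m j <= 2)%N ->
  intg P (mono m) /\ \int[P]_w mono m w = \prod_j \int[P]_w g j w ^+ m j.
Proof.
move=> m2; apply: (indep_prod indX dJ) => [j|j].
  exact: (measurable_funX (m j) (@ga j)).
have := m2 j; case: (m j) => [|[|[|//]]] _.
- rewrite (_ : (fun w => _) = cst 1); first exact: intg_cst.
  by apply/funext => w; rewrite expr0.
- rewrite (_ : (fun w => _) = g j); first exact: gi.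
  by apply/funext => w; rewrite expr1.
- exact: g2i.
Qed.

Let pair_mono (a b c e : 'I_n) w : g a w * g b w * (g c w * g e w) =
  mono (fun j => (j == a) + (j == b) + ((j == c) + (j == e)))%N w.
Proof.
have gj a' : g a' w = \prod_j g j w ^+ (j == a').
  rewrite (bigD1 a')//= eqxx expr1 big1 ?mulr1// => j /negbTE ->; exact: expr0.
rewrite (gj a) (gj b) (gj c) (gj e) -!big_split/=.
by apply: eq_bigr => j _; rewrite !exprD.
Qed.

Let pair_le2 (a b c e : 'I_n) : a != b -> c != e ->
  forall j, ((j == a) + (j == b) + ((j == c) + (j == e)) <= 2)%N.
Proof.
move=> ab ce j.
have : ((j == a) + (j == b) <= 1)%N.
  by case: eqP => [->|_]; [rewrite (negbTE ab)|case: eqP].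
have : ((j == c) + (j == e) <= 1)%N.
  by case: eqP => [->|_]; [rewrite (negbTE ce)|case: eqP].
by move=> h1 h2; exact: (leq_add h2 h1).
Qed.

Let pair_i (a b c e : 'I_n) : a != b -> c != e ->
  intg P (fun w => g a w * g b w * (g c w * g e w)).
Proof.
move=> ab ce.
have -> : (fun w => g a w * g b w * (g c w * g e w)) =
    mono (fun j => (j == a) + (j == b) + ((j == c) + (j == e)))%N.
  by apply/funext => w; exact: pair_mono.
by have [] := monoE (pair_le2 ab ce).
Qed.

(** Two distinct ordered pairs leave some index with exponent 1, whose factor has mean 0. *)
Let pair_orth (a b c e : 'I_n) : (a < b)%N -> (c < e)%N -> (a, b) != (c, e) ->
  \int[P]_w (g a w * g b w * (g c w * g e w)) = 0.
Proof.
move=> ab ce abce.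
have ab' : a != b by rewrite -val_eqE ltn_eqF.
have ce' : c != e by rewrite -val_eqE ltn_eqF.
under eq_Rintegral do rewrite pair_mono.
have [_ ->] := monoE (pair_le2 ab' ce').
have zero j : ((j == a) + (j == b) + ((j == c) + (j == e)) = 1)%N ->
    \prod_j \int[P]_w g j w ^+ ((j == a) + (j == b) + ((j == c) + (j == e))) = 0.
  move=> j1; rewrite (bigD1 j)//= j1.
  by rewrite [X in X * _](_ : _ = 0) ?mul0r// -(g1 j); apply: eq_Rintegral => w _; rewrite expr1.
have [ac|ac] := eqVneq a c.
  have be : b != e by apply: contraNneq abce => ->; rewrite ac.
  apply: (zero b); rewrite eqxx (negbTE be) eq_sym (negbTE ab').
  by rewrite eq_sym -ac (negbTE ab').
have [ae|ae] := eqVneq a e.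
  apply: (zero b); rewrite eqxx [b == a]eq_sym (negbTE ab') -ae [b == a]eq_sym (negbTE ab').
  rewrite (_ : (b == c) = false)//; apply/negbTE; rewrite -val_eqE gtn_eqF//.
  by rewrite (ltn_trans ce)// -ae.
by apply: (zero a); rewrite eqxx (negbTE ab') (negbTE ac) (negbTE ae).
Qed.

Let pair_diag (a b : 'I_n) : (a < b)%N ->
  \int[P]_w (g a w * g b w * (g a w * g b w)) = 1.
Proof.
move=> ab; have ab' : a != b by rewrite -val_eqE ltn_eqF.
under eq_Rintegral do rewrite pair_mono.
have [_ ->] := monoE (pair_le2 ab' ab').
apply: big1 => j _.
have [->|ja] := eqVneq j a.
  by rewrite (negbTE ab'); exact: g2.
have [->|jb] := eqVneq j b; first exact: g2.
under eq_Rintegral do rewrite expr0.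
exact: Ex_cst.
Qed.

Let sq a w : R := g a w ^+ 2 - 1.

Let sqi a : intg P (sq a).
Proof. by apply: intgB => //; exact: intg_cst. Qed.

Let sq0 a : \int[P]_w sq a w = 0.
Proof. by rewrite ExB//; [rewrite g2 Ex_cst subrr|exact: intg_cst]. Qed.

Let sqa a : adapted X [set ix a]%SET (sq a).
Proof. by apply: measurable_funB; [exact: (measurable_funX 2 (@ga a))|exact: measurable_cst]. Qed.

Let sqsq_i a b : intg P (fun w => sq a w * sq b w).
Proof.
have [->|ab] := eqVneq a b.
  rewrite (_ : (fun w => _) = (fun w => g b w ^+ 4 - 2 * g b w ^+ 2 + 1)).
    apply: intgD; last exact: intg_cst.
    by apply: intgB => //; exact: intgZ.
  by apply/funext => w; rewrite /sq; ring.
exact: (indep_integrable indX (dJ ab) (@sqa a) (@sqa b) (sqi a) (sqi b)).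
Qed.

Let sq_orth a b : a != b -> \int[P]_w (sq a w * sq b w) = 0.
Proof.
by move=> ab; rewrite (indep_Rintegral indX (dJ ab) (@sqa a) (@sqa b) (sqi a) (sqi b)) sq0 mul0r.
Qed.

Let sq_diag a : \int[P]_w (sq a w * sq a w) <= k4.
Proof.
have -> : (fun w => sq a w * sq a w) = (fun w => g a w ^+ 4 - (2 * g a w ^+ 2 - 1)).
  by apply/funext => w; rewrite /sq; ring.
have i1 : intg P (fun w => 2 * g a w ^+ 2 - 1).
  by apply: intgB; [exact: intgZ|exact: intg_cst].
rewrite ExB// ExB ?ExZ ?g2 ?Ex_cst//; [|exact: intgZ|exact: intg_cst].
by have := g4 a; lra.
Qed.

Variables (Q : 'M[R]_n) (r : nat).
Hypothesis Qr : projection_rank Q r.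

Let QT a b : Q a b = Q b a.
Proof. by case: Qr => _ QT _; rewrite -{1}QT mxE. Qed.

Let lt_pair := {p : 'I_n * 'I_n | (p.1 < p.2)%N}.
(** [|g Q|^2 - r] is [A + 2 B]: centred squares on the diagonal and products over [a < b]. Each of
    the two is a sum of pairwise orthogonal variables. *)
Let A w : R := \sum_a Q a a * sq a w.
Let B w : R := \sum_(p : lt_pair) Q (val p).1 (val p).2 * (g (val p).1 w * g (val p).2 w).

Let grow w : 'rV[R]_n := \row_j g j w.

Let sum_sym (F : 'I_n -> 'I_n -> R) : (forall a b, F a b = F b a) ->
  \sum_a \sum_b F a b = \sum_a F a a + 2 * \sum_(p : lt_pair) F (val p).1 (val p).2.
Proof.
move=> FS; rewrite pair_bigA/=.
rewrite (bigID (fun p : 'I_n * 'I_n => p.1 == p.2))/=; congr (_ + _).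
  rewrite (reindex_onto (fun a => (a, a)) fst)/= => [|[a b] /=/eqP -> //].
  by apply: eq_bigl => a; rewrite /= !eqxx.
rewrite (bigID (fun p : 'I_n * 'I_n => (p.1 < p.2)%N))/= mulr2n mulrDl !mul1r.
have e1 : \sum_(p : 'I_n * 'I_n | (p.1 < p.2)%N) F p.1 p.2 =
    \sum_(p : lt_pair) F (val p).1 (val p).2.
  rewrite (reindex_omap (val : lt_pair -> _) insub)/=.
    by apply: eq_bigl => p; rewrite (valP p) valK eqxx.
  by move=> p pp; rewrite insubT.
rewrite -e1; congr (_ + _).
  by apply: eq_bigl => -[a b] /=; rewrite -val_eqE/=; case: ltngtP.
rewrite (reindex_inj (h := fun p => (p.2, p.1)))/=; last by move=> [a b] [c e] [-> ->].
apply: eq_big => [[a b] /=|p _]; last by rewrite FS.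
by rewrite -val_eqE/=; case: ltngtP.
Qed.

Let quad w : sqnorm (grow w *m Q) - r%:R = A w + 2 * B w.
Proof.
case: Qr => QQ QTm Qt.
have -> : sqnorm (grow w *m Q) = \sum_a \sum_b Q a b * (g a w * g b w).
  have : (grow w *m Q) *m (grow w *m Q)^T = grow w *m Q *m (grow w)^T.
    by rewrite trmx_mul QTm mulmxA -(mulmxA _ Q Q) QQ.
  rewrite mulmx_tr_sqnorm => /(congr1 (fun M : 'M[R]_1 => M 0 0)).
  rewrite !mxE eqxx mulr1n => ->; rewrite exchange_big/=; apply: eq_bigr => b _.
  rewrite !mxE mulr_suml; apply: eq_bigr => a _; rewrite !mxE; ring.
rewrite sum_sym => [|a b]; last by rewrite QT; ring.
rewrite -Qt /mxtrace addrAC; congr (_ + _).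
rewrite -sumrB; apply: eq_bigr => a _; rewrite /sq; ring.
Qed.

Let A2 : intg P (fun w => A w ^+ 2) /\ \int[P]_w A w ^+ 2 <= k4 * \sum_a Q a a ^+ 2.
Proof.
have [i1 e1] := Ex_orthogonal (fun a => Q a a) sqsq_i sq_orth; split => //.
rewrite e1 mulr_sumr; apply: ler_sum => a _; rewrite mulrC ler_wpM2r ?sqr_ge0//.
Qed.

Let Bi (p q : lt_pair) : intg P (fun w => g (val p).1 w * g (val p).2 w *
    (g (val q).1 w * g (val q).2 w)).
Proof. by apply: pair_i; rewrite -val_eqE ltn_eqF// (valP p, valP q). Qed.

Let B2 : intg P (fun w => B w ^+ 2) /\
  \int[P]_w B w ^+ 2 = \sum_(p : lt_pair) Q (val p).1 (val p).2 ^+ 2.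
Proof.
have Bo (p q : lt_pair) : p != q -> \int[P]_w (g (val p).1 w * g (val p).2 w *
    (g (val q).1 w * g (val q).2 w)) = 0.
  move=> pq; apply: pair_orth; rewrite ?(valP p) ?(valP q)//.
have [i1 e1] := Ex_orthogonal (fun p : lt_pair => Q (val p).1 (val p).2) Bi Bo; split => //.
by rewrite e1; apply: eq_bigr => p _; rewrite pair_diag ?mulr1// (valP p).
Qed.

Let quad_sqr : intg P (fun w => (sqnorm (grow w *m Q) - r%:R) ^+ 2) /\
  \int[P]_w (sqnorm (grow w *m Q) - r%:R) ^+ 2 <= 2 * k4 * r%:R.
Proof.
have mA : measurable_fun setT A.
  by apply: measurable_sum => a; apply: measurable_funM => //; exact: intg_measurable (sqi a).
have mB : measurable_fun setT B.
  apply: measurable_sum => p; apply: measurable_funM => //.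
  by apply: measurable_funM; exact: intg_measurable.
under eq_fun do rewrite quad.
have i2 : intg P (fun w => 2 * A w ^+ 2 + 8 * B w ^+ 2).
  by apply: intgD; apply: intgZ; [have [] := A2|have [] := B2].
have le w : (A w + 2 * B w) ^+ 2 <= 2 * A w ^+ 2 + 8 * B w ^+ 2.
  by have := sqr_ge0 (A w - 2 * B w); rewrite !expr2; lra.
have i1 : intg P (fun w => (A w + 2 * B w) ^+ 2).
  apply: intg_le i2 => [|w]; last by rewrite ger0_norm ?sqr_ge0.
  by apply: measurable_funX; apply: measurable_funD => //; exact: measurable_funM.
split => //; apply: le_trans (Ex_le i1 i2 le) _.
have [A2i A2e] := A2; have [B2i B2e] := B2.
rewrite ExD ?ExZ//; [|exact: intgZ|exact: intgZ].
rewrite B2e.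
(* The squared entries of a symmetric projection add up to its trace. *)
have -> : r%:R = \sum_a Q a a ^+ 2 + 2 * \sum_(p : lt_pair) Q (val p).1 (val p).2 ^+ 2.
  rewrite -(sum_sym (F := fun a b => Q a b ^+ 2)) => [|a b]; last by rewrite QT.
  case: Qr => QQ QTm <-; rewrite /mxtrace; apply: eq_bigr => a _.
  by rewrite -{1}QQ mxE; apply: eq_bigr => b _; rewrite [Q b a]QT expr2.
have : 0 <= \sum_(p : lt_pair) Q (val p).1 (val p).2 ^+ 2.
  by apply: sumr_ge0 => p _; exact: sqr_ge0.
by have := k41; nra.
Qed.

Let quad_mean : intg P (fun w => sqnorm (grow w *m Q) - r%:R) /\
  \int[P]_w (sqnorm (grow w *m Q) - r%:R) = 0.
Proof.
under eq_fun do rewrite quad.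
have Ai : intg P A by apply: intg_sum => a; exact: intgZ.
have pi (p : lt_pair) : intg P (fun w => g (val p).1 w * g (val p).2 w) /\
    \int[P]_w (g (val p).1 w * g (val p).2 w) = 0.
  have pp : (val p).1 != (val p).2 by rewrite -val_eqE ltn_eqF// (valP p).
  split; first exact: (indep_integrable indX (dJ pp) (@ga _) (@ga _) (gi _) (gi _)).
  by rewrite (indep_Rintegral indX (dJ pp) (@ga _) (@ga _) (gi _) (gi _)) g1 mul0r.
have Bi1 : intg P B by apply: intg_sum => p; apply: intgZ; have [] := pi p.
split; first by apply: intgD => //; exact: intgZ.
rewrite ExD//; last exact: intgZ.
rewrite ExZ// /A /B !Ex_sum; last 2 first.
- by move=> p; apply: intgZ; have [] := pi p.
- by move=> a; exact: intgZ.
rewrite !big1 ?mulr0 ?addr0// => [p _|a _]; last by rewrite ExZ// sq0 mulr0.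
by have [pi1 pi2] := pi p; rewrite ExZ// pi2 mulr0.
Qed.

(** Cantelli's one-sided inequality: variance at most [2 k4 r], deviation [r / 2], optimal shift
    [b = 4 k4]. Unlike Chebyshev's, the bound stays below 1 for every rank, which the last few rows
    need. *)
Lemma reject_prob : (0 < r)%N ->
  (P [set w | ~~ accepts Q (grow w)] <= (8 * k4 / (8 * k4 + r%:R))%:E)%E.
Proof.
move=> r0; have rr : (0 : R) < r%:R by rewrite ltr0n.
pose b := 4 * k4; pose c := r%:R / 2 + b.
have b0 : 0 < b by rewrite /b; have := k41; lra.
have c0 : 0 < c by rewrite /c; lra.
pose Y w := sqnorm (grow w *m Q) - r%:R.
have [Yi Y1] := quad_mean; have [Y2i Y2] := quad_sqr.
pose f w := c ^- 2 * (Y w ^+ 2 + (- (2 * b) * Y w + b ^+ 2)).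
have fE w : f w = c ^- 2 * (Y w - b) ^+ 2 by rewrite /f; congr (_ * _); ring.
have fi : intg P f.
  apply: intgZ; apply: intgD => //; apply: intgD; [exact: intgZ|exact: intg_cst].
have f0 w : 0 <= f w by rewrite fE mulr_ge0 ?sqr_ge0// invr_ge0 sqr_ge0.
have mrej : measurable [set w | ~~ accepts Q (grow w)].
  rewrite (_ : [set w | _] = ~` [set w | r%:R / 2 <= sqnorm (grow w *m Q)]).
    apply: measurableC; rewrite -[X in measurable X]setTI; apply: measurable_fun_le => //.
    have -> : (fun w => sqnorm (grow w *m Q)) = (fun w => Y w + r%:R).
      by apply/funext => w; rewrite /Y subrK.
    by apply: measurable_funD => //; exact: intg_measurable Yi.
  apply/seteqP; split => w /=; rewrite /accepts; case: Qr => _ _ ->; first by move/negP.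
  by move=> ?; apply/negP.
apply: le_trans (_ : P [set w | 1 <= f w]%R <= _)%E.
  apply: le_measure; rewrite ?inE//.
    rewrite -[X in measurable X]setTI; apply: measurable_fun_le => //; exact: intg_measurable fi.
  move=> w /=; rewrite /accepts -ltNge; case: Qr => _ _ -> h.
  rewrite fE mulrC ler_pdivlMr ?exprn_gt0// mul1r -[leRHS]sqrrN.
  by rewrite lerXn2r ?nnegrE ?(ltW c0)//; rewrite /Y /c; lra.
apply: le_trans (markov1 fi f0) _; rewrite lee_fin /f ExZ; last first.
  apply: intgD => //; apply: intgD; [exact: intgZ|exact: intg_cst].
rewrite ExD//; last by apply: intgD; [exact: intgZ|exact: intg_cst].
rewrite ExD; [|exact: intgZ|exact: intg_cst].
rewrite ExZ// Y1 mulr0 add0r Ex_cst mulrC ler_pdivrMr ?exprn_gt0//.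
apply: (@le_trans _ _ (2 * k4 * r%:R + b ^+ 2)); first by rewrite lerD2r.
rewrite le_eqVlt; apply/orP; left; apply/eqP; rewrite /c /b; field.
by rewrite gt_eqF//; have := k41; lra.
Qed.

End row_variance.

(** * Measurability of the greedy procedure *)

Section measurable_greedy.
Context {R : realType} {d : measure_display} {T : measurableType d}.
Variable n : nat.

Definition measurable_mx m p (M : T -> 'M[R]_(m, p)) :=
  forall i j, measurable_fun setT (fun t => M t i j).

Lemma measurable_mulmx m p q (M : T -> 'M[R]_(m, p)) (M' : T -> 'M[R]_(p, q)) :
  measurable_mx M -> measurable_mx M' -> measurable_mx (fun t => M t *m M' t).
Proof.
move=> mM mM' i j; under eq_fun do rewrite mxE.
by apply: measurable_sum => k; apply: measurable_funM; [exact: mM|exact: mM'].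
Qed.

Lemma measurable_sqnorm (r : T -> 'rV[R]_n) : measurable_mx r ->
  measurable_fun setT (fun t => sqnorm (r t)).
Proof. by move=> mr; apply: measurable_sum => j; apply: measurable_funX; exact: mr. Qed.

Lemma measurable_mxtrace (M : T -> 'M[R]_n) : measurable_mx M ->
  measurable_fun setT (fun t => \tr (M t)).
Proof. by move=> mM; apply: measurable_sum => j; exact: mM. Qed.

Lemma measurable_accepts (M : T -> 'M[R]_n) (r : T -> 'rV[R]_n) :
  measurable_mx M -> measurable_mx r ->
  measurable_fun setT (fun t => accepts (M t) (r t)).
Proof.
move=> mM mr; apply: measurable_fun_ler.
  by apply: measurable_funM => //; exact: measurable_mxtrace.
by apply: measurable_sqnorm; exact: measurable_mulmx.
Qed.

Lemma measurable_greedy_step (M : T -> 'M[R]_n) (r : T -> 'rV[R]_n) :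
  measurable_mx M -> measurable_mx r ->
  measurable_mx (fun t => greedy_step (M t) (r t)).
Proof.
move=> mM mr i j; have mu := measurable_mulmx mr mM.
have -> : (fun t => greedy_step (M t) (r t) i j) = (fun t => if accepts (M t) (r t)
    then M t i j - (sqnorm (r t *m M t)) `^ (-1) * ((r t *m M t) 0 i * (r t *m M t) 0 j)
    else M t i j).
  apply/funext => t; rewrite /greedy_step; case: ifP => // _.
  rewrite powR_inv1 ?sqnorm_ge0//; move: (r t *m M t) => u; rewrite !mxE big_ord1 !mxE.
  by [].
apply: measurable_fun_ifT; [exact: measurable_accepts| |exact: mM].
apply: measurable_funB; first exact: mM.
apply: measurable_funM; last by apply: measurable_funM; exact: mu.
apply: (@measurableT_comp _ _ _ _ _ _ (fun x => x `^ (-1))) => //.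
exact: measurable_sqnorm.
Qed.

End measurable_greedy.

(** * The exponential potential *)

Section potential.
Context {R : realType}.
Variables (ka : R).
Hypothesis ka0 : 0 < ka.

Let gam := (4 * ka + 4)^-1.
Let d0 := (Num.truncn (ka * expR (3 * gam) / gam)).+1.

Let gam0 : 0 < gam. Proof. by rewrite invr_gt0; have := ka0; lra. Qed.

(** A function of the remaining rank. Below [d0] rejection is only known to have probability at most
    [ka / (ka + 1)], so losing a rank has to halve the potential. Above [d0] rejection is rare and
    the ratio [exp (3 gam)] suffices, which keeps the starting value small. At rank 0 the value is
    0. *)
Definition potential (t : R) : R :=
  if t <= 0 then 0 else expR (ln 2 * Num.min t d0%:R + 3 * gam * Num.max (t - d0%:R) 0).

Lemma measurable_potential : measurable_fun setT potential.
Proof.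
apply: measurable_fun_ifT => //; first exact: measurable_fun_ler.
apply: measurableT_comp => //; apply: measurable_funD.
  by apply: measurable_funM => //; exact: measurable_minr.
apply: measurable_funM => //; apply: measurable_maxr => //; exact: measurable_funB.
Qed.

Lemma potential_ge0 t : 0 <= potential t.
Proof. by rewrite /potential; case: ifP => // _; exact: expR_ge0. Qed.

Lemma potential_ge1 t : 0 < t -> 1 <= potential t.
Proof.
move=> t0; rewrite /potential.
have -> : (t <= 0) = false by rewrite leNgt t0.
rewrite -[leLHS]expR0 ler_expR addr_ge0//.
  by rewrite mulr_ge0 ?ln_ge0 ?ler1n// le_min ltW//=.
by rewrite mulr_ge0 ?mulr_ge0 ?(ltW gam0)// le_max lexx orbT.
Qed.

Lemma potential_le m : potential m%:R <= expR (ln 2 * d0%:R + 3 * gam * m%:R).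
Proof.
rewrite /potential; case: ifP => [_|/negbT]; first exact: expR_ge0.
rewrite -ltNge => m0; rewrite ler_expR lerD//.
  by rewrite ler_wpM2l ?ln_ge0 ?ler1n// ge_min lexx orbT.
apply: ler_wpM2l; first by rewrite mulr_ge0// ltW.
by rewrite ge_max (ltW m0) andbT lerBlDr lerDl.
Qed.

(** Below [d0], [(1 - p) / 2 + p <= 1 - 2 gam] by the choice of [gam]. Above, [d0] is chosen so that
    [p exp (3 gam) <= gam], and the mean ratio is at most [exp (- 3 gam) (1 + gam)]. *)
Lemma potential_step (r : nat) (p : R) : (0 < r)%N -> 0 <= p <= ka / (ka + r%:R) ->
  (1 - p) * potential r.-1%:R + p * potential r%:R <= expR (- (2 * gam)) * potential r%:R.
Proof.
case: r => // r _ /andP[p0 pr]; rewrite [r.+1.-1]/=.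
have rr : (0 : R) < r.+1%:R by [].
set f := potential r.+1%:R; have f0 : 0 <= f by exact: potential_ge0.
have p1 : p <= 1.
  apply: le_trans pr _; rewrite ler_pdivrMr ?mul1r ?lerDl ?ltW//.
  by rewrite addr_gt0.
suff [b [b0 hb h]] : exists b, [/\ 0 <= b, potential r%:R <= b * f & (1 - p) * b + p <= expR (- (2 * gam))].
  apply: (@le_trans _ _ (((1 - p) * b + p) * f)); last by rewrite ler_wpM2r.
  by rewrite [leRHS]mulrDl lerD2r -(mulrA (1 - p)); apply: ler_wpM2l; rewrite ?subr_ge0.
have [rd|rd] := leqP r.+1 d0.
  exists (1 / 2); split => //.
    rewrite /f /potential [r.+1%:R <= 0]leNgt rr/=; case: ifP => [_|/negbT].
      by rewrite mulr_ge0// expR_ge0.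
    move=> _; have rd' : (r.+1%:R : R) <= d0%:R by rewrite ler_nat.
    have -> : 1 / 2 = expR (- ln 2) :> R by rewrite expRN lnK ?posrE// mul1r.
    rewrite -expRD ler_expR.
    have -> : Num.min r.+1%:R d0%:R = r.+1%:R :> R by apply/min_idPl.
    have -> : Num.max (r.+1%:R - d0%:R) 0 = 0 :> R by apply/max_idPr; rewrite subr_le0.
    have -> : Num.max (r%:R - d0%:R) 0 = 0 :> R.
      by apply/max_idPr; rewrite subr_le0 (le_trans _ rd')// ler_nat.
    have -> : Num.min r%:R d0%:R = r%:R :> R.
      by apply/min_idPl; rewrite (le_trans _ rd')// ler_nat.
    by rewrite -natr1; lra.
  have pr1 : p <= ka / (ka + 1).
    apply: le_trans pr _; rewrite ler_pM2l// lef_pV2 ?posrE ?lerD2l ?ler1n ?addr_gt0//.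
  apply: le_trans (expR_ge1Dx _).
  have e1 : 2 * gam = (1 - ka / (ka + 1)) / 2.
    by rewrite /gam; field; rewrite !gt_eqF//; have := ka0; lra.
  rewrite e1; lra.
exists (expR (- (3 * gam))); split; first exact: expR_ge0.
  rewrite /f /potential [r.+1%:R <= 0]leNgt rr/=; case: ifP => [_|/negbT].
    by rewrite mulr_ge0// expR_ge0.
  move=> _; have rd' : (d0%:R : R) <= r%:R by rewrite ler_nat.
  rewrite -expRD ler_expR.
  have -> : Num.min r.+1%:R d0%:R = d0%:R :> R.
    by apply/min_idPr; rewrite (le_trans rd')// ler_nat.
  have -> : Num.max (r.+1%:R - d0%:R) 0 = r.+1%:R - d0%:R :> R.
    by apply/max_idPl; rewrite subr_ge0 (le_trans rd')// ler_nat.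
  have -> : Num.max (r%:R - d0%:R) 0 = r%:R - d0%:R :> R.
    by apply/max_idPl; rewrite subr_ge0.
  have -> : Num.min r%:R d0%:R = d0%:R :> R by apply/min_idPr.
  by rewrite -natr1; lra.
have h1 : ka * expR (3 * gam) / gam <= r.+1%:R.
  apply: ltW; apply: lt_le_trans (truncnS_gt _) _.
  by rewrite ler_nat ltnW.
have h2 : p * expR (3 * gam) <= gam.
  apply: (@le_trans _ _ (ka / r.+1%:R * expR (3 * gam))).
    rewrite ler_wpM2r ?expR_ge0//; apply: le_trans pr _.
    by rewrite ler_pM2l// lef_pV2 ?posrE ?lerDr ?(ltW ka0)// addr_gt0.
  by move: h1; rewrite ler_pdivrMr// => h1; rewrite mulrAC ler_pdivrMr// [leRHS]mulrC.
have h3 : (1 - p) * expR (- (3 * gam)) + p <= expR (- (3 * gam)) * (1 + gam).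
  have e3 : 1 = expR (- (3 * gam)) * expR (3 * gam) by rewrite -expRD addNr expR0.
  have -> : (1 - p) * expR (- (3 * gam)) + p =
      expR (- (3 * gam)) * (1 - p + p * expR (3 * gam)).
    by rewrite mulrDr mulrCA -e3 mulr1 mulrC.
  by rewrite ler_wpM2l ?expR_ge0//; lra.
apply: le_trans h3 _.
have -> : - (2 * gam) = - (3 * gam) + gam by ring.
by rewrite expRD ler_wpM2l ?expR_ge0// expR_ge1Dx.
Qed.

End potential.

(** * Failure probability of the greedy procedure *)

Section greedy_probability.
Context {R : realType} {d : measure_display} {Omega : measurableType d}.
Variable P : probability Omega R.
Variables (n N : nat) (G : 'I_N -> 'I_n -> Omega -> R).
Hypothesis indG : mutually_independent P (fun ij : 'I_N * 'I_n => G ij.1 ij.2).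
Hypothesis gi : forall i j, intg P (G i j).
Hypothesis g2i : forall i j, intg P (fun w => G i j w ^+ 2).
Hypothesis g4i : forall i j, intg P (fun w => G i j w ^+ 4).
Hypothesis g1 : forall i j, \int[P]_w G i j w = 0.
Hypothesis g2 : forall i j, \int[P]_w G i j w ^+ 2 = 1.
Variable k4 : R.
Hypothesis k41 : 4 <= k4.
Hypothesis g4 : forall i j, \int[P]_w G i j w ^+ 4 <= k4.

Let ka := 8 * k4.
Let ka0 : 0 < ka. Proof. by rewrite /ka; have := k41; lra. Qed.
Let gam := (4 * ka + 4)^-1.
Local Notation pot := (potential ka).
Local Notation X := (fun ij : 'I_N * 'I_n => G ij.1 ij.2).

Definition rows w (k : nat) : 'rV[R]_n :=
  \row_j (if (insub k : option 'I_N) is Some i then G i j w else 0).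

Let past k : {set 'I_N * 'I_n} := [set ij : 'I_N * 'I_n | (ij.1 < k)%N]%SET.
Let present k : {set 'I_N * 'I_n} := [set ij : 'I_N * 'I_n | (ij.1 == k :> nat)%N]%SET.

Let dpast k : [disjoint past k & present k]%B.
Proof.
apply/pred0P => -[i j] /=; rewrite !finset.inE/=; case: ltngtP => //.
Qed.

Let rows_adapted k j : adapted X (present k) (fun w => rows w k 0 j).
Proof.
have -> : (fun w => rows w k 0 j) =
    (fun w => if (insub k : option 'I_N) is Some i then G i j w else 0).
  by apply/funext => w; rewrite mxE.
case: insubP => [i _ ik|_]; last exact: measurable_cst.
by apply: (@adapted_coord _ _ _ _ X _ (i, j)); rewrite finset.inE/= ik.
Qed.

Let greedy_adapted k i j : adapted X (past k) (fun w => greedy (rows w) k i j).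
Proof.
elim: k i j => [|k ih] i j; first exact: measurable_cst.
apply: (@measurable_greedy_step _ _ _ _ (fun w : coords X (past k.+1) => greedy (rows w) k)
  (fun w : coords X (past k.+1) => rows w k)).
- move=> {}i {}j; apply: (adapted_sub (J := past k)); last exact: ih.
  by apply/fintype.subsetP => ij; rewrite !finset.inE; exact: ltnW.
- move=> {}i {}j; rewrite (ord1 i); apply: (adapted_sub (J := present k)); last exact: rows_adapted.
  by apply/fintype.subsetP => ij; rewrite !finset.inE => /eqP ->.
Qed.

Let mgreedy k : measurable_mx (fun w => greedy (rows w) k).
Proof. by move=> i j; exact: (adapted_measurable indG (greedy_adapted (k := k) i j)). Qed.

Let mpot k : measurable_fun setT (fun w => pot (\tr (greedy (rows w) k))).
Proof.
apply: (@measurableT_comp _ _ _ _ _ _ pot); first exact: measurable_potential.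
by apply: measurable_mxtrace; exact: mgreedy.
Qed.

Let reject_row (i : 'I_N) (Q : 'M[R]_n) r : projection_rank Q r -> (0 < r)%N ->
  measurable [set w | ~~ accepts Q (rows w i)] /\
  (P [set w | ~~ accepts Q (rows w i)] <= (ka / (ka + r%:R))%:E)%E.
Proof.
move=> Qr r0.
have rE w : rows w i = \row_j G i j w.
  by apply/rowP => j; rewrite !mxE valK.
split; last first.
  under eq_fun do rewrite rE.
  apply: (@reject_prob _ _ _ P _ X indG _ (fun j => (i, j))) => //.
  by move=> j j' [].
have m1 : measurable_mx (fun _ : Omega => Q) by move=> a b; exact: measurable_cst.
have m2 : measurable_mx (fun w => rows w i).
  by move=> a b; rewrite (ord1 a); exact: (adapted_measurable indG (rows_adapted (k := i) b)).
have := measurable_accepts m1 m2 measurableT (Y := [set false]) I.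
rewrite setTI; congr measurable; apply/seteqP; split => w /=; first by move=> ->.
by move/negbTE.
Qed.

(** Decoupling freezes the matrix built from the rows before [k] and replaces row [k] by an
    independent copy, so the rejection bound applies to each fixed projection. *)
Let pot_step k : (k < N)%N ->
  (\int[P]_w (pot (\tr (greedy (rows w) k.+1)))%:E <=
   (expR (- (2 * gam)))%:E * \int[P]_w (pot (\tr (greedy (rows w) k)))%:E)%E.
Proof.
move=> kN.
pose F (z : coords X (past k) * coords X (present k)) : \bar R :=
  (pot (\tr (greedy_step (greedy (rows z.1) k) (rows z.2 k))))%:E.
have mF : measurable_fun setT F.
  apply/measurable_EFinP; apply: (@measurableT_comp _ _ _ _ _ _ pot).
    exact: measurable_potential.
  apply: measurable_mxtrace; apply: measurable_greedy_step => i j.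
    exact: (measurableT_comp (greedy_adapted (k := k) i j) measurable_fst).
  rewrite (ord1 i); exact: (measurableT_comp (rows_adapted (k := k) j) measurable_snd).
have F0 z : (0 <= F z)%E by rewrite lee_fin; exact: potential_ge0.
have -> : (\int[P]_w (pot (\tr (greedy (rows w) k.+1)))%:E = \int[P]_w F (w, w))%E by [].
rewrite (integral_decoupled indG (dpast k) mF F0).
rewrite -ge0_integralZl//; last 2 first.
- exact/measurable_EFinP/mpot.
- by move=> w _; rewrite lee_fin; exact: potential_ge0.
apply: ge0_le_integral => //.
- by move=> w _; apply: integral_ge0.
- exact: (measurable_decoupled indG mF F0).
- apply/measurable_EFinP/measurable_funM => //; exact: mpot.
move=> w _; rewrite /F/=; have [r rn Qr] := greedy_rank (rows w) k.
set Q := greedy (rows w) k in Qr *.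
have [r0|r0] := posnP r.
  have trQ : \tr Q = 0 by case: Qr => _ _ ->; rewrite r0.
  under eq_integral do rewrite (projection_rank_id Qr (or_introl r0)).
  by rewrite integral_cst// trQ /potential lexx mul0e mule0.
pose A := [set w' | ~~ accepts Q (rows w' k)].
have [mA PA] := reject_row (Ordinal kN) Qr r0.
rewrite -/A in mA PA.
have trQ : \tr Q = r%:R by case: Qr.
pose p := fine (P A).
have pE : P A = p%:E by rewrite fineK// fin_num_measure.
have p0 : 0 <= p <= ka / (ka + r%:R).
  by rewrite fine_ge0//= -lee_fin -pE.
rewrite trQ -EFinM; apply: le_trans (_ : ((1 - p) * pot r.-1%:R + p * pot r%:R)%:E <= _)%E; last first.
  by rewrite lee_fin; apply: potential_step.
rewrite (eq_integral (fun w' => (pot r.-1%:R)%:E * (\1_(~` A) w')%:E + (pot r%:R)%:E * (\1_A w')%:E)%E).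
  have i0 (B : set Omega) (a : R) w' : 0 <= a -> (0 <= a%:E * (\1_B w')%:E)%E.
    by move=> a0; rewrite -EFinM lee_fin mulr_ge0.
  have mi (B : set Omega) : measurable B -> measurable_fun setT (fun w' => (\1_B w' : R)%:E).
    by move=> mB; exact/measurable_EFinP.
  rewrite ge0_integralD//=; last 4 first.
  - by move=> w' _; apply: i0; exact: potential_ge0.
  - by apply: measurable_funeM; apply: mi; exact: measurableC.
  - by move=> w' _; apply: i0; exact: potential_ge0.
  - by apply: measurable_funeM; exact: mi.
  rewrite !ge0_integralZl//=; try by [rewrite lee_fin; exact: potential_ge0 |
    move=> w' _; rewrite lee_fin | exact: mi | apply: mi; exact: measurableC].
  rewrite !integral_indic//=; last exact: measurableC.
  by rewrite !setIT probability_setC// pE -EFinB -!EFinM -EFinD mulrC [pot r%:R * _]mulrC.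
move=> w' _; rewrite !indicE; have [nacc|acc] := boolP (~~ accepts Q (rows w' k)).
  rewrite (projection_rank_id Qr (or_intror nacc)) trQ.
  by rewrite memNset ?mule0 ?add0e//= mem_set// mule1.
have acc' : accepts Q (rows w' k) by rewrite negbK in acc.
have [_ _ ->] : projection_rank (greedy_step Q (rows w' k)) r.-1.
  by apply: projection_rank_step => //; rewrite prednK.
by rewrite mem_set ?mule1 ?memNset ?mule0 ?adde0//= => /negP.
Qed.

(** The starting potential is at most a constant times [exp (3 gam n)], and at least [2 n] rows each
    gain [exp (- 2 gam)]; what remains is [exp (- gam n)]. A potential below 1 forces rank 0. *)
Lemma greedy_fails : (2 * n <= N)%N ->
  exists B : set Omega, [/\ measurable B,
    (P B <= (expR (ln 2 * (Num.truncn (ka * expR (3 * gam) / gam)).+1%:R - gam * n%:R))%:E)%E &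
    forall w, ~ B w -> greedy (rows w) N = 0].
Proof.
move=> nN.
have H k : (k <= N)%N -> (\int[P]_w (pot (\tr (greedy (rows w) k)))%:E <=
    (expR (- (2 * gam)) ^+ k * pot n%:R)%:E)%E.
  elim: k => [_|k ih kN].
    rewrite expr0 mul1r /=; under eq_integral do rewrite mxtrace1.
    by rewrite integral_cst//= probability_setT mule1.
  apply: le_trans (pot_step kN) _; rewrite exprS -mulrA EFinM.
  by apply: lee_wpmul2l; [rewrite lee_fin expR_ge0|exact: ih (ltnW kN)].
exists [set w | 1 <= pot (\tr (greedy (rows w) N))]; split.
- rewrite -[X in measurable X]setTI; apply: measurable_fun_le => //; exact: mpot.
- have := ge0_markov1 P (@mpot N) (fun w => potential_ge0 ka _).
  move=> /le_trans; apply.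
  apply: le_trans (H N (leqnn N)) _; rewrite lee_fin.
  apply: (@le_trans _ _ (expR (- (2 * gam) * (2 * n%:R)) * expR (ln 2 * (Num.truncn (ka * expR (3 * gam) / gam)).+1%:R + 3 * gam * n%:R))).
    apply: ler_pM; [by rewrite exprn_ge0// expR_ge0|exact: potential_ge0| |exact: potential_le].
    rewrite -expRM_natr ler_expR !mulNr lerN2 ler_wpM2l//.
      by rewrite mulr_ge0// invr_ge0; have := ka0; lra.
    by rewrite -natrM ler_nat.
  rewrite -expRD ler_expR; lra.
- move=> w /negP; rewrite -ltNge => h.
  have [r rn Qr] := greedy_rank (rows w) N.
  apply: projection_rank0; move: Qr; case: r {rn} => // r Qr.
  move: h; rewrite ltNge potential_ge1//; by case: Qr => _ _ ->.
Qed.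

End greedy_probability.

(** * Dilated hulls and successive approximation *)

Section norm_hull.
Context {R : realType}.

Definition nrm m (x : 'rV[R]_m) : R := Num.sqrt (sqnorm x).

Lemma nrm_ge0 m (x : 'rV[R]_m) : 0 <= nrm x.
Proof. exact: sqrtr_ge0. Qed.

Lemma nrm_sqr m (x : 'rV[R]_m) : nrm x ^+ 2 = sqnorm x.
Proof. by rewrite sqr_sqrtr// sqnorm_ge0. Qed.

Lemma nrmZ m s (x : 'rV[R]_m) : nrm (s *: x) = `|s| * nrm x.
Proof. by rewrite /nrm sqnormZ sqrtrM ?sqr_ge0// sqrtr_sqr. Qed.

Lemma nrm_eq0 m (x : 'rV[R]_m) : nrm x = 0 -> x = 0.
Proof.
move=> x0; have : sqnorm x = 0 by rewrite -nrm_sqr x0 expr0n.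
move=> /(psumr_eq0P (fun j _ => sqr_ge0 (x 0 j))) h.
by apply/rowP => j; rewrite mxE; apply/eqP; rewrite -sqrf_eq0 h.
Qed.

Lemma dotp_le m (x y : 'rV[R]_m) : dotp x y <= nrm x * nrm y.
Proof.
have [x0|x0] := eqVneq (nrm x) 0.
  rewrite x0 mul0r (nrm_eq0 x0) /dotp big1// => j _; by rewrite mxE mul0r.
have [y0|y0] := eqVneq (nrm y) 0.
  rewrite y0 mulr0 (nrm_eq0 y0) /dotp big1// => j _; by rewrite mxE mulr0.
have xy : 0 < nrm x * nrm y by rewrite mulr_gt0// lt_def nrm_ge0 andbT.
have := sqnorm_ge0 (nrm y *: x + (- nrm x) *: y).
rewrite sqnormD !sqnormZ dotpZl dotpZr -!nrm_sqr sqrrN => h.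
rewrite -(ler_pM2l xy); move: h; rewrite !expr2; lra.
Qed.

Lemma nrmD m (x y : 'rV[R]_m) : nrm (x + y) <= nrm x + nrm y.
Proof.
rewrite -(@ler_pXn2r _ 2)// ?nnegrE ?addr_ge0 ?nrm_ge0//.
rewrite nrm_sqr sqnormD -!nrm_sqr sqrrD; have := dotp_le x y; lra.
Qed.

Lemma nrmN m (x : 'rV[R]_m) : nrm (- x) = nrm x.
Proof. by rewrite -scaleN1r nrmZ normrN1 mul1r. Qed.

Variables (n N : nat) (v : 'I_N -> 'rV[R]_n).

(** For [s >= 0] and [N > 0], the dilate by [s] of the symmetric hull; signed coefficients make sums
    and multiples immediate. *)
Definition shull (s : R) : set 'rV[R]_n :=
  [set x | exists2 c : 'I_N -> R, \sum_i `|c i| <= s & x = \sum_i c i *: v i].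

Lemma shull_le s s' : s <= s' -> shull s `<=` shull s'.
Proof. by move=> ss x [c cs ->]; exists c => //; exact: le_trans ss. Qed.

Lemma shullD s s' x y : shull s x -> shull s' y -> shull (s + s') (x + y).
Proof.
move=> [c cs ->] [c' cs' ->]; exists (fun i => c i + c' i).
  apply: le_trans (lerD cs cs'); rewrite -big_split/=; apply: ler_sum => i _.
  exact: ler_normD.
by rewrite -big_split/=; apply: eq_bigr => i _; rewrite scalerDl.
Qed.

Lemma shullZ s k x : shull s x -> shull (`|k| * s) (k *: x).
Proof.
move=> [c cs ->]; exists (fun i => k * c i).
  under eq_bigr do rewrite normrM.
  by rewrite -mulr_sumr ler_wpM2l.
by rewrite scaler_sumr; apply: eq_bigr => i _; rewrite scalerA.
Qed.

Lemma shull_sym_conv_hull x : (0 < N)%N -> shull 1 x -> sym_conv_hull v x.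
Proof.
move=> N0 [c cs ->]; pose i0 := Ordinal N0.
pose e := (1 - \sum_i `|c i|) / 2; have e0 : 0 <= e by rewrite divr_ge0// subr_ge0.
pose p i := Num.max (c i) 0 + e *+ (i == i0).
pose p' i := Num.max (- c i) 0 + e *+ (i == i0).
have pp i : Num.max (c i) 0 - Num.max (- c i) 0 = c i /\
    Num.max (c i) 0 + Num.max (- c i) 0 = `|c i|.
  have [ci|ci] := leP 0 (c i).
    have -> : Num.max (- c i) 0 = 0 by apply/max_idPr; rewrite oppr_le0.
    by rewrite subr0 addr0 ger0_norm.
  have -> : Num.max (- c i) 0 = - c i by apply/max_idPl; rewrite oppr_ge0 ltW.
  by rewrite sub0r opprK add0r ltr0_norm.
exists p, p'; split; first by move=> i; rewrite addr_ge0 ?mulrn_wge0// le_max lexx orbT.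
split; first by move=> i; rewrite addr_ge0 ?mulrn_wge0// le_max lexx orbT.
split; last by apply: eq_bigr => i _; congr (_ *: _); rewrite -[LHS](pp i).1 /p /p'; ring.
transitivity (\sum_i (`|c i| + (e *+ (i == i0) + e *+ (i == i0)))).
  by apply: eq_bigr => i _; rewrite -(pp i).2 /p /p'; ring.
have ei : \sum_i e *+ (i == i0) = e by rewrite (bigD1 i0)//= big1 ?addr0 // => i /negbTE->.
by rewrite !big_split/= ei /e; field.
Qed.

(** Induction on the number of leading coordinates allowed to differ from [1] and [-1]: a point is a
    convex combination of the two obtained by setting one coordinate to these values. *)
Lemma cube_shull s (r : R) : 0 <= s ->
    (forall e : 'I_n -> bool, shull s (r *: \row_j (-1) ^+ e j)) ->
  forall x : 'rV[R]_n, (forall j, `|x 0 j| <= 1) -> shull s (r *: x).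
Proof.
move=> s0 vert.
suff H k : forall x : 'rV[R]_n, (forall j, `|x 0 j| <= 1) ->
    (forall j : 'I_n, (k <= j)%N -> exists b : bool, x 0 j = (-1) ^+ b) -> shull s (r *: x).
  by move=> x x1; apply: (H n) => // j; rewrite leqNgt ltn_ord.
elim: k => [|k ih] x x1 xk.
  have /choice[e eE] : forall j, exists b : bool, x 0 j = (-1) ^+ b by move=> j; exact: xk.
  by have := vert e; congr (shull s (r *: _)); apply/rowP => j; rewrite mxE -eE.
have [kn|kn] := ltnP k n; last first.
  by apply: ih => // j; rewrite leqNgt (leq_trans (ltn_ord j)).
pose k' := Ordinal kn.
pose y (b : bool) : 'rV[R]_n := \row_j (if j == k' then (-1) ^+ b else x 0 j).
have yP b : shull s (r *: y b).
  apply: ih => j; first by rewrite mxE; case: ifP => // _; rewrite normr_sign.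
  rewrite mxE; have [->|jk] := eqVneq j k'; first by move=> _; exists b.
  by rewrite leq_eqVlt => /orP[/eqP kj|]; [case/eqP: jk; apply: val_inj|exact: xk].
have := x1 k'; rewrite ler_norml => /andP[h1 h2].
have -> : r *: x = ((1 + x 0 k') / 2) *: (r *: y false) + ((1 - x 0 k') / 2) *: (r *: y true).
  rewrite !scalerA !(mulrC _ r) -!scalerA -scalerDr; congr (_ *: _).
  by apply/rowP => j; rewrite !mxE; case: eqP => [->|_]; rewrite ?expr0 ?expr1; field.
apply: shull_le (shullD (shullZ _ (yP false)) (shullZ _ (yP true))).
rewrite !ger0_norm; [|lra|lra].
by lra.
Qed.

Variable c : R.
Hypothesis c0 : 0 < c.
Hypothesis net_near : forall z, @netP n z ->
  exists2 a, shull 2 a & nrm (c *: netv z - a) <= c / 4.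

Let orth_zero (u : 'rV[R]_n) : (forall i, dotp u (v i) = 0) -> u = 0.
Proof.
move=> uv; have [z zP uz] := net_norm u; have [a [k _ aE] ca] := net_near zP.
have ua : dotp u a = 0.
  rewrite aE; elim/big_ind: _ => [|x y ux uy|i _].
  - by rewrite /dotp big1// => j _; rewrite mxE mulr0.
  - by rewrite dotpDr ux uy addr0.
  - by rewrite dotpZr uv mulr0.
have h : dotp u (c *: netv z - a) <= nrm u * (c / 4).
  by apply: le_trans (dotp_le _ _) _; rewrite ler_wpM2l ?nrm_ge0.
move: h; rewrite dotpDr dotpZr -scaleN1r dotpZr ua mulr0 addr0 => h.
apply: nrm_eq0; apply/eqP; rewrite eq_le nrm_ge0 andbT.
have : c * nrm u <= c * (2 * dotp u (netv z)) by rewrite ler_pM2l.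
by move=> h'; rewrite -(pmulr_rle0 _ c0); lra.
Qed.

(** The [v i] span, so some finite dilate contains the ball. Its size is irrelevant: it only starts
    the iteration in [ball_shull]. *)
Let span_shull : exists2 s, 0 <= s & forall y : 'rV[R]_n, nrm y <= 1 -> shull s (c *: y).
Proof.
pose V : 'M[R]_(N, n) := \matrix_i v i.
have Vfull : row_full V.
  rewrite /row_full -mxrank_tr -/(row_free V^T) -kermx_eq0; apply/eqP/row_matrixP => i.
  rewrite row0; apply: orth_zero => k.
  have : row i (kermx V^T) *m V^T = 0 by rewrite -row_mul mulmx_ker row0.
  move=> /rowP/(_ k); rewrite !mxE => <-; apply: eq_bigr => j _.
  by rewrite !mxE.
pose D := pinvmx V; have DV : D *m V = 1%:M.
  by apply: mulVpmx.
exists (\sum_i \sum_j c * `|D j i|).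
  by do 2 apply: sumr_ge0 => ? _; rewrite mulr_ge0// ltW.
move=> y y1; exists (fun i => \sum_j c * y 0 j * D j i).
  apply: ler_sum => i _; apply: le_trans (ler_norm_sum _ _ _) _; apply: ler_sum => j _.
  rewrite !normrM gtr0_norm// ler_wpM2r// ler_piMr ?(ltW c0)//.
  rewrite -(@ler_pXn2r _ 2)// ?nnegrE// expr1n real_normK ?num_real//.
  apply: (@le_trans _ _ (sqnorm y)).
    by rewrite /sqnorm (bigD1 j)//= lerDl sumr_ge0// => k _; exact: sqr_ge0.
  by rewrite -nrm_sqr expr_le1// nrm_ge0.
rewrite -[y in LHS]mulmx1 -DV mulmxA; apply/rowP => k; rewrite !mxE summxE mulr_sumr.
apply: eq_bigr => i _; rewrite !mxE mulr_suml mulr_sumr mulr_suml; apply: eq_bigr => j _; ring.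
Qed.

(** A net point plus its approximation leave an error of at most [1/2 + 1/4], so a dilation factor
    [t] improves to [2 + 3/4 t]. The fixed point is 8, and finitely many steps from a finite start
    reach 9 without a limit. *)
Lemma ball_shull (y : 'rV[R]_n) : nrm y <= 1 -> shull 9 (c *: y).
Proof.
have [s s0 hs] := span_shull.
have step t : 0 <= t -> (forall y : 'rV[R]_n, nrm y <= 1 -> shull t (c *: y)) ->
    forall y : 'rV[R]_n, nrm y <= 1 -> shull (2 + 3 / 4 * t) (c *: y).
  move=> t0 ht {}y y1.
  have [|z zP yz] := net_cover (y := y); first by rewrite -nrm_sqr expr_le1// nrm_ge0.
  have [a a2 ca] := net_near zP.
  pose y' := y - c^-1 *: a.
  have y'34 : nrm y' <= 3 / 4.
    have -> : y' = (y - netv z) + c^-1 *: (c *: netv z - a).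
      by rewrite scalerBr scalerA mulVf ?gt_eqF// scale1r addrA subrK.
    apply: le_trans (nrmD _ _) _; rewrite nrmZ gtr0_norm ?invr_gt0//.
    have : nrm (y - netv z) <= 1 / 2.
      rewrite -(@ler_pXn2r _ 2)// ?nnegrE ?nrm_ge0// ?divr_ge0// nrm_sqr.
      by rewrite expr_div_n expr1n (_ : 2 ^+ 2 = 4)//; ring.
    have : c^-1 * nrm (c *: netv z - a) <= 1 / 4.
      by rewrite ler_pdivrMl//; lra.
    lra.
  have -> : c *: y = a + (3 / 4) *: (c *: ((4 / 3) *: y')).
    have -> : (3 / 4) *: (c *: ((4 / 3) *: y')) = c *: y'.
      by rewrite !scalerA; congr (_ *: _); field.
    by rewrite scalerBr scalerA mulfV ?gt_eqF// scale1r addrC subrK.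
  apply: shullD => //; rewrite -[in X in shull X _](@ger0_norm _ (3 / 4)); last lra.
  apply: shullZ; apply: ht; rewrite nrmZ ger0_norm; lra.
have iterS k : forall y : 'rV[R]_n, nrm y <= 1 -> shull (8 + (3 / 4) ^+ k * s) (c *: y).
  elim: k => [|k ih] {}y y1.
    by apply: (@shull_le s); [rewrite expr0; lra|exact: hs].
  have e0 : 0 <= (3 / 4) ^+ k * s by rewrite mulr_ge0// exprn_ge0// divr_ge0.
  apply: (@shull_le (2 + 3 / 4 * (8 + (3 / 4) ^+ k * s))); last by apply: step => //; lra.
  by rewrite exprS; lra.
have [k ks] : exists k, (3 / 4) ^+ k * s <= 1.
  have h34 : `|3 / 4 : R| < 1 by rewrite ger0_norm; lra.
  have := cvg_expr h34 => /cvgr0Pnorm_le/(_ (s + 1)^-1).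
  have s1 : 0 < s + 1 by lra.
  rewrite invr_gt0 s1 => /(_ isT)[k _ /(_ k (leqnn k))] /= hk; exists k.
  move: hk; rewrite ger0_norm ?exprn_ge0 ?divr_ge0// => hk.
  have := ler_wpM2r s0 hk; move/le_trans; apply.
  by rewrite mulrC ler_pdivrMr//; lra.
by move=> y1; apply: shull_le (iterS k _ y1); lra.
Qed.

(** The error [c / 4] costs a dilate of [9 / 4], and [2 + 9 / 4 <= 5]. *)
Lemma vertex_shull x : (exists2 a, shull 2 a & nrm (x - a) <= c / 4) -> shull 5 x.
Proof.
move=> [a a2 xa].
have -> : x = a + (1 / 4) *: (c *: ((4 / c) *: (x - a))).
  have -> : (1 / 4) *: (c *: ((4 / c) *: (x - a))) = x - a.
    by rewrite !scalerA -[RHS]scale1r; congr (_ *: _); field; rewrite gt_eqF.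
  by rewrite addrC subrK.
apply: (@shull_le (2 + `|1 / 4| * 9)); first by rewrite ger0_norm; lra.
apply: shullD => //; apply: shullZ; apply: ball_shull.
rewrite nrmZ ger0_norm; last by rewrite divr_ge0// ltW.
by rewrite mulrAC ler_pdivrMr//; lra.
Qed.

End norm_hull.

(** * Tilted weights and their concentration *)

Section tilting.
Context {R : realType} {d : measure_display} {Omega : measurableType d}.
Variable P : probability Omega R.
Variables (n N : nat) (G : 'I_N -> 'I_n -> Omega -> R).
Hypothesis indG : mutually_independent P (fun ij : 'I_N * 'I_n => G ij.1 ij.2).
Hypothesis gi : forall i j, intg P (G i j).
Hypothesis g2i : forall i j, intg P (fun w => G i j w ^+ 2).
Hypothesis g1 : forall i j, \int[P]_w G i j w = 0.
Hypothesis g2 : forall i j, \int[P]_w G i j w ^+ 2 = 1.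
Variable k1 : R.
Hypothesis k10 : 0 < k1.
Hypothesis mgf : forall i j s, intg P (fun w => expR (s * G i j w)) /\
  \int[P]_w expR (s * G i j w) <= expR (k1 * s ^+ 2).
Variables (phi : 'I_N -> 'I_n -> R -> R) (bb : R).
Hypothesis bb0 : 0 < bb.
Hypothesis mphi : forall i j, measurable_fun setT (phi i j).
Hypothesis phi_le : forall i j y, `|phi i j y| <= bb.
Hypothesis phi0 : forall i j, \int[P]_w phi i j (G i j w) = 0.
Hypothesis phi1 : forall i j, \int[P]_w (phi i j (G i j w) * G i j w) = 1.

Local Notation X := (fun ij : 'I_N * 'I_n => G ij.1 ij.2).

Definition row_coords i : {set 'I_N * 'I_n} := [set ij : 'I_N * 'I_n | ij.1 == i]%SET.

Lemma disjoint_row_coords i k : i != k -> [disjoint row_coords i & row_coords k]%B.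
Proof.
move=> ik; apply/pred0P => ij /=; rewrite !finset.inE; apply/negP => /andP[/eqP e1 /eqP e2].
by move: ik; rewrite -e1 -e2 eqxx.
Qed.

Let single i j (f : R -> R) : measurable_fun setT f ->
  adapted X [set (i, j)]%SET (fun w => f (G i j w)).
Proof.
move=> mf; apply: (measurableT_comp mf).
by apply: (@adapted_coord _ _ _ _ X _ (i, j)); rewrite finset.inE.
Qed.

Let single_row i j (f : Omega -> R) :
  adapted X [set (i, j)]%SET f -> adapted X (row_coords i) f.
Proof. by apply: adapted_sub; rewrite finset.sub1set finset.inE. Qed.

Let mG i j : measurable_fun setT (G i j).
Proof. exact: intg_measurable (gi i j). Qed.

Let dcell (i : 'I_N) (j l : 'I_n) : j != l -> [disjoint [set (i, j)]%SET & [set (i, l)]%SET]%B.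
Proof. by move=> jl; rewrite finset.disjoints1 finset.inE xpair_eqE eqxx. Qed.

Let cell_prod i (f : 'I_n -> R -> R) : (forall j, measurable_fun setT (f j)) ->
    (forall j, intg P (fun w => f j (G i j w))) ->
  intg P (fun w => \prod_j f j (G i j w)) /\
  \int[P]_w (\prod_j f j (G i j w)) = \prod_j \int[P]_w f j (G i j w).
Proof. by move=> mf fi; apply: (indep_prod indG (@dcell i)) => // j; exact: single. Qed.

Section direction.
Variable m : 'rV[R]_n.
Hypothesis m1 : sqnorm m <= 1.

Let Y i w := dotp (\row_j G i j w) m.

Let YE i w : Y i w = \sum_j m 0 j * G i j w.
Proof. by apply: eq_bigr => j _; rewrite mxE mulrC. Qed.

Let Y2 i : intg P (fun w => Y i w ^+ 2) /\ \int[P]_w Y i w ^+ 2 <= 1.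
Proof.
have [||h1 h2] := @Ex_orthogonal _ _ _ P 'I_n (G i) (fun j => m 0 j).
- move=> j l; have [->|jl] := eqVneq j l.
    by rewrite (_ : (fun w => _) = (fun w => G i l w ^+ 2))//; apply/funext => w; rewrite expr2.
  apply: (indep_integrable indG (dcell i jl)); [exact: (@single i j id)|exact: (@single i l id)| |]; exact: gi.
- move=> j l jl; rewrite (indep_Rintegral indG (dcell i jl)) ?g1 ?mul0r//.
  + exact: (@single i j id).
  + exact: (@single i l id).
  + exact: gi.
  + exact: gi.
have YY : (fun w => Y i w ^+ 2) = (fun w => (\sum_j m 0 j * G i j w) ^+ 2).
  by apply/funext => w; rewrite YE.
rewrite YY; split => //; rewrite h2 (eq_bigr (fun j => m 0 j ^+ 2)) => [//|j _].
rewrite -[RHS]mulr1 -(g2 i j); congr (_ * _).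
Qed.

Let Ymgf i s : intg P (fun w => expR (s * Y i w)) /\
  \int[P]_w expR (s * Y i w) <= expR (k1 * s ^+ 2).
Proof.
have E : (fun w => expR (s * Y i w)) = (fun w => \prod_j expR (s * m 0 j * G i j w)).
  apply/funext => w; rewrite YE mulr_sumr expR_sum; apply: eq_bigr => j _.
  by rewrite mulrA.
have [h1 h2] := @cell_prod i (fun j y => expR (s * m 0 j * y))
  (fun j => measurableT_comp (@measurable_expR _) (measurable_funM (measurable_cst _) (@measurable_id _ _ _)))
  (fun j => (mgf i j (s * m 0 j)).1).
rewrite E; split => //; rewrite h2.
apply: (@le_trans _ _ (\prod_j expR (k1 * (s * m 0 j) ^+ 2))).
  apply: ler_prod => j _; rewrite (mgf _ _ _).2 andbT.
  by apply: Rintegral_ge0 => w _; exact: expR_ge0.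
rewrite -expR_sum ler_expR; under eq_bigr do rewrite exprMn mulrA.
by rewrite -mulr_sumr ler_piMr// mulr_ge0 ?sqr_ge0// ltW.
Qed.

Let mY i : measurable_fun setT (Y i).
Proof.
rewrite (_ : Y i = (fun w => \sum_j m 0 j * G i j w)); last by apply/funext => w; rewrite YE.
by apply: measurable_sum => j; exact: measurable_funM.
Qed.

(** [y^2 exp |y| <= 4 exp (2 |y|) <= 4 (exp (2 y) + exp (- 2 y))], then the generating function at
    [2] and [-2]. *)
Let Yexp i : intg P (fun w => Y i w ^+ 2 * expR `|Y i w|) /\
  \int[P]_w (Y i w ^+ 2 * expR `|Y i w|) <= 8 * expR (4 * k1).
Proof.
pose h w := 4 * (expR (2 * Y i w) + expR (- 2 * Y i w)).
have hi : intg P h.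
  by apply: intgZ; apply: intgD; exact: (Ymgf _ _).1.
have le w : Y i w ^+ 2 * expR `|Y i w| <= h w.
  apply: (@le_trans _ _ (4 * (expR `|Y i w| * expR `|Y i w|))).
    by rewrite mulrA ler_wpM2r ?expR_ge0// sqr_le_expR.
  rewrite /h ler_wpM2l// -expRD.
  have [y0|y0] := leP 0 (Y i w).
    rewrite ger0_norm//; have -> : Y i w + Y i w = 2 * Y i w by ring.
    by rewrite lerDl expR_ge0.
  rewrite ltr0_norm//; have -> : - Y i w + - Y i w = -2 * Y i w by ring.
  by rewrite lerDr expR_ge0.
have ge w : 0 <= Y i w ^+ 2 * expR `|Y i w| by rewrite mulr_ge0 ?sqr_ge0 ?expR_ge0.
have i1 : intg P (fun w => Y i w ^+ 2 * expR `|Y i w|).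
  apply: intg_le hi => [|w]; last by rewrite ger0_norm.
  apply: measurable_funM; first exact: measurable_funX.
  by apply: measurableT_comp => //; exact: measurableT_comp.
split => //; apply: le_trans (Ex_le i1 hi le) _.
rewrite ExZ; last by apply: intgD; exact: (Ymgf _ _).1.
rewrite ExD; [|exact: (Ymgf _ _).1|exact: (Ymgf _ _).1].
have := (Ymgf i 2).2; have := (Ymgf i (-2)).2; rewrite sqrrN.
have -> : k1 * 2 ^+ 2 = 4 * k1 by ring.
lra.
Qed.

Section weights.
Variables (x : 'rV[R]_n) (tau : R).
Hypothesis xb : forall j, `|x 0 j| * bb <= 1 / 2.
Hypothesis tau1 : 1 <= tau.
Hypothesis x2 : 9 * bb ^+ 2 * sqnorm x <= 2 * ln tau.

Let tau0 : 0 < tau. Proof. exact: lt_le_trans tau1. Qed.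

Let u i j w := x 0 j * phi i j (G i j w).
Definition tilt i w := \prod_j (1 + x 0 j * phi i j (G i j w)).
Local Notation W := tilt.
Definition tilt_trunc i w := if W i w <= tau ^+ 2 then W i w else 0.
Local Notation W' := tilt_trunc.

Let u_le i j w : `|u i j w| <= 1 / 2.
Proof. by apply: le_trans (xb j); rewrite normrM ler_wpM2l. Qed.

Let factor_gt0 i j w : 0 < 1 + x 0 j * phi i j (G i j w).
Proof. by have := u_le i j w; rewrite /u ler_norml => /andP[]; lra. Qed.

Let W0 i w : 0 < W i w.
Proof. by apply: prodr_gt0 => j _. Qed.

Let phi_i i j : intg P (fun w => phi i j (G i j w)).
Proof.
apply: (intg_le _ _ (intg_cst P bb)) => [|w]; last exact: phi_le.
exact: measurableT_comp.
Qed.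

Let W1 i : intg P (W i) /\ \int[P]_w W i w = 1.
Proof.
have fi j : intg P (fun w => 1 + x 0 j * phi i j (G i j w)).
  by apply: intgD; [exact: intg_cst|exact: intgZ].
have [h1 h2] := @cell_prod i (fun j y => 1 + x 0 j * phi i j y)
  (fun j => measurable_funD (measurable_cst _) (measurable_funM (measurable_cst _) (mphi i j))) fi.
split => //; rewrite /W h2; apply: big1 => j _.
rewrite ExD; [|exact: intg_cst|exact: intgZ].
by rewrite Ex_cst ExZ// phi0 mulr0 addr0.
Qed.

(** For [|t| <= 1/2], [(1 + t)^4 <= 1 + 4 t + 9 t^2]; the linear term has mean 0, and the product is
    at most [exp (9 bb^2 |x|^2)]. *)
Let W4 i : intg P (fun w => W i w ^+ 4) /\ \int[P]_w W i w ^+ 4 <= tau ^+ 2.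
Proof.
have mf j : measurable_fun setT (fun y => (1 + x 0 j * phi i j y) ^+ 4).
  apply: measurable_funX; apply: measurable_funD => //; exact: measurable_funM.
have E : (fun w => W i w ^+ 4) = (fun w => \prod_j (1 + x 0 j * phi i j (G i j w)) ^+ 4).
  by apply/funext => w; rewrite -prodrXl.
have le j w : (1 + x 0 j * phi i j (G i j w)) ^+ 4 <=
    1 + (4 * x 0 j) * phi i j (G i j w) + 9 * bb ^+ 2 * x 0 j ^+ 2.
  have := u_le i j w; rewrite /u; set y := phi i j _; rewrite ler_norml => /andP[h1 h2].
  have : (1 + x 0 j * y) ^+ 4 <= 1 + 4 * (x 0 j * y) + 9 * (x 0 j * y) ^+ 2.
    move: h1 h2; set t := x 0 j * y => h1 h2.
    have : 0 <= t ^+ 2 * (3 - 4 * t - t ^+ 2).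
      by rewrite mulr_ge0 ?sqr_ge0// expr2; nra.
    have -> : (1 + t) ^+ 4 = 1 + 4 * t + 6 * t ^+ 2 + 4 * t ^+ 3 + t ^+ 4 by ring.
    have -> : t ^+ 3 = t * t ^+ 2 by ring.
    have -> : t ^+ 4 = t ^+ 2 * t ^+ 2 by ring.
    lra.
  have : (x 0 j * y) ^+ 2 <= bb ^+ 2 * x 0 j ^+ 2.
    rewrite exprMn mulrC ler_wpM2r ?sqr_ge0// -(real_normK (num_real y)).
    by rewrite lerXn2r ?nnegrE ?(ltW bb0)//; exact: phi_le.
  lra.
have i4 j : intg P (fun w => 1 + (4 * x 0 j) * phi i j (G i j w) + 9 * bb ^+ 2 * x 0 j ^+ 2).
  by apply: intgD; [apply: intgD; [exact: intg_cst|exact: intgZ]|exact: intg_cst].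
have pos j w : 0 <= (1 + x 0 j * phi i j (G i j w)) ^+ 4 by rewrite exprn_ge0// ltW.
have fi j : intg P (fun w => (1 + x 0 j * phi i j (G i j w)) ^+ 4).
  apply: intg_le (i4 j) => [|w]; last by rewrite ger0_norm.
  exact: (measurableT_comp (mf j) (mG i j)).
have [h1 h2] := @cell_prod i (fun j y => (1 + x 0 j * phi i j y) ^+ 4) mf fi.
rewrite E; split => //; rewrite h2.
apply: (@le_trans _ _ (\prod_j expR (9 * bb ^+ 2 * x 0 j ^+ 2))).
  apply: ler_prod => j _; apply/andP; split; first by apply: Rintegral_ge0 => w _.
  apply: le_trans (Ex_le (fi j) (i4 j) (le j)) _.
  rewrite ExD; [|by apply: intgD; [exact: intg_cst|exact: intgZ]|exact: intg_cst].
  rewrite ExD; [|exact: intg_cst|exact: intgZ].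
  by rewrite !Ex_cst ExZ// phi0 mulr0 addr0 expR_ge1Dx.
rewrite -expR_sum -mulr_sumr -/(sqnorm x).
apply: (@le_trans _ _ (expR (2 * ln tau))); first by rewrite ler_expR.
by rewrite expRM_natl lnK// posrE.
Qed.

Let WG i l : intg P (fun w => W i w * G i l w) /\ \int[P]_w (W i w * G i l w) = x 0 l.
Proof.
pose f j y := (1 + x 0 j * phi i j y) * y ^+ (j == l).
have mf j : measurable_fun setT (f j).
  apply: measurable_funM; last exact: measurable_funX.
  by apply: measurable_funD => //; exact: measurable_funM.
have E : (fun w => W i w * G i l w) = (fun w => \prod_j f j (G i j w)).
  apply/funext => w; rewrite /f big_split/=; congr (_ * _).
  by rewrite (bigD1 l)//= eqxx expr1 big1 ?mulr1// => j /negbTE ->; rewrite expr0.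
have phiG j : intg P (fun w => phi i j (G i j w) * G i j w).
  apply: (intg_le _ _ (intgZ bb (intgD (intg_cst P 1) (g2i i j)))).
  - by apply: measurable_funM => //; exact: measurableT_comp.
  - move=> w; rewrite normrM; apply: ler_pM => //; rewrite -(real_normK (num_real (G i j w))).
    have := normr_ge0 (G i j w); rewrite /=; nra.
have fi j : intg P (fun w => f j (G i j w)) /\
    \int[P]_w f j (G i j w) = if j == l then x 0 l else 1.
  have [jl|jl] := eqVneq j l.
    have -> : (fun w => f j (G i j w)) = (fun w => G i l w + x 0 l * (phi i l (G i l w) * G i l w)).
      by apply/funext => w; rewrite /f jl eqxx expr1; ring.
    split; first by apply: intgD => //; exact: intgZ.
    by rewrite ExD ?ExZ ?g1 ?phi1 ?add0r ?mulr1//; exact: intgZ.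
  have -> : (fun w => f j (G i j w)) = (fun w => 1 + x 0 j * phi i j (G i j w)).
    by apply/funext => w; rewrite /f (negbTE jl) expr0 mulr1.
  split; first by apply: intgD; [exact: intg_cst|exact: intgZ].
  rewrite ExD; [|exact: intg_cst|exact: intgZ].
  by rewrite Ex_cst ExZ// phi0 mulr0 addr0.
have [h1 h2] := @cell_prod i f mf (fun j => (fi j).1).
rewrite E; split => //; rewrite h2 (bigD1 l)//= (fi l).2 eqxx big1 ?mulr1// => j jl.
by rewrite (fi j).2 (negbTE jl).
Qed.

Let WY i : intg P (fun w => W i w * Y i w) /\ \int[P]_w (W i w * Y i w) = dotp x m.
Proof.
have -> : (fun w => W i w * Y i w) = (fun w => \sum_j m 0 j * (W i w * G i j w)).
  by apply/funext => w; rewrite YE mulr_sumr; apply: eq_bigr => j _; ring.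
split; first by apply: intg_sum => j; apply: intgZ; exact: (WG i j).1.
rewrite Ex_sum => [|j]; last by apply: intgZ; exact: (WG i j).1.
by apply: eq_bigr => j _; rewrite ExZ ?(WG i j).2 1?mulrC//; exact: (WG i j).1.
Qed.

Lemma tilt_trunc_ge0 i w : 0 <= W' i w.
Proof. by rewrite /tilt_trunc; case: ifP => // _; exact: ltW. Qed.

Let W'_ge0 := tilt_trunc_ge0.

Let W'_le i w : W' i w <= tau ^+ 2.
Proof. by rewrite /tilt_trunc; case: ifP => // _; exact: sqr_ge0. Qed.

Let W'_adapted i : adapted X (row_coords i) (W' i).
Proof.
have aW : adapted X (row_coords i) (W i).
  apply: measurable_prod => j _; apply: (@single_row i j).
  by apply: (@single i j (fun y => 1 + x 0 j * phi i j y)); apply: measurable_funD => //; exact: measurable_funM.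
apply: measurable_fun_ifT => //; exact: measurable_fun_ler.
Qed.

Let mW' i : measurable_fun setT (W' i).
Proof. exact: (adapted_measurable indG (@W'_adapted i)). Qed.

Let Y_adapted i : adapted X (row_coords i) (Y i).
Proof.
rewrite (_ : Y i = (fun w => \sum_j m 0 j * G i j w)); last by apply/funext => w; rewrite YE.
apply: measurable_sum => j; apply: measurable_funM => //; apply: (@single_row i j); exact: (@single i j id).
Qed.

Let W'i i : intg P (W' i).
Proof.
apply: (intg_le (@mW' i) _ (intg_cst P (tau ^+ 2))) => w.
by rewrite ger0_norm.
Qed.

Let EW' i : \int[P]_w W' i w <= 1.
Proof.
rewrite -(W1 i).2; apply: Ex_le => //; first exact: (W1 i).1.
by move=> w; rewrite /tilt_trunc; case: ifP => // _; exact: ltW.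
Qed.

Let W'Yi i : intg P (fun w => W' i w * Y i w).
Proof.
apply: (intg_le _ _ (intgZ (tau ^+ 2) (intgD (intg_cst P 1) (Y2 i).1))).
- exact: measurable_funM.
- move=> w; rewrite normrM; apply: ler_pM => //; first by rewrite ger0_norm.
  by rewrite -(real_normK (num_real (Y i w))) /=; have := normr_ge0 (Y i w); nra.
Qed.

(** Where the weight [a] exceeds [tau^2], dropping it costs [- a y <= tau a^2 / 2 + y^2 / (2 tau)],
    and [a^2 <= a^4 / tau^4]. Each half contributes at most [1 / (2 tau)] in mean. *)
Let EW'Y i : \int[P]_w (W' i w * Y i w) <= dotp x m + tau^-1.
Proof.
pose h w := W i w * Y i w + (1 / 2 * tau ^- 3 * W i w ^+ 4 + 1 / 2 * tau^-1 * Y i w ^+ 2).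
have i1 : intg P (fun w => 1 / 2 * tau ^- 3 * W i w ^+ 4 + 1 / 2 * tau^-1 * Y i w ^+ 2).
  by apply: intgD; apply: intgZ; [exact: (W4 i).1|exact: (Y2 i).1].
have hi : intg P h by apply: intgD => //; exact: (WY i).1.
have le w : W' i w * Y i w <= h w.
  rewrite /tilt_trunc /h; case: (leP (W i w) (tau ^+ 2)) => WT.
    have h1 : 0 <= 1 / 2 * tau ^- 3 * W i w ^+ 4.
      by rewrite !mulr_ge0 ?divr_ge0 ?invr_ge0 ?exprn_ge0// ltW.
    have h2 : 0 <= 1 / 2 * tau^-1 * Y i w ^+ 2.
      by rewrite mulr_ge0 ?sqr_ge0// divr_ge0 ?divr_ge0// ltW.
    by rewrite lerDl addr_ge0.
  rewrite mul0r; set a := W i w in WT *; set y := Y i w.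
  have a2 : a ^+ 2 <= tau ^- 4 * a ^+ 4.
    rewrite mulrC ler_pdivlMr ?exprn_gt0// (exprM a 2 2) expr2 ler_wpM2l ?sqr_ge0//.
    rewrite (exprM tau 2 2) lerXn2r ?nnegrE ?sqr_ge0 ?(ltW WT)//.
    by rewrite (le_trans _ (ltW WT))// sqr_ge0.
  have a3 : tau * a ^+ 2 <= tau ^- 3 * a ^+ 4.
    have := ler_wpM2l (ltW tau0) a2; rewrite (mulrA tau (tau ^- 4)).
    by have -> : tau * tau ^- 4 = tau ^- 3 by field; rewrite gt_eqF.
  have : 0 <= tau^-1 * (tau * a + y) ^+ 2 by rewrite mulr_ge0 ?sqr_ge0// invr_ge0 ltW.
  have -> : tau^-1 * (tau * a + y) ^+ 2 = tau * a ^+ 2 + 2 * (a * y) + tau^-1 * y ^+ 2.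
    by field; rewrite gt_eqF.
  lra.
apply: le_trans (Ex_le (W'Yi i) hi le) _.
rewrite ExD ?(WY i).2//; last exact: (WY i).1.
rewrite lerD2l ExD; [|apply: intgZ; exact: (W4 i).1|apply: intgZ; exact: (Y2 i).1].
rewrite (ExZ _ (W4 i).1) (ExZ _ (Y2 i).1).
have h1 : tau ^- 3 * (\int[P]_w W i w ^+ 4) <= tau^-1.
  apply: (@le_trans _ _ (tau ^- 3 * tau ^+ 2)).
    by rewrite ler_wpM2l ?invr_ge0 ?exprn_ge0 ?(ltW tau0)//; exact: (W4 i).2.
  by rewrite le_eqVlt; apply/orP; left; apply/eqP; field; rewrite gt_eqF.
have h2 : tau^-1 * (\int[P]_w Y i w ^+ 2) <= tau^-1.
  by rewrite ler_piMr ?invr_ge0 ?(ltW tau0)//; exact: (Y2 i).2.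
by rewrite -!mulrA; lra.
Qed.

(** A Bernstein bound, with the generating function of [Z i] controlled by [expR_le_quadratic]. *)
Let truncated_chernoff (Z : 'I_N -> Omega -> R) (mu v lam del : R) : 0 <= lam ->
    (forall i, adapted X (row_coords i) (Z i)) -> (forall i, intg P (Z i)) ->
    (forall i, \int[P]_w Z i w <= mu) ->
    (forall i, intg P (fun w => Z i w ^+ 2 * expR (lam * `|Z i w|))) ->
    (forall i, \int[P]_w (Z i w ^+ 2 * expR (lam * `|Z i w|)) <= v) ->
  measurable [set w | N%:R * (mu + del) <= \sum_i Z i w] /\
  (P [set w | N%:R * (mu + del) <= \sum_i Z i w]%R <=
     (expR (N%:R * (lam ^+ 2 * v - lam * del)))%:E)%E.
Proof.
move=> l0 aZ iZ Zmu iV Vv.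
pose h i w := 1 + lam * Z i w + lam ^+ 2 * (Z i w ^+ 2 * expR (lam * `|Z i w|)).
have hi i : intg P (h i).
  by apply: intgD; [apply: intgD; [exact: intg_cst|exact: intgZ]|exact: intgZ].
have le i w : expR (lam * Z i w) <= h i w.
  apply: le_trans (expR_le_quadratic _) _.
  by rewrite exprMn normrM (ger0_norm l0) -mulrA.
have ei i : intg P (fun w => expR (lam * Z i w)).
  apply: intg_le (hi i) => [|w]; last by rewrite ger0_norm ?expR_ge0.
  apply: measurableT_comp => //; apply: measurable_funM => //; exact: (adapted_measurable indG (aZ i)).
have Ee i : \int[P]_w expR (lam * Z i w) <= expR (lam * mu + lam ^+ 2 * v).
  apply: le_trans (Ex_le (ei i) (hi i) (le i)) _; apply: le_trans (expR_ge1Dx _).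
  rewrite ExD; [|by apply: intgD; [exact: intg_cst|exact: intgZ]|exact: intgZ].
  rewrite ExD; [|exact: intg_cst|exact: intgZ].
  rewrite Ex_cst !ExZ// -addrA lerD2l lerD// ler_wpM2l ?sqr_ge0//.
have [h1 h2] := @chernoff_indep _ _ _ P _ _ indG 'I_N row_coords Z
  (fun=> lam * mu + lam ^+ 2 * v) lam (N%:R * (mu + del)) l0 disjoint_row_coords aZ ei Ee.
split => //; apply: le_trans h2 _; rewrite lee_fin ler_expR sumr_const card_ord -mulr_natl.
lra.
Qed.

Lemma tilt_weights_prob :
  measurable [set w | N%:R * 2 <= \sum_i W' i w] /\
  (P [set w | N%:R * 2 <= \sum_i W' i w]%R <=
     (expR (- (N%:R * (4 * expR 1 * tau ^+ 4)^-1)))%:E)%E.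
Proof.
have t4 : 1 <= tau ^+ 4 by rewrite exprn_ege1.
have e1 : 1 <= expR (1 : R) by rewrite -expR0 ler_expR.
(* Minimises [lam^2 v - lam] for [v = e tau^4], with value [- 1 / (4 v)]; it also keeps [lam] times
   a weight below 1. *)
pose lam := (2 * expR 1 * tau ^+ 4)^-1.
have den0 : 0 < 2 * expR 1 * tau ^+ 4 by rewrite !mulr_gt0 ?expR_gt0 ?exprn_gt0.
have lam0 : 0 <= lam by rewrite invr_ge0 ltW.
have lamt : lam * tau ^+ 2 <= 1.
  rewrite mulrC ler_pdivrMr// mul1r (exprM tau 2 2).
  have : 1 <= tau ^+ 2 by rewrite exprn_ege1.
  by set a := tau ^+ 2; nra.
have le i w : W' i w ^+ 2 * expR (lam * `|W' i w|) <= tau ^+ 4 * expR 1.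
  apply: ler_pM; rewrite ?sqr_ge0 ?expR_ge0//.
    by rewrite (exprM tau 2 2) lerXn2r ?nnegrE ?sqr_ge0.
  by rewrite ler_expR ger0_norm// (le_trans _ lamt)// ler_wpM2l.
have ii i : intg P (fun w => W' i w ^+ 2 * expR (lam * `|W' i w|)).
  apply: (intg_le _ _ (intg_cst P (tau ^+ 4 * expR 1))) => [|w].
    apply: measurable_funM; first exact: measurable_funX.
    apply: measurableT_comp => //; apply: measurable_funM => //; exact: measurableT_comp.
  by rewrite ger0_norm ?le// mulr_ge0 ?sqr_ge0 ?expR_ge0.
have := @truncated_chernoff W' 1 (tau ^+ 4 * expR 1) lam 1 lam0 W'_adapted W'i EW' ii.
have -> : 1 + 1 = 2 :> R by ring.
case=> [i|h1 h2].
  by rewrite -(Ex_cst P (tau ^+ 4 * expR 1)); apply: Ex_le => //; exact: intg_cst.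
split => //; apply: le_trans h2 _; rewrite lee_fin ler_expR le_eqVlt; apply/orP; left; apply/eqP.
by rewrite /lam; field; rewrite !gt_eqF ?expR_gt0.
Qed.

Lemma tilt_direction_prob (del : R) : 0 < del <= 1 ->
  measurable [set w | N%:R * (dotp x m + tau^-1 + del) <= \sum_i W' i w * Y i w] /\
  (P [set w | N%:R * (dotp x m + tau^-1 + del) <= \sum_i W' i w * Y i w]%R <=
     (expR (- (N%:R * (del ^+ 2 / (32 * expR (4 * k1) * tau ^+ 4)))))%:E)%E.
Proof.
move=> /andP[del0 del1].
have t4 : 1 <= tau ^+ 4 by rewrite exprn_ege1.
have e1 : 1 <= expR (4 * k1) by rewrite -[leLHS]expR0 ler_expR mulr_ge0// ltW.
pose k2 := 8 * expR (4 * k1).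
(* Minimises [lam^2 v - lam del] for [v = k2 tau^4], with value [- del^2 / (4 v)]. *)
pose lam := del / (2 * k2 * tau ^+ 4).
have k20 : 8 <= k2 by rewrite /k2; lra.
have den0 : 0 < 2 * k2 * tau ^+ 4 by rewrite mulr_gt0 ?exprn_gt0//; lra.
have lam0 : 0 <= lam by rewrite divr_ge0// ltW.
have lamt : lam * tau ^+ 2 <= 1.
  rewrite /lam mulrAC ler_pdivrMr// mul1r (exprM tau 2 2).
  have : 1 <= tau ^+ 2 by rewrite exprn_ege1.
  set a := tau ^+ 2 => a1.
  apply: (@le_trans _ _ a); first by rewrite ler_piMl//; lra.
  by rewrite expr2 mulrA ler_peMl//; nra.
have le i w : (W' i w * Y i w) ^+ 2 * expR (lam * `|W' i w * Y i w|) <=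
    tau ^+ 4 * (Y i w ^+ 2 * expR `|Y i w|).
  rewrite exprMn (mulrA (tau ^+ 4)); apply: ler_pM.
  - by apply: mulr_ge0; exact: sqr_ge0.
  - exact: expR_ge0.
  - apply: ler_wpM2r; first exact: sqr_ge0.
    by rewrite (exprM tau 2 2) lerXn2r ?nnegrE ?sqr_ge0.
  - rewrite ler_expR normrM ger0_norm// mulrA ler_piMl//.
    by rewrite (le_trans _ lamt)// ler_wpM2l.
have i0 i : intg P (fun w => tau ^+ 4 * (Y i w ^+ 2 * expR `|Y i w|)).
  by apply: intgZ; exact: (Yexp i).1.
have ii i : intg P (fun w => (W' i w * Y i w) ^+ 2 * expR (lam * `|W' i w * Y i w|)).
  apply: intg_le (i0 i) => [|w].
    have mWY : measurable_fun setT (fun w => W' i w * Y i w) by exact: measurable_funM.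
    apply: measurable_funM; first exact: measurable_funX.
    apply: measurableT_comp => //; apply: measurable_funM => //; exact: measurableT_comp.
  by rewrite ger0_norm ?le// mulr_ge0 ?sqr_ge0 ?expR_ge0.
have aZ i : adapted X (row_coords i) (fun w => W' i w * Y i w).
  by apply: measurable_funM; [exact: W'_adapted|exact: Y_adapted].
case: (@truncated_chernoff (fun i w => W' i w * Y i w) (dotp x m + tau^-1) (tau ^+ 4 * k2)
  lam del lam0 aZ W'Yi EW'Y ii) => [i|h1 h2].
  apply: le_trans (Ex_le (ii i) (i0 i) (le i)) _; rewrite ExZ; last exact: (Yexp i).1.
  by rewrite ler_wpM2l ?exprn_ge0 ?(ltW tau0)//; exact: (Yexp i).2.
split => //; apply: le_trans h2 _; rewrite lee_fin ler_expR le_eqVlt; apply/orP; left; apply/eqP.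
rewrite /lam /k2; field; rewrite !gt_eqF ?expR_gt0//.
Qed.

End weights.
End direction.
End tilting.

(** * Large [N / n]: a cube inside the hull *)

Section large_aspect_ratio.
Context {R : realType} {d : measure_display} {Omega : measurableType d}.
Variable P : probability Omega R.
Variables (n N : nat) (G : 'I_N -> 'I_n -> Omega -> R).
Hypothesis n0 : (0 < n)%N.
Hypothesis N0 : (0 < N)%N.
Hypothesis indG : mutually_independent P (fun ij : 'I_N * 'I_n => G ij.1 ij.2).
Hypothesis gi : forall i j, intg P (G i j).
Hypothesis g2i : forall i j, intg P (fun w => G i j w ^+ 2).
Hypothesis g1 : forall i j, \int[P]_w G i j w = 0.
Hypothesis g2 : forall i j, \int[P]_w G i j w ^+ 2 = 1.
Variable k1 : R.
Hypothesis k10 : 0 < k1.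
Hypothesis mgf : forall i j s, intg P (fun w => expR (s * G i j w)) /\
  \int[P]_w expR (s * G i j w) <= expR (k1 * s ^+ 2).
Variables (phi : 'I_N -> 'I_n -> R -> R) (bb : R).
Hypothesis bb1 : 1 <= bb.
Hypothesis mphi : forall i j, measurable_fun setT (phi i j).
Hypothesis phi_le : forall i j y, `|phi i j y| <= bb.
Hypothesis phi0 : forall i j, \int[P]_w phi i j (G i j w) = 0.
Hypothesis phi1 : forall i j, \int[P]_w (phi i j (G i j w) * G i j w) = 1.

Let bb0 : 0 < bb. Proof. exact: lt_le_trans bb1. Qed.
Let nn : (0 : R) < n%:R. Proof. by rewrite ltr0n. Qed.
Let NN : (0 : R) < N%:R. Proof. by rewrite ltr0n. Qed.

Local Notation v w := (fun i => \row_j G i j w).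
Let c : R := (6 * bb)^-1.
(* Large enough for the union bound over a direction in a net of size [64 ^ n] and a
   target point in that net or among the [2 ^ n] vertices. *)
Let al : R := 2 * ln 64 + ln 4 + 1.

(* The weights are truncated at [tau ^ 2]. *)
Variable tau : R.
Hypothesis tau8 : tau ^+ 8 = N%:R / n%:R.
Hypothesis tau_e : expR 1 <= tau.
Hypothesis tau_c : tau^-1 <= c / 16.
Hypothesis tau_w : al * (4 * expR 1) <= tau ^+ 4.
Hypothesis tau_d : al * (32 * expR (4 * k1)) <= tau ^+ 4 * (c / 16) ^+ 2.

Let c0 : 0 < c. Proof. by rewrite invr_gt0 mulr_gt0. Qed.
Let c1 : c <= 1. Proof. by rewrite invf_le1; have := bb1; have := bb0; lra. Qed.
Let tau1 : 1 <= tau.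
Proof. by apply: le_trans tau_e; rewrite -[leLHS]expR0 ler_expR. Qed.
Let tau0 : 0 < tau. Proof. exact: lt_le_trans tau1. Qed.

(** [N = tau^8 n] turns a Chernoff exponent of order [N / tau^4] into [n tau^4]. *)
Let exponent a b : 0 < b -> al * b <= tau ^+ 4 * a -> al * n%:R <= N%:R * (a / (b * tau ^+ 4)).
Proof.
move=> b0 h; have -> : N%:R = tau ^+ 8 * n%:R by rewrite tau8 divfK// gt_eqF.
have -> : tau ^+ 8 * n%:R * (a / (b * tau ^+ 4)) = tau ^+ 4 * a / b * n%:R.
  by field; rewrite !gt_eqF.
by rewrite ler_wpM2r ?(ltW nn)// ler_pdivlMr.
Qed.

(** The point is the average of the [G_i] with truncated weights, of total mass below 2. Its excess
    over [x] is below [1/tau + c/16 <= c/8] in every net direction, and the net recovers the norm up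
    to a factor 2. *)
Lemma tilt_point (x : 'rV[R]_n) : (forall j, `|x 0 j| * bb <= 1 / 2) ->
    9 * bb ^+ 2 * sqnorm x <= 2 * ln tau ->
  exists B : set Omega, [/\ measurable B,
    (P B <= ((64 ^+ n + 1) * expR (- (al * n%:R)))%:E)%E &
    forall w, ~ B w -> exists2 a, shull (v w) 2 a & nrm (x - a) <= c / 4].
Proof.
move=> xb x2; pose W' := tilt_trunc G phi x tau.
have del01 : 0 < c / 16 <= 1 by apply/andP; split; [rewrite divr_gt0|have := c1; lra].
have [mBw PBw] := tilt_weights_prob indG gi mphi phi_le phi0 xb tau1.
have dirP z : netP z -> _ := fun zP => tilt_direction_prob indG gi g2i g1 g2 k10 mgf bb0
  mphi phi_le phi0 phi1 (netv_sqnorm zP) xb tau1 x2 del01.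
pose A z := [set w | N%:R * (dotp x (netv z) + tau^-1 + c / 16) <=
  \sum_i W' i w * dotp (\row_j G i j w) (netv z)].
have [|B [mB PB BA]] := @union_bound _ _ _ P _ (@netP n) A (expR (- (al * n%:R))) (fun z zP => (dirP z zP).1).
  move=> z zP; apply: le_trans (dirP z zP).2 _; rewrite lee_fin ler_expR lerN2.
  by apply: exponent; rewrite ?mulr_gt0 ?expR_gt0.
exists (B `|` [set w | N%:R * 2 <= \sum_i W' i w]); split.
- exact: measurableU.
- apply: le_trans (measureU2 _ _ _) _ => //.
  rewrite mulrDl mul1r EFinD; apply: leeD.
    apply: le_trans PB _; rewrite lee_fin ler_wpM2r ?expR_ge0//; exact: card_net.
  apply: le_trans PBw _; rewrite lee_fin ler_expR lerN2.
  rewrite -[_^-1]mul1r; apply: exponent; first by rewrite mulr_gt0 ?expR_gt0.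
  by rewrite mulr1.
move=> w /not_orP[Bw /= /negP]; rewrite -ltNge => Ww.
pose a := \sum_i (W' i w / N%:R) *: (\row_j G i j w).
have W0 i : 0 <= W' i w by exact: (tilt_trunc_ge0 G phi_le tau xb i w).
exists a.
  exists (fun i => W' i w / N%:R) => //.
  under eq_bigr do rewrite ger0_norm ?divr_ge0 ?(ltW NN)//.
  by rewrite -mulr_suml ler_pdivrMr// mulrC ltW.
rewrite -nrmN opprB.
have [z zP az] := net_norm (a - x); apply: le_trans az _.
have /negP := BA w Bw z zP; rewrite -ltNge.
have -> : \sum_i W' i w * dotp (\row_j G i j w) (netv z) = N%:R * dotp a (netv z).
  rewrite /dotp /a; under [in RHS]eq_bigr do rewrite summxE mulr_suml.
  rewrite exchange_big/= mulr_sumr; apply: eq_bigr => i _.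
  rewrite !mulr_sumr; apply: eq_bigr => j _; rewrite !mxE; field.
  by rewrite !gt_eqF ?sqrtr_gt0.
rewrite ltr_pM2l// => h.
have -> : dotp (a - x) (netv z) = dotp a (netv z) - dotp x (netv z).
  by rewrite dotpC dotpDr -scaleN1r dotpZr mulN1r !(dotpC (netv z)).
by have := tau_c; lra.
Qed.

Lemma cube_sub_hull : (N%:R <= (2 : R) ^+ n) ->
  exists B : set Omega, [/\ measurable B, (P B <= (expR (- n%:R))%:E)%E &
    forall w, ~ B w -> forall x : 'rV[R]_n, (forall j, `|x 0 j| <= 1) ->
      sym_conv_hull (v w) (x *m (Num.sqrt (ln (N%:R / n%:R) / n%:R) / (30 * bb))%:M)].
Proof.
(* The 6 makes [9 bb^2 |x|^2 = ln (N/n) / 4 = 2 ln tau] at the vertices. [N <= 2 ^ n] gives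
   [ln (N/n) <= n], hence [r bb <= 1/6]. The final [30 bb] accounts for the dilate by 5. *)
move=> N2; pose r := Num.sqrt (ln (N%:R / n%:R) / n%:R) / (6 * bb).
pose l := ln (N%:R / n%:R) : R.
have lE : l = 8 * ln tau by rewrite /l -tau8 lnXn// mulr_natl.
have lt1 : 1 <= ln tau by rewrite -(expRK 1) ler_ln ?posrE ?expR_gt0.
have l0 : 0 <= l by rewrite lE; lra.
have ln_le : l <= n%:R.
  have h : N%:R / n%:R <= (2 : R) ^+ n.
    by apply: le_trans N2; rewrite ler_pdivrMr// ler_peMr ?ler1n// ltW.
  apply: (@le_trans _ _ (ln (2 ^+ n))).
    by rewrite ler_ln ?posrE ?divr_gt0 ?exprn_gt0.
  have -> : ln (2 ^+ n) = n%:R * ln 2 :> R by rewrite lnXn// mulr_natl.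
  rewrite ler_piMr ?(ltW nn)//.
  by have := @le_ln1Dx R 1; rewrite (_ : 1 + 1 = 2) => [|]; [apply|ring].
have r0 : 0 <= r by rewrite divr_ge0 ?sqrtr_ge0// mulr_ge0// ltW.
have r2 : r ^+ 2 = l / n%:R / (6 * bb) ^+ 2.
  by rewrite expr_div_n sqr_sqrtr// divr_ge0// ltW.
have vertP (e : {ffun 'I_n -> bool}) : exists B : set Omega, [/\ measurable B,
    (P B <= ((64 ^+ n + 1) * expR (- (al * n%:R)))%:E)%E &
    forall w, ~ B w -> exists2 a, shull (v w) 2 a & nrm (r *: \row_j (-1) ^+ e j - a) <= c / 4].
  apply: tilt_point => [j|].
    rewrite !mxE normrM normr_sign mulr1 ger0_norm// /r.
    have -> : Num.sqrt (ln (N%:R / n%:R) / n%:R) / (6 * bb) * bb = Num.sqrt (l / n%:R) / 6.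
      by field; rewrite gt_eqF.
    have : Num.sqrt (l / n%:R) <= 1.
      by rewrite -[leRHS]sqrtr1 ler_wsqrtr// ler_pdivrMr// mul1r.
    lra.
  rewrite sqnormZ r2.
  have -> : sqnorm (\row_j (-1) ^+ e j : 'rV[R]_n) = n%:R.
    rewrite /sqnorm (eq_bigr (fun=> 1)) => [|j _]; last by rewrite mxE sqrr_sign.
    by rewrite sumr_const card_ord.
  have -> : 9 * bb ^+ 2 * (l / n%:R / (6 * bb) ^+ 2 * n%:R) = l / 4.
    by field; rewrite !gt_eqF.
  by rewrite lE; lra.
have netvP (z : net_index n) : netP z -> exists B : set Omega, [/\ measurable B,
    (P B <= ((64 ^+ n + 1) * expR (- (al * n%:R)))%:E)%E &
    forall w, ~ B w -> exists2 a, shull (v w) 2 a & nrm (c *: netv z - a) <= c / 4].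
  move=> zP; have z1 := @netv_sqnorm R _ _ zP; apply: tilt_point => [j|].
    have zj : `|(netv z : 'rV[R]_n) 0 j| <= 1.
      rewrite -(@ler_pXn2r _ 2)// ?nnegrE// expr1n real_normK ?num_real//.
      apply: le_trans z1; rewrite /sqnorm [leRHS](bigD1 j)//= lerDl sumr_ge0// => i _; exact: sqr_ge0.
    rewrite mxE normrM gtr0_norm//.
    have -> : c * `|netv z 0 j| * bb = `|netv z 0 j| / 6 by rewrite /c; field; rewrite gt_eqF.
    lra.
  rewrite sqnormZ; have -> : 9 * bb ^+ 2 * (c ^+ 2 * sqnorm (netv z)) = sqnorm (netv z) / 4.
    by rewrite /c; field; rewrite gt_eqF.
  lra.
have /choice[Be BeP] := vertP.
have /choice[Bz BzP] : forall z, exists B : set Omega, netP z -> [/\ measurable B,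
    (P B <= ((64 ^+ n + 1) * expR (- (al * n%:R)))%:E)%E &
    forall w, ~ B w -> exists2 a, shull (v w) 2 a & nrm (c *: netv z - a) <= c / 4].
  move=> z; have [zP|nz] := boolP (netP z); last by exists set0.
  by have [B HB] := netvP z zP; exists B.
have [||B1 [mB1 PB1 B1A]] := @union_bound _ _ _ P _ (@netP n) Bz ((64 ^+ n + 1) * expR (- (al * n%:R))).
- by move=> z zP; have [] := BzP z zP.
- by move=> z zP; have [] := BzP z zP.
have [||B2 [mB2 PB2 B2A]] := @union_bound _ _ _ P _ (@predT {ffun 'I_n -> bool}) Be
    ((64 ^+ n + 1) * expR (- (al * n%:R))).
- by move=> e _; have [] := BeP e.
- by move=> e _; have [] := BeP e.
exists (B1 `|` B2); split; first exact: measurableU.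
- apply: le_trans (measureU2 _ _ _) _ => //.
  apply: le_trans (leeD PB1 PB2) _; rewrite -EFinD lee_fin -mulrDl.
  have -> : #|@predT {ffun 'I_n -> bool}| = (2 ^ n)%N by rewrite card_ffun card_bool card_ord.
  have h64 : (1 : R) <= 64 ^+ n by rewrite exprn_ege1// ler1n.
  have h2 : ((2 ^ n)%N%:R : R) <= 64 ^+ n.
    by rewrite natrX lerXn2r ?nnegrE// ler_nat.
  apply: (@le_trans _ _ ((2 * 64 ^+ n) * ((2 * 64 ^+ n) * expR (- (al * n%:R))))).
    apply: ler_pM.
    + by rewrite addr_ge0.
    + by rewrite mulr_ge0 ?expR_ge0// addr_ge0// exprn_ge0.
    + by have := @card_net R n; lra.
    + by rewrite ler_wpM2r ?expR_ge0//; lra.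
  have -> : (64 : R) ^+ n = expR (n%:R * ln 64) by rewrite expRM_natl lnK// posrE.
  have -> : 2 * expR (n%:R * ln 64) * (2 * expR (n%:R * ln 64) * expR (- (al * n%:R))) =
      4 * (expR (n%:R * ln 64) * expR (n%:R * ln 64) * expR (- (al * n%:R))) :> R by ring.
  rewrite -{1}(@lnK _ 4) ?posrE// -!expRD ler_expR /al.
  have : ln 4 <= n%:R * ln 4 :> R by rewrite ler_peMl ?ln_ge0 ?ler1n.
  lra.
move=> w /not_orP[B1w B2w] x x1; apply: shull_sym_conv_hull => //.
have near z : @netP n z -> exists2 a, shull (v w) 2 a & nrm (c *: netv z - a) <= c / 4.
  by move=> zP; have [_ _] := BzP z zP; apply; exact: B1A.
have vert (e : 'I_n -> bool) : shull (v w) 5 (r *: \row_j (-1) ^+ e j).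
  apply: (vertex_shull c0 near).
  have [_ _ /(_ w (B2A w B2w [ffun j => e j] isT))] := BeP [ffun j => e j].
  have -> : (\row_j (-1) ^+ [ffun j => e j] j : 'rV[R]_n) = \row_j (-1) ^+ e j.
    by apply/rowP => j; rewrite !mxE ffunE.
  by [].
have := shullZ (1 / 5) (cube_shull _ vert x1) => /(_ (ler0n _ 5)).
rewrite ger0_norm; last lra.
have -> : 1 / 5 * 5 = 1 :> R by field.
congr (shull _ _ _); rewrite mul_mx_scalar scalerA; congr (_ *: _).
by rewrite /r; field; rewrite gt_eqF.
Qed.

End large_aspect_ratio.

(** Induction through [(1 + 1/n) ^ n <= e]. *)
Lemma expn_le_fact_expR {R : realType} n : (n%:R : R) ^+ n <= n`!%:R * expR n%:R.
Proof.
elim: n => [|n ih]; first by rewrite expr0 fact0 expR0 mulr1.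
case: n ih => [|n] ih.
  by rewrite expr1 mul1r (le_trans _ (expR_ge1Dx _))// lerDr.
have n0 : (0 : R) < n.+1%:R by [].
have e1 : (1 + n.+1%:R^-1) ^+ n.+1 <= expR (1 : R).
  rewrite -[X in expR X](@mulVf R n.+1%:R) ?gt_eqF// expRM_natr.
  by rewrite lerXn2r ?nnegrE ?addr_ge0 ?invr_ge0 ?expR_ge0 ?expR_ge1Dx// ltW.
have -> : (n.+2%:R : R) ^+ n.+2 = n.+2%:R * (n.+1%:R ^+ n.+1 * (1 + n.+1%:R^-1) ^+ n.+1).
  rewrite exprS -exprMn; congr (_ * _ ^+ _).
  by rewrite mulrDr mulr1 mulfV ?gt_eqF// natr1.
have -> : expR (n.+2%:R : R) = expR n.+1%:R * expR 1 by rewrite -expRD natr1.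
rewrite factS natrM -mulrA ler_wpM2l// mulrA.
by apply: ler_pM => //; rewrite exprn_ge0// addr_ge0// invr_ge0 ltW.
Qed.

(** * Bounded [N / n]: a parallelepiped from the greedy rows *)

Section small_aspect_ratio.
Context {R : realType} {d : measure_display} {Omega : measurableType d}.
Variables (n N : nat) (G : 'I_N -> 'I_n -> Omega -> R).

(** With [Q = 0], [x B] is a combination of the rows whose coefficients have the Euclidean norm of
    [x], at most [sqrt n]. By Cauchy-Schwarz their absolute sum is at most [sqrt (N n)], so [B] is
    divided by that; [n! >= (n/e)^n] bounds the determinant. *)
Lemma greedy_cube w : (0 < n)%N -> (0 < N)%N -> greedy (rows G w) N = 0 ->
  exists A : 'M[R]_n, (forall x : 'rV[R]_n, (forall j, `|x 0 j| <= 1) ->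
      sym_conv_hull (fun i => \row_j G i j w) (x *m A)) /\
    (Num.sqrt (2 * expR 1 * N%:R))^-1 ^+ n <= `|\det A|.
Proof.
move=> n0 N0 Q0; have nn : (0 : R) < n%:R by rewrite ltr0n.
have NN : (0 : R) < N%:R by rewrite ltr0n.
have [r Qp [B [_ detB span]]] := greedy_spansP (rows G w) N.
have r0 : r = 0%N.
  by case: Qp => _ _; rewrite Q0 mxtrace0 => /eqP; rewrite eq_sym pnatr_eq0 => /eqP.
rewrite r0 fact0 expr0 divr1 mulr1 in detB.
pose s := Num.sqrt (N%:R * n%:R : R).
have s0 : 0 < s by rewrite sqrtr_gt0 mulr_gt0.
have ss : s ^+ 2 = N%:R * n%:R by rewrite sqr_sqrtr// mulr_ge0 ?ltW.
exists (s^-1 *: B); split.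
  move=> x x1; apply: shull_sym_conv_hull => //.
  have [c [c1 c2]] := span x; rewrite Q0 mulmx0 in c1 c2.
  exists (fun i => s^-1 * c i); last first.
    rewrite -scalemxAr c1 addr0 scaler_sumr; apply: eq_bigr => i _.
    rewrite scalerA; congr (_ *: _); apply/rowP => j; rewrite !mxE.
    by rewrite valK.
  under eq_bigr do rewrite normrM gtr0_norm ?invr_gt0//.
  rewrite -mulr_sumr ler_pdivrMl// mulr1.
  pose a : 'rV[R]_N := \row_i `|c i|; pose b : 'rV[R]_N := const_mx 1.
  have -> : \sum_(i < N) `|c i| = dotp a b by apply: eq_bigr => i _; rewrite !mxE mulr1.
  apply: le_trans (dotp_le a b) _.
  have -> : nrm b = Num.sqrt N%:R.
    rewrite /nrm /sqnorm; congr Num.sqrt; under eq_bigr do rewrite mxE expr1n.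
    by rewrite sumr_const card_ord.
  have an : nrm a <= Num.sqrt n%:R.
    apply: ler_wsqrtr.
    have -> : sqnorm a = sqnorm x.
      have z0 : sqnorm (0 : 'rV[R]_n) = 0 by rewrite /sqnorm big1// => j _; rewrite mxE expr0n.
      rewrite -c2 z0 addr0; apply: eq_bigr => i _; rewrite mxE.
      by rewrite real_normK// num_real.
    rewrite -[n in n%:R]card_ord -sumr_const; apply: ler_sum => j _.
    by rewrite -real_normK ?num_real// expr_le1.
  by rewrite /s sqrtrM ?ler0n// mulrC ler_wpM2l ?sqrtr_ge0.
rewrite detZ -(@ler_pXn2r _ 2)// ?nnegrE ?exprn_ge0 ?invr_ge0 ?sqrtr_ge0//.
rewrite normrM normrX (gtr0_norm (_ : 0 < s^-1)) ?invr_gt0// exprMn real_normK ?num_real//.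
rewrite [leLHS]exprAC (exprAC s^-1) !(exprVn _ 2) ss.
rewrite sqr_sqrtr; last by rewrite !mulr_ge0 ?expR_ge0 ?ltW.
apply: (@le_trans _ _ ((N%:R * n%:R)^-1 ^+ n * (n`!%:R / 2 ^+ n))); last first.
  by rewrite ler_wpM2l// exprn_ge0// invr_ge0 mulr_ge0 ?ltW.
have h : (n%:R / (2 * expR 1)) ^+ n <= n`!%:R / 2 ^+ n :> R.
  rewrite expr_div_n exprMn invfM mulrA [leLHS]mulrAC ler_wpM2r ?invr_ge0 ?exprn_ge0//.
  rewrite ler_pdivrMr ?exprn_gt0 ?expR_gt0// -expRM_natl mulr1.
  exact: expn_le_fact_expR.
apply: le_trans (ler_wpM2l _ h); last by rewrite exprn_ge0// invr_ge0 mulr_ge0 ?ltW.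
rewrite -exprMn le_eqVlt; apply/orP; left; apply/eqP; congr (_ ^+ _).
by field; rewrite !gt_eqF ?expR_gt0.
Qed.

End small_aspect_ratio.

(** * Choice of the constants and union of the two regimes *)

(** The logarithm in the second moment cancels against the one in the squared side of the cube. *)
Lemma tilted_ratio_le (R : realType) (k1 c3 b l e : R) : 0 <= k1 -> 0 <= c3 -> 0 <= e -> 1 <= l ->
  e * (128 * k1 * (l + c3) + 1) * (b ^+ 2 / l) <= e * (128 * k1 * (1 + c3) + 1) * b ^+ 2.
Proof.
move=> k10 c30 e0 l1; have l0 : 0 < l by exact: lt_le_trans l1.
have h : (128 * k1 * (l + c3) + 1) / l <= 128 * k1 * (1 + c3) + 1.
  rewrite ler_pdivrMr//; have : 0 <= k1 * c3 * (l - 1) by rewrite !mulr_ge0// subr_ge0.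
  lra.
have -> : e * (128 * k1 * (l + c3) + 1) * (b ^+ 2 / l) =
    e * ((128 * k1 * (l + c3) + 1) / l) * b ^+ 2 by field; rewrite gt_eqF.
by apply: ler_wpM2r; [exact: sqr_ge0|exact: ler_wpM2l].
Qed.

Lemma isotropic_constant_whp (R : realType) (k1 k4 bb : R) :
    0 < k1 -> 4 <= k4 -> 1 <= bb ->
  exists c C : R, 0 < c /\ 0 < C /\
  forall (d : measure_display) (Omega : measurableType d)
      (P : probability Omega R) (n N : nat) (G : 'I_N -> 'I_n -> Omega -> R),
    (1 <= n)%N -> (2 * n <= N)%N -> (N <= 2 ^ n)%N ->
    mutually_independent P (fun ij : 'I_N * 'I_n => G ij.1 ij.2) ->
    (forall i j, intg P (G i j)) -> (forall i j, intg P (fun w => G i j w ^+ 2)) ->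
    (forall i j, intg P (fun w => G i j w ^+ 4)) ->
    (forall i j, \int[P]_w G i j w = 0) -> (forall i j, \int[P]_w G i j w ^+ 2 = 1) ->
    (forall i j, \int[P]_w G i j w ^+ 4 <= k4) ->
    (forall i j s, intg P (fun w => expR (s * G i j w)) /\
      \int[P]_w expR (s * G i j w) <= expR (k1 * s ^+ 2)) ->
    (forall i j, exists phi : R -> R, [/\ measurable_fun setT phi,
      forall y, `|phi y| <= bb, \int[P]_w phi (G i j w) = 0 &
      \int[P]_w (phi (G i j w) * G i j w) = 1]) ->
    exists E : set Omega, measurable E /\
      E `<=` [set w | let K := sym_conv_hull (fun i => \row_j G i j w) in
                      convex_body K /\ isotropic_constant K < C] /\
      (P E > (1 - C * expR (- c * n%:R))%:E)%E.
Proof.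
move=> k10 k41 bb1.
pose gam : R := (4 * (8 * k4) + 4)^-1.
pose D : R := expR (ln 2 * (Num.truncn (8 * k4 * expR (3 * gam) / gam)).+1%:R).
pose c : R := (6 * bb)^-1; pose al : R := 2 * ln 64 + ln 4 + 1.
(* One summand per lower bound on [tau] required by [cube_sub_hull]. *)
pose tau0 : R := expR 1 + 16 / c + al * (4 * expR 1) + al * (32 * expR (4 * k1)) / (c / 16) ^+ 2.
pose c3 : R := 3 + ln 64.
pose LA : R := Num.sqrt (expR 1 * (128 * k1 * (ln (tau0 ^+ 8) + c3) + 1) * (2 * expR 1 * tau0 ^+ 8)).
pose LB : R := Num.sqrt (expR 1 * (128 * k1 * (1 + c3) + 1) * (30 * bb) ^+ 2).
(* [LA] and [LB] bound the isotropic constant in the two regimes, [D + 2] the failure probability,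
   and [expR gam] settles dimension 1. *)
pose C : R := LA + LB + D + expR gam + 4.
have gam0 : 0 < gam by rewrite invr_gt0; lra.
have gam1 : gam <= 1 by rewrite invf_le1; lra.
have D0 : 0 < D := expR_gt0 _.
have LA0 : 0 <= LA := sqrtr_ge0 _.
have LB0 : 0 <= LB := sqrtr_ge0 _.
have bb0 : 0 < bb by lra.
have c0 : 0 < c by rewrite invr_gt0 mulr_gt0.
have al0 : 0 < al by rewrite ltr_wpDl// addr_ge0 ?mulr_ge0 ?ln_ge0 ?ler1n.
have c30 : 0 <= c3 by rewrite addr_ge0 ?ln_ge0 ?ler1n.
have t1 : 1 <= expR (1 : R) by rewrite -[leLHS]expR0 ler_expR.
have pos1 : 0 <= 16 / c by rewrite divr_ge0// ltW.
have pos2 : 0 <= al * (4 * expR 1) by rewrite !mulr_ge0 ?expR_ge0 ?ltW.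
have pos3 : 0 <= al * (32 * expR (4 * k1)) / (c / 16) ^+ 2.
  by rewrite divr_ge0 ?sqr_ge0// !mulr_ge0 ?expR_ge0 ?ltW.
have tau01 : 1 <= tau0 by rewrite /tau0; lra.
have tau0_e : expR 1 <= tau0 by rewrite /tau0; lra.
have tau0_c : 16 / c <= tau0 by rewrite /tau0; lra.
have tau0_w : al * (4 * expR 1) <= tau0 by rewrite /tau0; lra.
have tau0_d : al * (32 * expR (4 * k1)) / (c / 16) ^+ 2 <= tau0 by rewrite /tau0; lra.
have C_gt : LA + LB < C by rewrite /C; have := expR_gt0 gam; lra.
have C_gt2 : D + 2 < C by rewrite /C; have := expR_gt0 gam; lra.
have C_gt3 : expR gam < C by rewrite /C; lra.
exists gam, C; split => //; split; first exact: lt_trans (expR_gt0 _) C_gt3.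
move=> d Omega P n N G n0 nN N2 indG gi g2i g4i g1 g2 g4 mgf dual.
case: n n0 nN N2 G indG gi g2i g4i g1 g2 g4 mgf dual => [//|[|m]] _ nN N2 G indG gi g2i g4i g1 g2 g4 mgf dual.
  (* For [n = 1] the claimed lower bound [1 - C exp (- gam)] is negative, so the empty event
     suffices. *)
  exists set0; split; first exact: measurable0.
  split; first by [].
  by rewrite measure0 lte_fin mulr1 subr_lt0 -(expRxMexpNx_1 gam) ltr_pM2r ?expR_gt0.
set n := m.+2 in nN N2 G indG gi g2i g4i g1 g2 g4 mgf dual *.
have nn : (0 : R) < n%:R by [].
have nN' : (n <= N)%N by apply: leq_trans nN; rewrite leq_pmull.
have N0 : (0 < N)%N by apply: leq_trans nN'.
pose q : R := N%:R / n%:R.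
have q2 : 2 <= q by rewrite ler_pdivlMr// -natrM ler_nat.
have q1 : 1 <= q by apply: le_trans q2; rewrite ler1n.
have q0 : 0 < q by exact: lt_le_trans q1.
have lq0 : 0 <= ln q by rewrite ln_ge0.
pose M : R := 16 * k1 * n%:R ^+ 2 * (ln q + 3 + ln 64).
have [BU [mBU PBU HU]] := supported_sums_bound indG k10 mgf isT nN'.
have ME : 8 * M / n%:R ^+ 2 + 1 = 128 * k1 * (ln q + c3) + 1.
  by rewrite /M /c3; field; rewrite gt_eqF.
have egn : expR (- n%:R) <= expR (- gam * n%:R) :> R.
  by rewrite ler_expR mulNr lerN2; apply: ler_piMl => //; exact: ltW.
suff [BX [mBX PBX HX]] : exists BX : set Omega, [/\ measurable BX,
    (P BX <= ((D + 1) * expR (- gam * n%:R))%:E)%E &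
    forall w, ~ BX w -> exists A rho, [/\ 0 < rho,
      forall x : 'rV[R]_n, (forall j, `|x 0 j| <= 1) ->
        sym_conv_hull (fun i => \row_j G i j w) (x *m A),
      rho ^+ n <= `|\det A| &
      Num.sqrt (expR 1 * (8 * M / n%:R ^+ 2 + 1) / (rho ^+ 2 * n%:R)) <= LA + LB]].
  exists (~` (BU `|` BX)); split; first by apply: measurableC; exact: measurableU.
  split.
    move=> w /not_orP[nU nX] /=; have [A [rho [rho0 KA detA bound]]] := HX w nX.
    split; first exact: sym_hull_convex_body rho0 KA detA.
    apply: le_lt_trans (isotropic_constant_sym_hull (HU w nU) ltr01 rho0 KA detA) _.
    exact: le_lt_trans bound C_gt.
  have mUX : measurable (BU `|` BX) by exact: measurableU.
  rewrite probability_setC//.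
  have PUX : (P (BU `|` BX) <= ((D + 2) * expR (- gam * n%:R))%:E)%E.
    apply: le_trans (measureU2 _ _ _) _ => //.
    apply: le_trans (leeD PBU PBX) _; rewrite -EFinD lee_fin.
    rewrite [leRHS](_ : _ = expR (- gam * n%:R) + (D + 1) * expR (- gam * n%:R)); last by ring.
    by rewrite lerD2r.
  have -> : P (BU `|` BX) = (fine (P (BU `|` BX)))%:E by rewrite fineK// fin_num_measure.
  rewrite -EFinB lte_fin ltrD2l ltrN2.
  apply: (@le_lt_trans _ _ ((D + 2) * expR (- gam * n%:R))).
    by rewrite -lee_fin fineK// fin_num_measure.
  by rewrite ltr_pM2r ?expR_gt0.
(* The threshold is a constant, so the factor [q] lost by the greedy rows goes into [LA]; above it,
   [tau = q^(1/8)] exceeds [tau0]. *)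
have [qC|qC] := leP q (tau0 ^+ 8).
  have [BX [mBX PBX HX]] := greedy_fails indG gi g2i g4i g1 g2 k41 g4 nN.
  exists BX; split => //.
    apply: le_trans PBX _; rewrite lee_fin -/gam expRD -/D mulNr ler_wpM2r ?expR_ge0//.
    by rewrite lerDl.
  move=> w /HX Q0; have [A [KA detA]] := greedy_cube (isT : (0 < n)%N) N0 Q0.
  exists A, (Num.sqrt (2 * expR 1 * N%:R))^-1; split => //.
    by rewrite invr_gt0 sqrtr_gt0 !mulr_gt0 ?expR_gt0// ltr0n.
  apply: (@le_trans _ _ LA); last by rewrite lerDl.
  apply: ler_wsqrtr.
  rewrite ME exprVn sqr_sqrtr; last by rewrite !mulr_ge0 ?expR_ge0.
  have -> : ((2 * expR 1 * N%:R)^-1 * n%:R)^-1 = 2 * expR 1 * q.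
    by rewrite /q; field; rewrite !gt_eqF ?expR_gt0// ltr0n.
  apply: ler_pM.
  - apply: mulr_ge0; first exact: expR_ge0.
    apply: addr_ge0 => //; apply: mulr_ge0; last exact: addr_ge0.
    by apply: mulr_ge0; [exact: ler0n|exact: ltW].
  - by apply: mulr_ge0; [apply: mulr_ge0; [|exact: expR_ge0]|exact: ltW].
  - apply: ler_wpM2l; first exact: expR_ge0.
    rewrite lerD2r; apply: ler_wpM2l; first by apply: mulr_ge0; [exact: ler0n|exact: ltW].
    rewrite lerD2r; by rewrite ler_ln ?posrE// exprn_gt0// (lt_le_trans ltr01).
  - apply: ler_wpM2l; last exact: qC.
    by apply: mulr_ge0; [exact: ler0n|exact: expR_ge0].
pose tau := q `^ (1 / 8).
have tau8 : tau ^+ 8 = q.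
  rewrite -powR_mulrn ?powR_ge0// -powRrM (_ : 1 / 8 * 8 = 1) ?powRr1 ?(ltW q0)//.
  by field.
have tau_ge : tau0 <= tau.
  rewrite -(@ler_pXn2r _ 8)// ?nnegrE ?powR_ge0//; last exact: le_trans tau01.
  by rewrite tau8 ltW.
have tau1 : 1 <= tau by exact: le_trans tau_ge.
have tau_gt0 : 0 < tau by exact: lt_le_trans tau1.
have tau4 : tau <= tau ^+ 4.
  by rewrite exprS ler_peMr ?powR_ge0// exprn_ege1.
have /choice[phi phiP] : forall ij : 'I_N * 'I_n, exists phi : R -> R,
    [/\ measurable_fun setT phi, forall y, `|phi y| <= bb,
      \int[P]_w phi (G ij.1 ij.2 w) = 0 & \int[P]_w (phi (G ij.1 ij.2 w) * G ij.1 ij.2 w) = 1].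
  by move=> ij; exact: dual.
have tau_e : expR 1 <= tau by exact: le_trans tau_ge.
have tau_c : tau^-1 <= c / 16.
  rewrite -[leRHS]invrK lef_pV2 ?posrE ?invr_gt0 ?divr_gt0//.
  by rewrite invf_div; exact: le_trans tau_ge.
have tau_w : al * (4 * expR 1) <= tau ^+ 4.
  by apply: le_trans tau4; exact: le_trans tau_ge.
have tau_d : al * (32 * expR (4 * k1)) <= tau ^+ 4 * (c / 16) ^+ 2.
  rewrite -ler_pdivrMr ?exprn_gt0 ?divr_gt0//.
  by apply: le_trans tau4; exact: le_trans tau_ge.
have N2' : N%:R <= (2 : R) ^+ n by rewrite -natrX ler_nat.
have [B [mB PB HB]] := @cube_sub_hull _ _ _ P n N G isT N0 indG gi g2i g1 g2 k1 k10 mgf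
  (fun i j => phi (i, j)) bb bb1
  (fun i j => let: And4 h _ _ _ := phiP (i, j) in h)
  (fun i j => let: And4 _ h _ _ := phiP (i, j) in h)
  (fun i j => let: And4 _ _ h _ := phiP (i, j) in h)
  (fun i j => let: And4 _ _ _ h := phiP (i, j) in h)
  tau tau8 tau_e tau_c tau_w tau_d N2'.
exists B; split => //.
  apply: le_trans PB _; rewrite lee_fin; apply: le_trans egn _.
  by rewrite ler_peMl ?expR_ge0// lerDr ltW.
have lq1 : 1 <= ln q.
  have h1 : 1 <= ln tau by rewrite -(expRK 1) ler_ln ?posrE ?expR_gt0.
  rewrite -tau8 lnXn// mulrS; apply: (le_trans h1).
  by rewrite lerDl mulrn_wge0// ln_ge0.
have lq_gt0 : 0 < ln q by exact: lt_le_trans lq1.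
have sq0 : 0 < Num.sqrt (ln q / n%:R) by rewrite sqrtr_gt0 divr_gt0.
move=> w /HB KA; exists (Num.sqrt (ln q / n%:R) / (30 * bb))%:M, (Num.sqrt (ln q / n%:R) / (30 * bb)).
have rho0 : 0 < Num.sqrt (ln q / n%:R) / (30 * bb) by rewrite divr_gt0// mulr_gt0.
split => //; first by rewrite det_scalar ger0_norm// exprn_ge0// ltW.
apply: (@le_trans _ _ LB); last by rewrite lerDr.
apply: ler_wsqrtr.
rewrite ME expr_div_n sqr_sqrtr; last by rewrite divr_ge0// ltW.
have -> : (ln q / n%:R / (30 * bb) ^+ 2 * n%:R)^-1 = (30 * bb) ^+ 2 / ln q.
  by field; rewrite !gt_eqF.
by apply: tilted_ratio_le => //; exact: ltW.
Qed.

Theorem theorem3p2 (R : realType) :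
  exists c C : R, 0 < c /\ 0 < C /\
  forall (d : measure_display) (Omega : measurableType d)
         (P : probability Omega R) (n N : nat)
         (G : 'I_N -> 'I_n -> Omega -> R),
    (1 <= n)%N -> (2 * n <= N)%N -> (N <= 2 ^ n)%N ->
    mutually_independent P (fun ij : 'I_N * 'I_n => G ij.1 ij.2) ->
    (forall i j,
       expectation P (G i j) = 0%E /\
       expectation P (fun w => G i j w ^+ 2) = 1%E /\
       (expectation P (fun w => expR (G i j w ^+ 2 / 10)) <= 10%:E)%E) ->
    exists E : set Omega, measurable E /\
      E `<=` [set w | let K := sym_conv_hull (fun i => \row_j G i j w) in
                      convex_body K /\ isotropic_constant K < C] /\
      (P E > (1 - C * expR (- c * n%:R))%:E)%E.
Proof.
(* The three constants are those of [subg_mgf], [subg_pow4] and [subg_dual]. *)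
have e5 : 0 < 200 * expR 5 :> R by rewrite mulr_gt0 ?expR_gt0.
have k4 : 4 <= 4000 :> R by lra.
have b1 : 1 <= 360 :> R by lra.
have [c [C [c0 [C0 H]]]] := isotropic_constant_whp e5 k4 b1.
exists c, C; split => //; split => // d Omega P n N G n1 nN N2 indG hG.
have mG i j : measurable_fun setT (G i j) by exact: (indG.1 (i, j)).
apply: H => // i j; have [h1 [h2 h3]] := hG i j.
- exact: subg_intg (mG i j) h3.
- exact: subg_sqr_intg (mG i j) h3.
- exact: (subg_pow4 (mG i j) h3).1.
- exact: subg_mean h1.
- exact: subg_var h2.
- exact: (subg_pow4 (mG i j) h3).2.
- exact: subg_mgf (mG i j) h1 h3.
- exact: subg_dual (mG i j) h1 h2 h3.
Qed.
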